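(* Let $(-A,B,C)$ be a continuous time linear system with state space $H$ and input and output space $\mathbb{C}$, where $A$ has dense domain and is maximally accretive, and suppose that $C(sI+A)^{-1}\in H^2(RHP;H')$ and $(sI+A)^{-1}B\in H^2(RHP;H)$. Let $\phi(t)=Ce^{-tA}B$ be the impulse response function, let $R_x=\int_x^\infty e^{-tA}BCe^{-tA}\,dt$, suppose that $I+R_x$ is invertible, and let $$T_{GL}(x,y)=-Ce^{-xA}(I+R_x)^{-1}e^{-yA}B,\qquad x,y\ge0.$$ Then $T_{GL}$ satisfies the Gelfand--Levitan equation $$\phi(x+y)+T_{GL}(x,y)+\int_x^\infty T_{GL}(x,z)\phi(z+y)\,dz=0,$$ and $$\frac{d}{dx}\log\det(I+R_x)=\mathrm{trace}\,T_{GL}(x,x).$$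
   Context: $H$ is a separable complex Hilbert space, $H'=\mathcal{L}(H;\mathbb{C})$, $B:\mathbb{C}\to H$ and $C:H\to\mathbb{C}$ are bounded linear, and $-A$ generates a strongly continuous contraction semigroup $(e^{-tA})_{t\ge0}$ on $H$. $RHP=\{s:\Re s>0\}$ and $H^2(RHP;E)$ is the $E$-valued Hardy space on $RHP$. Under these hypotheses each $R_x$ ($x\ge0$) is trace class and $\det(I+R_x)$ is the Fredholm determinant. Since input and output spaces are $\mathbb{C}$, $T_{GL}(x,y)$ is scalar and the trace of a scalar is itself. *)

(* Defs.v *)
From HB Require Import structures.
From mathcomp Require Import all_boot all_order all_algebra.
From mathcomp Require Import complex ring.
From mathcomp Require Import all_classical all_reals all_analysis.

Set Implicit Arguments.
Unset Strict Implicit.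
Unset Printing Implicit Defensive.

Import Order.TTheory GRing.Theory Num.Theory.
Import numFieldNormedType.Exports.

Local Open Scope classical_set_scope.
Local Open Scope ring_scope.
Local Open Scope complex_scope.

(* [R[i]] with the topology and norm it has as a normed module over itself. *)
HB.instance Definition _ (R : realType) := NormedModule.copy R[i] R[i]^o.

(* Norms in a complex normed module take their values in [R[i]]. *)
Definition rnorm (R : realType) (V : normedModType R[i]) (v : V) : R :=
  complex.Re `|v|.

Lemma rnormE (R : realType) (V : normedModType R[i]) (v : V) :
  `|v| = (rnorm v)%:C.
Proof.
rewrite /rnorm; have := normr_ge0 v; case: (`|v|) => a b.
by rewrite lecE /= => /andP[/eqP-> _].
Qed.

Section Dual.
Context (R : realType) (H : normedModType R[i]).

(* The dual [H' = L(H; C)], normed by the operator norm. *)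
Definition bounded_functional : {pred (H -> R[i])} :=
  fun f => `[< linear f /\ continuous f >].

Lemma bounded_functional_submod : submod_closed bounded_functional.
Proof.
split=> [|a f g].
  apply/asboolP; split; last exact: cst_continuous.
  by move=> a u v; rewrite /GRing.zero/= /GRing.scale/= mulr0 addr0.
move=> /asboolP[lf cf] /asboolP[lg cg]; apply/asboolP; split.
  have E w : (a *: f + g) w = a * f w + g w by [].
  by move=> b u v; rewrite !E lf lg /GRing.scale/=; ring.
move=> v; apply: continuousD; last exact: cg.
by apply: continuousZr; exact: cf.
Qed.

HB.instance Definition _ :=
  GRing.isSubmodClosed.Build R[i] (H -> R[i]) bounded_functional
    bounded_functional_submod.

Record dual := Dual {
  dual_fun :> H -> R[i] ;
  dual_funP : dual_fun \in bounded_functional }.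

HB.instance Definition _ := [isSub for dual_fun].
HB.instance Definition _ := [Choice of dual by <:].
HB.instance Definition _ := [SubChoice_isSubLmodule of dual by <:].

Definition opnorm (f : dual) : R :=
  sup [set rnorm (f v) | v in [set v : H | rnorm v <= 1]].

Lemma rnorm_ge0 (V : normedModType R[i]) (v : V) : 0 <= rnorm v.
Proof. by have := normr_ge0 v; rewrite rnormE ler0c. Qed.

Lemma ler_rnormD (V : normedModType R[i]) (u v : V) :
  rnorm (u + v) <= rnorm u + rnorm v.
Proof. by have := ler_normD u v; rewrite !rnormE -rmorphD lecE => /andP[]. Qed.

Lemma rnormZ (V : normedModType R[i]) (a : R[i]) (v : V) :
  rnorm (a *: v) = rnorm a * rnorm v.
Proof. by apply: complexI; rewrite -rnormE normrZ !rnormE -rmorphM. Qed.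

Lemma dual_linear (f : dual) : linear f.
Proof. by have /asboolP[] := dual_funP f. Qed.

HB.instance Definition _ (f : dual) :=
  GRing.isLinear.Build R[i] H R[i] _ (dual_fun f) (dual_linear f).

Lemma dual_continuous (f : dual) : continuous f.
Proof. by have /asboolP[] := dual_funP f. Qed.

Lemma opnorm_has_sup (f : dual) :
  has_sup [set rnorm (f v) | v in [set v : H | rnorm v <= 1]].
Proof.
split.
  by exists (rnorm (f 0)), 0 => //=; rewrite /rnorm normr0 ler01.
have [M [Mr HM]] := (linear_boundedP (dual_fun f)).1
  (@continuous_linear_bounded _ _ _ 0 (dual_fun f) (@dual_continuous f 0)).
have M1 : M < `|M| + 1.
  by rewrite (le_lt_trans (real_ler_norm Mr))// ltrDl ltr01.
exists (complex.Re (`|M| + 1)) => _ [v /= v1 <-].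
have : `|f v| <= (`|M| + 1) * 1.
  apply: (le_trans (HM _ M1 v)).
  apply: ler_wpM2l; first by rewrite addr_ge0// ler01.
  by rewrite rnormE lecE/= eqxx.
by rewrite mulr1 rnormE lecE => /andP[].
Qed.

Lemma rnorm_eq0 (V : normedModType R[i]) (v : V) : rnorm v = 0 -> v = 0.
Proof. by move=> v0; apply/eqP; rewrite -normr_eq0 rnormE v0. Qed.

Lemma opnorm_le (f : dual) (M : R) :
  (forall v, rnorm v <= 1 -> rnorm (f v) <= M) -> opnorm f <= M.
Proof.
move=> fM; apply: ge_sup => [|_ [v v1 <-]]; last exact: fM.
exact: (opnorm_has_sup f).1.
Qed.

Lemma opnorm_ub (f : dual) v : rnorm v <= 1 -> rnorm (f v) <= opnorm f.
Proof.
move=> v1; apply: ub_le_sup; first exact: (opnorm_has_sup f).2.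
by exists v.
Qed.

Lemma ler_opnormD (f g : dual) : opnorm (f + g) <= opnorm f + opnorm g.
Proof.
apply: opnorm_le => v v1; apply: le_trans (lerD (opnorm_ub f v1) (opnorm_ub g v1)).
exact: ler_rnormD.
Qed.

Lemma opnormZ_le (a : R[i]) (f : dual) : opnorm (a *: f) <= rnorm a * opnorm f.
Proof.
apply: opnorm_le => v v1; rewrite [X in rnorm X](_ : _ = a *: f v)// rnormZ.
by rewrite ler_wpM2l ?rnorm_ge0// opnorm_ub.
Qed.

Lemma opnormZ (a : R[i]) (f : dual) : opnorm (a *: f) = rnorm a * opnorm f.
Proof.
apply/eqP; rewrite eq_le opnormZ_le/=.
have [->|a0] := eqVneq a 0.
  rewrite /rnorm normr0 mul0r (le_trans (rnorm_ge0 ((0 *: f) 0)))//.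
  by rewrite opnorm_ub// /rnorm normr0 ler01.
have na0 : 0 < rnorm a.
  by rewrite lt_neqAle rnorm_ge0 andbT eq_sym; apply: contra_neq a0 => /rnorm_eq0.
have := opnormZ_le a^-1 (a *: f); rewrite scalerA mulVf// scale1r.
rewrite -(ler_pM2l na0) mulrA -(@rnormZ R[i]).
have -> : a *: a^-1 = 1 :> R[i] by exact: mulfV.
have -> : rnorm (1 : R[i]) = 1 by rewrite /rnorm normr1.
by rewrite mul1r.
Qed.

Lemma opnorm_eq0 (f : dual) : opnorm f = 0 -> f = 0.
Proof.
move=> f0; apply/val_inj/funext => v /=.
have [->|v0] := eqVneq v 0; first by rewrite linear0.
have nv0 : `|v| != 0 by rewrite normr_eq0.
have : f (`|v|^-1 *: v) = 0.
  apply/rnorm_eq0/eqP; rewrite eq_le rnorm_ge0 andbT -f0 opnorm_ub//.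
  by rewrite /rnorm normrZ normfV normr_id mulVf.
by rewrite linearZ => /eqP; rewrite scaler_eq0 invr_eq0 (negPf nv0) => /eqP.
Qed.

Definition dual_norm (f : dual) : R[i] := (opnorm f)%:C.

Lemma ler_dual_normD (f g : dual) :
  dual_norm (f + g) <= dual_norm f + dual_norm g.
Proof. by rewrite /dual_norm -rmorphD lecR ler_opnormD. Qed.

Lemma dual_normZ (a : R[i]) (f : dual) :
  dual_norm (a *: f) = `|a| * dual_norm f.
Proof. by rewrite /dual_norm opnormZ [`|a|]rnormE -rmorphM. Qed.

Lemma dual_norm_eq0 (f : dual) : dual_norm f = 0 -> f = 0.
Proof. by move=> /(@complexI R) /opnorm_eq0. Qed.

HB.instance Definition _ := Lmodule_isNormed.Build R[i] dual
  ler_dual_normD dual_normZ dual_norm_eq0.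

End Dual.

Definition separable (T : topologicalType) : Prop :=
  exists2 A : set T, countable A & dense A.

Section ComplexIntegral.
Context (R : realType).
Local Notation mu := (@lebesgue_measure R).

Definition cintegrable (D : set R) (f : R -> R[i]) : Prop :=
  mu.-integrable D (EFin \o (fun t => complex.Re (f t))) /\
  mu.-integrable D (EFin \o (fun t => complex.Im (f t))).

Definition cintegral (D : set R) (f : R -> R[i]) : R[i] :=
  Rintegral mu D (fun t => complex.Re (f t)) +i*
  Rintegral mu D (fun t => complex.Im (f t)).

Definition cexp (z : R[i]) : R[i] :=
  (expR (complex.Re z))%:C *
  (cos (complex.Im z) +i* sin (complex.Im z)).

(* [log f] has derivative [l] at the point [x] of [0, +oo[, where [log f] is
   any determination of the logarithm of [f] near [x] that is differentiable
   at [x]; two of them differ by a constant near [x].  At [x = 0] the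
   derivative is one-sided. *)
Definition has_log_derivative (f : R -> R[i]) (x : R) (l : R[i]) : Prop :=
  exists L : R -> R[i],
    (\forall y \near x, 0 <= y -> cexp (L y) = f y) /\
    (h^-1)%:C * (L (x + h) - L x) @[h --> within [set h | 0 <= x + h] 0^'] --> l.

(* [H^2(RHP; E)], for functions on the plane of which only the values on the
   open right half-plane matter. *)
Definition hardy2 (E : normedModType R[i]) (F : R[i] -> E) : Prop :=
  (forall s, 0 < complex.Re s -> derivable F s 1) /\
  (ereal_sup [set \int[mu]_w ((rnorm (F (sigma +i* w))) ^+ 2)%:E
             | sigma in [set sigma : R | (0 < sigma)%R]] < +oo)%E.

End ComplexIntegral.

Section Operators.
Context (R : realType) (H : completeNormedModType R[i]).
Context (dot : {dot H for Num.conj}).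
Local Notation mu := (@lebesgue_measure R).

(* Bochner integral.  When [H] is separable, weak measurability is strong
   measurability, so the first two conditions say that [f] is Bochner
   integrable on [D]. *)
Definition is_bochner (D : set R) (f : R -> H) (u : H) : Prop :=
  [/\ forall w, cintegrable D (fun t => dot (f t) w),
      (\int[mu]_(t in D) (rnorm (f t))%:E < +oo)%E &
      forall w, dot u w = cintegral D (fun t => dot (f t) w)].

Definition bochner (D : set R) (f : R -> H) : H := xget 0 (is_bochner D f).

Definition bounded_invertible (T : H -> H) : Prop :=
  exists J : {linear H -> H}, [/\ continuous J, cancel T J & cancel J T].

Definition opinv (T : H -> H) (v : H) : H := xget 0 [set u | T u = v].

(* Unbounded operators are pairs [(D, A)]: the values of [A] off its domain [D]
   are irrelevant. *)
Definition linear_operator (D : set H) (A : H -> H) : Prop :=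
  D 0 /\ forall (a : R[i]) u v, D u -> D v ->
    D (a *: u + v) /\ A (a *: u + v) = a *: A u + A v.

Definition accretive (D : set H) (A : H -> H) : Prop :=
  forall v, D v -> 0 <= complex.Re (dot (A v) v).

Definition maximally_accretive (D : set H) (A : H -> H) : Prop :=
  accretive D A /\
  forall D' A', linear_operator D' A' -> accretive D' A' ->
    D `<=` D' -> (forall v, D v -> A' v = A v) -> D' `<=` D.

(* [(s I + A)^-1] *)
Definition resolvent (D : set H) (A : H -> H) (s : R[i]) (v : H) : H :=
  xget 0 [set u | D u /\ s *: u + A u = v].

(* Only the values of [S] on [0, +oo[ are constrained. *)
Definition contraction_semigroup (S : R -> {linear H -> H}) : Prop :=
  [/\ forall v, S 0 v = v,
      forall s t v, 0 <= s -> 0 <= t -> S (s + t) v = S s (S t v),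
      forall t v, 0 <= t -> `|S t v| <= `|v| &
      forall v, {within `[0, +oo[, continuous (fun t => S t v)}].

Definition generates (D : set H) (G : H -> H) (S : R -> {linear H -> H}) :
    Prop :=
  forall v w, (D v /\ G v = w) <->
    (t^-1)%:C *: (S t v - v) @[t --> 0^'+] --> w.

(* In finite dimension an orthonormal basis is padded with zero vectors. *)
Definition orthonormal_basis (e : nat -> H) : Prop :=
  [/\ forall i j, i != j -> dot (e i) (e j) = 0,
      forall i, dot (e i) (e i) = 1 \/ e i = 0 &
      forall v, (forall i, dot v (e i) = 0) -> v = 0].

(* Absolutely convergent sums of operators of rank at most one; the trace norm
   is the infimum of the sums of the norms over all such representations. *)
Definition trace_class (T : H -> H) : Prop :=
  exists a b : nat -> H,
    cvgn (series (fun n => rnorm (a n) * rnorm (b n))) /\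
    forall v, series (fun n => dot v (b n) *: a n) @ \oo --> T v.

(* [det (I + T)] for [T] of trace class is the limit of the determinants of
   [I + P_n T P_n], where [P_n] projects on the first [n] vectors of an
   orthonormal basis; the limit does not depend on the basis.  It is also the
   sum over [k] of the traces of the exterior powers [/\^k T]. *)
Definition is_fredholm_det (T : H -> H) (d : R[i]) : Prop :=
  trace_class T /\
  forall e, orthonormal_basis e ->
    \det (1%:M + \matrix_(i < n, j < n) dot (T (e j)) (e i)) @[n --> \oo] --> d.

Definition fredholm_det (T : H -> H) : R[i] := xget 0 (is_fredholm_det T).

End Operators.

(* [S t] stands for [exp (- t A)]. *)
Section LinearSystem.
Context (R : realType) (H : completeNormedModType R[i]).
Context (dot : {dot H for Num.conj}).
Context (S : R -> {linear H -> H}).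
Context (B : {linear R[i] -> H}) (C : {linear H -> R[i]}).

Definition impulse (t : R) : R[i] := C (S t (B 1)).

Definition Rop (x : R) (v : H) : H :=
  bochner dot `[x, +oo[ (fun t => S t (B (C (S t v)))).

Definition I_Rop (x : R) (v : H) : H := v + Rop x v.

(* The operator from [C] to [C] is identified with its value at [1]. *)
Definition TGL (x y : R) : R[i] := - C (S x (opinv (I_Rop x) (S y (B 1)))).

End LinearSystem.

(* Main.v *)
(* Put b_t = exp(- t A) B and let c_t be the vector with <v, c_t> = C exp(- t A) v, so
   that R_x is the integral over [x, +oo[ of the rank one operators <., c_t> b_t.

   The resolvent applied to B is the Laplace transform of b_t.  Its squared norm at
   sigma + i w is a cosine plus sine transform in w of functions of which the first takes
   the value int exp(- 2 sigma t) |b_t|^2 dt at 0; averaging against a Fejer kernel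
   recovers that value, so that the H^2 hypotheses bound int |b_t|^2 dt, and likewise
   int |c_t|^2 dt.  Hence |b_t| |c_t|, which is a product of decreasing functions, is
   integrable and R_x is a convergent sum of integrals over unit intervals, each of
   which is nuclear because b_t is uniformly continuous.

   The functional v |-> - C exp(- x A) (I + R_x)^-1 v can be pulled through the integral
   defining R_x, which gives the Gelfand-Levitan equation.  In trace norm
   R_(x + h) = R_x - h <., c_x> b_x + o(h), and the determinant is locally Lipschitz for
   the trace norm, so the matrix determinant lemma gives
   det (I + R_(x + h)) = det (I + R_x) (1 - h <(I + R_x)^-1 b_x, c_x>) + o(h), where the
   inner product is - T(x, x). *)
Require Import Defs.
From mathcomp Require Import all_boot all_order all_algebra.
From mathcomp Require Import complex ring lra.
From mathcomp Require Import all_classical all_reals all_analysis.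
From mathcomp Require Import spectral measurable_realfun.

Set Implicit Arguments.
Unset Strict Implicit.
Unset Printing Implicit Defensive.

Import Order.TTheory GRing.Theory Num.Theory.
Import numFieldNormedType.Exports.

Local Open Scope classical_set_scope.
Local Open Scope ring_scope.
Local Open Scope complex_scope.

(** * Complex scalars, sequences and inner products *)

(** $R_x$ is known only through a weak integral and its determinant only as a limit of compressions.
    Operators are therefore handled as forms $\langle Tv,w\rangle$ that are absolutely convergent
    sums of rank one forms; every determinant estimate is proved for the compressed matrices with
    constants free of their size, and then passes to the limit.

    Compression is not multiplicative, so the matrix determinant lemma and the nonvanishing of
    $\det(I+R_x)$, without which there is no logarithm, are obtained up to errors small in trace
    norm. The nonvanishing comes from the bounded inverse $J$ of $I+R_x$, since $J-I=-JR_x$ is again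
    nuclear.

    On the analytic side, the squared norm of the Laplace transform $L$ of $b_t$ is reduced to a
    single scalar integral: with $V_t=e^{-\sigma t}e^{-tA}$, $q(u,v)=\int_0^\infty\langle
    V_tu,V_tv\rangle\,dt$ and $q(u,b)=\langle u,Z\rangle$ one has $|L|^2=2\Re\langle L,Z\rangle$.
    This replaces a vector valued Plancherel theorem. The constant [cos 1] in the resulting bound
    comes from a crude lower estimate of the Fejer kernel near the origin. *)

Section ComplexScalars.
Context (R : realType).
Implicit Types (z w : R[i]) (a : R).

Lemma rnorm_realc a : rnorm (a%:C : R[i]) = `|a|.
Proof. by rewrite /rnorm normc_def /= expr0n /= addr0 sqrtr_sqr. Qed.

Lemma rnormM z w : rnorm (z * w) = rnorm z * rnorm w.
Proof. exact: (@rnormZ _ R[i]). Qed.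

Lemma rnorm_sqrE z : rnorm z ^+ 2 = complex.Re z ^+ 2 + complex.Im z ^+ 2.
Proof.
by rewrite /rnorm normc_def /= sqr_sqrtr // addr_ge0 ?sqr_ge0.
Qed.

Lemma rnorm_conj z : rnorm (conjc z) = rnorm z.
Proof. by rewrite /rnorm normcJ. Qed.

Lemma Re_le_rnorm z : `|complex.Re z| <= rnorm z.
Proof.
by rewrite -ler_sqr ?nnegrE ?rnorm_ge0 // rnorm_sqrE real_normK ?num_real //
  lerDl sqr_ge0.
Qed.

Lemma Im_le_rnorm z : `|complex.Im z| <= rnorm z.
Proof.
by rewrite -ler_sqr ?nnegrE ?rnorm_ge0 // rnorm_sqrE real_normK ?num_real //
  lerDr sqr_ge0.
Qed.

Lemma rnorm_le_ReIm z : rnorm z <= `|complex.Re z| + `|complex.Im z|.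
Proof.
rewrite -ler_sqr ?nnegrE ?rnorm_ge0 ?addr_ge0 // rnorm_sqrE sqrrD !real_normK ?num_real //.
by rewrite addrAC lerDl mulrn_wge0 // mulr_ge0.
Qed.

Lemma rnorm1 : rnorm (1 : R[i]) = 1.
Proof. by rewrite /rnorm normr1. Qed.

Lemma rnorm_prod I (r : seq I) (P : pred I) (F : I -> R[i]) :
  rnorm (\prod_(i <- r | P i) F i) = \prod_(i <- r | P i) rnorm (F i).
Proof.
apply: (big_morph (fun z : R[i] => rnorm z)); [exact: rnormM | exact: rnorm1].
Qed.

Lemma cnorm0 : rnorm (0 : R[i]) = 0.
Proof. by rewrite /rnorm normr0. Qed.

Lemma cnormN z : rnorm (- z) = rnorm z.
Proof. by rewrite /rnorm normrN. Qed.

Lemma cnormB z w : rnorm (z - w) = rnorm (w - z).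
Proof. by rewrite /rnorm distrC. Qed.

Lemma ler_cnormD z w : rnorm (z + w) <= rnorm z + rnorm w.
Proof. exact: ler_rnormD. Qed.

Lemma ler_cnormB z w : rnorm (z - w) <= rnorm z + rnorm w.
Proof. by rewrite -(cnormN w) ler_cnormD. Qed.

Lemma ler_cnorm_sum I (r : seq I) (P : pred I) (F : I -> R[i]) :
  rnorm (\sum_(i <- r | P i) F i) <= \sum_(i <- r | P i) rnorm (F i).
Proof.
elim/big_ind2: _ => [|x a y b xa yb|//]; first by rewrite cnorm0.
exact: le_trans (ler_cnormD _ _) (lerD xa yb).
Qed.

Lemma ReD z w : complex.Re (z + w) = complex.Re z + complex.Re w.
Proof. by case: z w => [a b] [c d]. Qed.

Lemma ImD z w : complex.Im (z + w) = complex.Im z + complex.Im w.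
Proof. by case: z w => [a b] [c d]. Qed.

Lemma ReN z : complex.Re (- z) = - complex.Re z.
Proof. by case: z. Qed.

Lemma ImN z : complex.Im (- z) = - complex.Im z.
Proof. by case: z. Qed.

Lemma ReM z w :
  complex.Re (z * w) = complex.Re z * complex.Re w - complex.Im z * complex.Im w.
Proof. by case: z w => [a b] [c d]. Qed.

Lemma ImM z w :
  complex.Im (z * w) = complex.Re z * complex.Im w + complex.Im z * complex.Re w.
Proof. by case: z w => [a b] [c d] /=; rewrite addrC. Qed.

Lemma Re_conj z : complex.Re (conjc z) = complex.Re z.
Proof. by case: z. Qed.

Lemma Im_conj z : complex.Im (conjc z) = - complex.Im z.
Proof. by case: z. Qed.

Lemma complex_eqP z w :
  complex.Re z = complex.Re w -> complex.Im z = complex.Im w -> z = w.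
Proof. by case: z w => [a b] [c d] /= -> ->. Qed.

Lemma conj_mulE z : conjc z * z = (rnorm z ^+ 2)%:C.
Proof. by apply: complex_eqP; rewrite ?rnorm_sqrE; case: z => a b /=; ring. Qed.

End ComplexScalars.

Section RealNorm.
Context (R : realType) (V : normedModType R[i]).
Implicit Types u v : V.

Lemma rnorm0 : rnorm (0 : V) = 0.
Proof. by rewrite /rnorm normr0. Qed.

Lemma rnormN v : rnorm (- v) = rnorm v.
Proof. by rewrite /rnorm normrN. Qed.

Lemma rnormB u v : rnorm (u - v) = rnorm (v - u).
Proof. by rewrite /rnorm distrC. Qed.

Lemma ler_rnormB u v : rnorm (u - v) <= rnorm u + rnorm v.
Proof. by rewrite -(rnormN v) ler_rnormD. Qed.

Lemma ler_rnorm_dist w u v : rnorm (u - v) <= rnorm (u - w) + rnorm (w - v).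
Proof. by have := ler_rnormD (u - w) (w - v); rewrite addrA subrK. Qed.

Lemma ler_rnormE u v : (`|u| <= `|v|) = (rnorm u <= rnorm v).
Proof. by rewrite !rnormE lecR. Qed.

Lemma cvg_rnormP (T : Type) (F : set_system T) (FF : Filter F) (f : T -> V) l :
  f @ F --> l <-> forall e : R, 0 < e -> \forall t \near F, rnorm (l - f t) < e.
Proof.
split=> [/cvgrPdist_lt fl e e0|fl].
  have /fl : (0 : R[i]) < e%:C by rewrite ltcR.
  by apply: filterS => t; rewrite rnormE ltcR.
(* A positive element of [R[i]] has zero imaginary part, so complex tolerances reduce to real
   ones. *)
apply/cvgrPdist_lt => -[a b]; rewrite ltcE/= => /andP[/eqP-> a0].
by apply: filterS (fl _ a0) => t h; rewrite rnormE complexr0 ltcR.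
Qed.

Lemma cvg_seq_rnormP (f : nat -> V) l :
  f @ \oo --> l <->
  forall e : R, 0 < e -> exists N, forall n, (N <= n)%N -> rnorm (l - f n) < e.
Proof.
rewrite cvg_rnormP; split=> h e /h.
  by case=> N _ hN; exists N => n Nn; apply: hN.
by case=> N hN; exists N.
Qed.

Lemma near_realP (a : R) (P : R -> Prop) :
  (\forall t \near a, P t) <->
  exists2 d : R, 0 < d & forall t, `|a - t| < d -> P t.
Proof.
split=> [/nbhs_ballP[d d0 h]|[d d0 h]]; first by exists d => // t ?; apply: h.
by apply/nbhs_ballP; exists d.
Qed.

End RealNorm.

Section Tends.
Context (R : realType) (V : normedModType R[i]).
Implicit Types (f g : nat -> V) (l m : V).

(* Sequential convergence with real epsilons: it avoids the competing topologies
   that [R[i]] inherits as a field and as a module. *)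
Definition tends f l := forall e : R, 0 < e ->
  exists N, forall n, (N <= n)%N -> rnorm (l - f n) < e.

Lemma tendsP f l : f @ \oo --> l <-> tends f l.
Proof. exact: cvg_seq_rnormP. Qed.

Lemma tends_near_cst f l N : (forall n, (N <= n)%N -> f n = l) -> tends f l.
Proof. by move=> h e e0; exists N => n /h ->; rewrite subrr rnorm0. Qed.

Lemma tends_unique f l m : tends f l -> tends f m -> l = m.
Proof.
move=> fl fm; apply/eqP; rewrite -subr_eq0; apply/eqP/rnorm_eq0/eqP.
rewrite eq_le rnorm_ge0 andbT; apply/ler_addgt0Pl => e e0; rewrite addr0.
have e2 : 0 < e / 2 by rewrite divr_gt0.
have [N hN] := fl _ e2; have [M hM] := fm _ e2.
pose n := maxn N M.
have := hN n (leq_maxl _ _); have := hM n (leq_maxr _ _).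
have := ler_rnorm_dist (f n) l m; rewrite (rnormB (f n) m); lra.
Qed.

Lemma tendsD f g l m : tends f l -> tends g m -> tends (fun n => f n + g n) (l + m).
Proof.
move=> fl gm e e0.
have e2 : 0 < e / 2 by rewrite divr_gt0.
have [N hN] := fl _ e2; have [M hM] := gm _ e2.
exists (maxn N M) => n; rewrite geq_max => /andP[/hN h1 /hM h2].
by rewrite opprD addrACA; have := ler_rnormD (l - f n) (m - g n); lra.
Qed.

Lemma tendsN f l : tends f l -> tends (fun n => - f n) (- l).
Proof.
move=> fl e /fl[N hN]; exists N => n /hN.
by rewrite -opprD rnormN.
Qed.

Lemma tends_bound f l (M : R) : tends f l -> (forall n, rnorm (f n) <= M) -> rnorm l <= M.
Proof.
move=> fl fM; apply/ler_addgt0Pr => e /fl[N /(_ N (leqnn _)) h].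
by have := ler_rnormD (l - f N) (f N); rewrite subrK; have := fM N; lra.
Qed.

Lemma tends_bounded f l : tends f l -> exists (N : nat) (M : R),
  (0 <= M) /\ forall n, (N <= n)%N -> rnorm (f n) <= M.
Proof.
move=> /(_ 1 ltr01)[N hN]; exists N, (rnorm l + 1); split.
  by rewrite addr_ge0 ?rnorm_ge0.
move=> n /hN; have := ler_rnormB l (l - f n); rewrite subKr; lra.
Qed.

Lemma tends_shift f l k : tends f l -> tends (fun n => f (n + k)%N) l.
Proof. by move=> fl e /fl[N hN]; exists N => n Nn; apply: hN; rewrite (leq_trans Nn) ?leq_addr. Qed.

End Tends.

Lemma tendsM (R : realType) (f g : nat -> R[i]) l m :
  tends f l -> tends g m -> tends (fun n => f n * g n) (l * m).
Proof.
move=> fl gm e e0; have [N1 [M [M0 hM]]] := tends_bounded gm.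
pose L := rnorm l + M + 1.
have L0 : 0 < L by rewrite /L; have := rnorm_ge0 l; lra.
have eL : 0 < e / (2 * L) by rewrite divr_gt0 // mulr_gt0.
have [N2 h2] := fl _ eL; have [N3 h3] := gm _ eL.
exists (maxn N1 (maxn N2 N3)) => n; rewrite !geq_max => /and3P[/hM b1 /h2 b2 /h3 b3].
have -> : l * m - f n * g n = (l - f n) * g n + l * (m - g n).
  by ring.
have -> : e = e / (2 * L) * L + L * (e / (2 * L)) by field; lra.
apply: le_lt_trans (ler_cnormD _ _) _; rewrite !rnormM.
apply: ltr_leD.
  apply: le_lt_trans (_ : rnorm (l - f n) * L < _); last by rewrite ltr_pM2r.
  by apply: ler_wpM2l; rewrite ?rnorm_ge0 // /L; have := rnorm_ge0 l; lra.
by apply: ler_pM; rewrite ?rnorm_ge0 ?(ltW b3) // /L; lra.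
Qed.

Lemma tends_sum (R : realType) (V : normedModType R[i]) I (r : seq I) (P : pred I)
    (f : I -> nat -> V) (l : I -> V) :
  (forall i, P i -> tends (f i) (l i)) ->
  tends (fun n => \sum_(i <- r | P i) f i n) (\sum_(i <- r | P i) l i).
Proof.
move=> h; elim: r => [|i r ih].
  by apply: (@tends_near_cst _ _ _ _ 0) => n _; rewrite !big_nil.
rewrite big_cons; have -> : (fun n => \sum_(j <- i :: r | P j) f j n) =
    (fun n => if P i then f i n + \sum_(j <- r | P j) f j n
              else \sum_(j <- r | P j) f j n).
  by apply/funext => n; rewrite big_cons.
by case: ifPn => // /h fi; exact: tendsD.
Qed.

Lemma tends_prod (R : realType) I (r : seq I) (P : pred I)
    (f : I -> nat -> R[i]) (l : I -> R[i]) :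
  (forall i, P i -> tends (f i) (l i)) ->
  tends (fun n => \prod_(i <- r | P i) f i n) (\prod_(i <- r | P i) l i).
Proof.
move=> h; elim: r => [|i r ih].
  by apply: (@tends_near_cst _ _ _ _ 0) => n _; rewrite !big_nil.
rewrite big_cons; have -> : (fun n => \prod_(j <- i :: r | P j) f j n) =
    (fun n => if P i then f i n * \prod_(j <- r | P j) f j n
              else \prod_(j <- r | P j) f j n).
  by apply/funext => n; rewrite big_cons.
by case: ifPn => // /h fi; exact: tendsM.
Qed.

Section Hilbert.
Context (R : realType) (H : completeNormedModType R[i]).
Context (dot : {dot H for Num.conj}).
Hypothesis H_hilbert : forall v : H, `|v| ^+ 2 = dot v v.
Implicit Types u v w : H.

Definition inner (u v : H) : R[i] := dot u v.
Local Notation ip := inner.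

Lemma dotDl u v w : ip (u + v) w = ip u w + ip v w.
Proof. exact: linearDl. Qed.

Lemma dotDr u v w : ip u (v + w) = ip u v + ip u w.
Proof. exact: linearDr. Qed.

Lemma dotZl (a : R[i]) u v : ip (a *: u) v = a * ip u v.
Proof. exact: linearZl_LR. Qed.

Lemma dotZr (a : R[i]) u v : ip u (a *: v) = conjc a * ip u v.
Proof. exact: linearZr_LR. Qed.

Lemma dot0l v : ip 0 v = 0. Proof. exact: linear0l. Qed.

Lemma dot0r v : ip v 0 = 0. Proof. exact: linear0r. Qed.

Lemma dotNl u v : ip (- u) v = - ip u v. Proof. exact: linearNl. Qed.

Lemma dotNr u v : ip u (- v) = - ip u v. Proof. exact: linearNr. Qed.

Lemma dotBl u v w : ip (u - v) w = ip u w - ip v w.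
Proof. by rewrite dotDl dotNl. Qed.

Lemma dotBr u v w : ip u (v - w) = ip u v - ip u w.
Proof. by rewrite dotDr dotNr. Qed.

Lemma dot_suml I (r : seq I) (P : pred I) (F : I -> H) v :
  ip (\sum_(i <- r | P i) F i) v = \sum_(i <- r | P i) ip (F i) v.
Proof. by apply: (big_morph (ip^~ v)) => [x y|]; rewrite ?dotDl ?dot0l. Qed.

Lemma dot_sumr I (r : seq I) (P : pred I) (F : I -> H) v :
  ip v (\sum_(i <- r | P i) F i) = \sum_(i <- r | P i) ip v (F i).
Proof. by apply: (big_morph (ip v)) => [x y|]; rewrite ?dotDr ?dot0r. Qed.

Lemma dotC u v : ip u v = conjc (ip v u).
Proof. by rewrite /inner hermC expr0 mul1r. Qed.

Lemma dotvv v : ip v v = (rnorm v ^+ 2)%:C.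
Proof. by rewrite /inner -H_hilbert rnormE rmorphXn. Qed.

Lemma rnorm_sqrD u v :
  rnorm (u + v) ^+ 2 = rnorm u ^+ 2 + rnorm v ^+ 2 + 2 * complex.Re (ip u v).
Proof.
apply: (@complexI R); rewrite -dotvv dotDl !dotDr !dotvv (dotC v u).
apply: complex_eqP; case: (ip u v) => a b; rewrite /= ?ReD ?ImD /=; ring.
Qed.

Lemma cauchy_schwarz u v : rnorm (ip u v) <= rnorm u * rnorm v.
Proof.
have [->|v0] := eqVneq v 0; first by rewrite dot0r !rnorm0 mulr0.
have nv0 : 0 < rnorm v.
  by rewrite lt_neqAle rnorm_ge0 andbT eq_sym; apply: contra_neq v0 => /rnorm_eq0.
pose a := ip u v; pose b : R := rnorm v ^+ 2.
have b0 : 0 < b by rewrite exprn_gt0.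
(* [p + q] is [rnorm v ^+ 2] times the component of [u] orthogonal to [v]; the scaling avoids a
   division. *)
pose p : H := b%:C *: u; pose q : H := (- a) *: v.
have := sqr_ge0 (rnorm (p + q)).
rewrite rnorm_sqrD /p /q dotZl dotZr !rnormZ rnorm_realc (ger0_norm (ltW b0)) cnormN -/a.
have -> : complex.Re (b%:C * (conjc (- a) * a)) = - (b * rnorm a ^+ 2).
  by rewrite rnorm_sqrE; case: (a) => c d /=; ring.
rewrite !exprMn -/b.
have -> : b ^+ 2 * rnorm u ^+ 2 + rnorm a ^+ 2 * b + 2 * - (b * rnorm a ^+ 2)
  = b * (b * rnorm u ^+ 2 - rnorm a ^+ 2) by ring.
rewrite pmulr_rge0 // subr_ge0 /b -exprMn ler_sqr ?nnegrE ?rnorm_ge0 ?mulr_ge0 ?rnorm_ge0 //.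
by rewrite mulrC.
Qed.

Lemma dot_inj u v : (forall w, ip u w = ip v w) -> u = v.
Proof.
move=> h; apply/eqP; rewrite -subr_eq0; apply/eqP/rnorm_eq0/eqP.
have : ip (u - v) (u - v) = 0 by rewrite dotBl h subrr.
by rewrite dotvv => /(@complexI R) /eqP; rewrite sqrf_eq0.
Qed.

Lemma tends_dot (f g : nat -> H) u v :
  tends f u -> tends g v -> tends (fun n => ip (f n) (g n)) (ip u v).
Proof.
move=> fu gv e e0; have [N1 [M [M0 hM]]] := tends_bounded fu.
pose L := rnorm v + M + 1.
have L0 : 0 < L by rewrite /L; have := rnorm_ge0 v; lra.
have eL : 0 < e / (2 * L) by rewrite divr_gt0 // mulr_gt0.
have [N2 h2] := fu _ eL; have [N3 h3] := gv _ eL.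
exists (maxn N1 (maxn N2 N3)) => n; rewrite !geq_max => /and3P[/hM b1 /h2 b2 /h3 b3].
have -> : ip u v - ip (f n) (g n) = ip (u - f n) v + ip (f n) (v - g n).
  by rewrite dotBl dotBr addrA subrK.
have -> : e = e / (2 * L) * L + L * (e / (2 * L)) by field; lra.
apply: le_lt_trans (ler_cnormD _ _) _.
apply: le_lt_trans (lerD (cauchy_schwarz _ _) (cauchy_schwarz _ _)) _.
apply: ltr_leD.
  apply: le_lt_trans (_ : rnorm (u - f n) * L < _); last by rewrite ltr_pM2r.
  by apply: ler_wpM2l; rewrite ?rnorm_ge0 // /L; have := rnorm_ge0 v; lra.
by apply: ler_pM; rewrite ?rnorm_ge0 ?(ltW b3) // /L; have := rnorm_ge0 v; lra.
Qed.

Lemma tends_dotl (f : nat -> H) u v :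
  tends f u -> tends (fun n => ip (f n) v) (ip u v).
Proof. by move=> fu; apply: tends_dot fu _; exact: (@tends_near_cst _ _ _ _ 0). Qed.

Lemma cauchy_tends (f : nat -> H) :
  (forall e : R, 0 < e -> exists N, forall m n, (N <= m)%N -> (N <= n)%N ->
     rnorm (f m - f n) < e) -> exists l, tends f l.
Proof.
move=> h; suff /cvg_ex[l /tendsP] : cvgn f by exists l.
apply/cauchy_cvgP/cauchyP => -[a b].
rewrite ltcE/= => /andP[/eqP-> a0].
have [N hN] := h _ a0.
exists (f N), N => // n Nn; rewrite /= -ball_normE /=.
by rewrite rnormE complexr0 ltcR; apply: hN.
Qed.

End Hilbert.

(** * Orthonormal bases and the Riesz representation *)

Section OrthonormalBasis.
Context (R : realType) (H : completeNormedModType R[i]).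
Context (dot : {dot H for Num.conj}).
Hypothesis H_hilbert : forall v : H, `|v| ^+ 2 = dot v v.
Implicit Types u v w : H.
Local Notation ip := (inner dot).

(** A zero residual yields the zero vector, because [0^-1 = 0]; linearly dependent terms thus become
    the padding that [orthonormal_basis] allows. *)
Fixpoint gram_schmidt (v : nat -> H) (n : nat) : seq H :=
  if n is m.+1 then
    let s := gram_schmidt v m in
    let r := v m - \sum_(x <- s) ip (v m) x *: x in
    rcons s (((rnorm r)^-1)%:C *: r)
  else [::].

Lemma size_gram_schmidt (v : nat -> H) n : size (gram_schmidt v n) = n.
Proof. by elim: n => //= n ih; rewrite size_rcons ih. Qed.

Lemma nth_gram_schmidt (v : nat -> H) n i : (i < n)%N ->
  nth 0 (gram_schmidt v n) i = nth 0 (gram_schmidt v i.+1) i.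
Proof.
elim: n => // n ih; rewrite ltnS leq_eqVlt => /predU1P[->//|ilt].
rewrite [gram_schmidt v n.+1]/= nth_rcons size_gram_schmidt ilt; exact: ih.
Qed.

Lemma separable_sequence : separable H ->
  exists v : nat -> H, forall u (e : R), 0 < e -> exists n, rnorm (u - v n) < e.
Proof.
move=> [A /countable_injP[g gA] dA].
(* Numbers that are not codes of points of [A] give the default [0], which cannot spoil density. *)
exists (fun n => xget 0 [set x | A x /\ g x = n]) => u e e0.
have [||x [ux Ax]] := dA (ball u e%:C).
- by exists u; apply: ballxx; rewrite ltcR.
- exact: ball_open.
exists (g x); case: xgetP => [y _ [Ay gy]|/(_ x)[]//].
have -> : y = x by apply: gA; rewrite ?inE.
by move: ux; rewrite -ball_normE /= rnormE ltcR.
Qed.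

Section System.
Context (e : nat -> H).
Hypothesis e_orth : forall i j, i != j -> dot (e i) (e j) = 0.
Hypothesis e_unit : forall i, dot (e i) (e i) = 1 \/ e i = 0.

Definition fourier_sum n u := \sum_(i < n) ip u (e i) *: e i.

(** Lets padding vectors be treated like unit vectors, both sides being zero when [e i = 0]. *)
Lemma ip_unit u i : ip u (e i) * ip (e i) (e i) = ip u (e i).
Proof.
have [h|->] := e_unit i; last by rewrite dot0r mul0r.
by rewrite [ip (e i) (e i)]h mulr1.
Qed.

Lemma ip_sum_basis n (c : nat -> R[i]) i : (i < n)%N ->
  ip (\sum_(j < n) c j *: e j) (e i) = c i * ip (e i) (e i).
Proof.
move=> iltn; rewrite dot_suml (bigD1 (Ordinal iltn)) //= big1 ?addr0 ?dotZl //.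
by move=> j ji; rewrite dotZl [ip _ _]e_orth ?mulr0.
Qed.

Lemma ip_fourier_basis n u i : (i < n)%N -> ip (fourier_sum n u) (e i) = ip u (e i).
Proof. by move=> iltn; rewrite (ip_sum_basis (fun j => ip u (e j))) // ip_unit. Qed.

Lemma ip_fourier n u w : ip (fourier_sum n u) w = \sum_(i < n) ip u (e i) * ip (e i) w.
Proof. by rewrite dot_suml; apply: eq_bigr => i _; rewrite dotZl. Qed.

(** Self-adjointness of the projection; together with the idempotence below it gives Bessel's
    inequality. *)
Lemma ip_fourierC n u w : ip (fourier_sum n u) w = ip u (fourier_sum n w).
Proof.
rewrite ip_fourier dot_sumr; apply: eq_bigr => i _.
by rewrite dotZr -dotC mulrC.
Qed.

Lemma fourier_sumK n u : fourier_sum n (fourier_sum n u) = fourier_sum n u.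
Proof. by apply: eq_bigr => i _; rewrite ip_fourier_basis. Qed.

Lemma rnorm_fourier_sqr n u :
  rnorm (fourier_sum n u) ^+ 2 = \sum_(i < n) rnorm (ip u (e i)) ^+ 2.
Proof.
apply: (@complexI R); rewrite -(dotvv H_hilbert) ip_fourierC fourier_sumK -ip_fourierC.
rewrite ip_fourier rmorph_sum; apply: eq_bigr => i _.
rewrite (dotC _ (e i) u); case: (ip u (e i)) => a b /=.
by apply: complex_eqP; rewrite ?rnorm_sqrE /=; ring.
Qed.

Lemma rnorm_fourier_le n u : rnorm (fourier_sum n u) <= rnorm u.
Proof.
have [->|p0] := eqVneq (fourier_sum n u) 0; first by rewrite rnorm0 rnorm_ge0.
have p1 : 0 < rnorm (fourier_sum n u).
  by rewrite lt_neqAle rnorm_ge0 andbT eq_sym; apply: contra_neq p0 => /rnorm_eq0.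
rewrite -(ler_pM2l p1) -expr2.
have -> : rnorm (fourier_sum n u) ^+ 2 = complex.Re (ip (fourier_sum n u) u).
  by rewrite -[in RHS](fourier_sumK n u) ip_fourierC (dotvv H_hilbert).
apply: le_trans (cauchy_schwarz H_hilbert _ _).
exact: le_trans (ler_norm _) (Re_le_rnorm _).
Qed.

Lemma bessel n u : \sum_(i < n) rnorm (ip u (e i)) ^+ 2 <= rnorm u ^+ 2.
Proof.
by rewrite -rnorm_fourier_sqr ler_sqr ?nnegrE ?rnorm_ge0 // rnorm_fourier_le.
Qed.

(** Pythagoras. A coefficient on a padding vector would count on the right and not on the left,
    hence the condition on [c]. *)
Lemma rnorm_sum_basis_sqr (c : nat -> R[i]) m n :
  (forall i, e i = 0 -> c i = 0) ->
  rnorm (\sum_(m <= i < n) c i *: e i) ^+ 2 = \sum_(m <= i < n) rnorm (c i) ^+ 2.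
Proof.
move=> c0; elim: n => [|n ih]; first by rewrite !big_geq // rnorm0 expr0n.
have [mn|nm] := leqP m n; last by rewrite !big_geq // rnorm0 expr0n.
rewrite !big_nat_recr //= (rnorm_sqrD H_hilbert) ih rnormZ exprMn.
have -> : ip (\sum_(m <= i < n) c i *: e i) (c n *: e n) = 0.
  rewrite dot_suml big_nat_cond big1 // => i /andP[/andP[_ iltn] _].
  by rewrite dotZl dotZr [ip _ _]e_orth ?mulr0 // neq_ltn iltn.
rewrite /= mulr0 addr0; congr (_ + _).
have [h|h] := e_unit n; last by rewrite (c0 _ h) cnorm0 expr0n mul0r.
suff -> : rnorm (e n) ^+ 2 = 1 by rewrite mulr1.
by apply: (@complexI R); rewrite -(dotvv H_hilbert).
Qed.

(** Riesz-Fischer: by Pythagoras the partial sums are Cauchy because those of the bounded series of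
    squares are. *)
Lemma basis_series_cvg (c : nat -> R[i]) (M : R) :
  (forall i, e i = 0 -> c i = 0) ->
  (forall n, \sum_(i < n) rnorm (c i) ^+ 2 <= M) ->
  exists v, tends (fun n => \sum_(i < n) c i *: e i) v.
Proof.
move=> c0 cM.
pose s : nat -> R := fun n => \sum_(0 <= i < n) rnorm (c i) ^+ 2.
have s_ndecr : {homo s : m n / (m <= n)%N >-> m <= n}.
  move=> m n mn; rewrite /s (big_cat_nat (leq0n m) mn) /= lerDl.
  by apply: sumr_ge0 => i _; apply: sqr_ge0.
have : cvgn s.
  apply: nondecreasing_is_cvgn => //; exists M => _ [n _ <-].
  by rewrite /s big_mkord.
move=> /cvgP/cauchy_cvgP/cauchyP sc.
apply: cauchy_tends => eps eps0.
have e2 : 0 < eps ^+ 2 / 2 by rewrite divr_gt0 // exprn_gt0.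
have [l [N _ hN]] := sc _ e2; exists N.
have key m n : (N <= m)%N -> (m <= n)%N ->
    rnorm (\sum_(i < m) c i *: e i - \sum_(i < n) c i *: e i) < eps.
  move=> Nm mn; rewrite rnormB -!(big_mkord xpredT (fun i => c i *: e i)).
  rewrite (big_cat_nat (leq0n m) mn) /= addrAC subrr add0r.
  rewrite -ltr_sqr ?nnegrE ?rnorm_ge0 ?(ltW eps0) // rnorm_sum_basis_sqr //.
  have -> : \sum_(m <= i < n) rnorm (c i) ^+ 2 = s n - s m.
    by rewrite /s (big_cat_nat (leq0n m) mn) /= addrAC subrr add0r.
  have := hN m Nm; have := hN n (leq_trans Nm mn).
  rewrite /ball /= !ltr_distlC => /andP[h1 h2] /andP[h3 h4]; lra.
move=> m n Nm Nn; have [mn|/ltnW nm] := leqP m n; first exact: key.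
by rewrite rnormB; apply: key.
Qed.

Hypothesis e_complete : forall v, (forall i, dot v (e i) = 0) -> v = 0.

Lemma fourier_tends u : tends (fun n => fourier_sum n u) u.
Proof.
have [||v cv] := @basis_series_cvg (fun i => ip u (e i)) (rnorm u ^+ 2).
  by move=> i ->; rewrite dot0r.
  by move=> n; exact: bessel.
(* The limit has the same coefficients as [u], so completeness of the system identifies the two. *)
suff uv : v - u = 0 by rewrite (subr0_eq uv) in cv.
apply: e_complete => i; rewrite -[dot _ _]/(ip _ _) dotBl.
apply/eqP; rewrite subr_eq0; apply/eqP.
apply: (tends_unique (tends_dotl H_hilbert (e i) cv)).
apply: (@tends_near_cst _ _ _ _ i.+1) => n; exact: ip_fourier_basis.
Qed.

(** The representing vector has the coefficients [conjc (l (e i))]. Evaluating [l] at its partial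
    sums bounds their norms by [M], so the series converges. *)
Lemma riesz_basis (l : H -> R[i]) (M : R) :
  (forall (a : R[i]) u v, l (a *: u + v) = a * l u + l v) ->
  (forall u, rnorm (l u) <= M * rnorm u) ->
  exists v, forall u, l u = ip u v.
Proof.
move=> lin lM.
have l0 : l 0 = 0.
  have := lin 1 0 0; rewrite scaler0 addr0 mul1r => /esym/eqP.
  by rewrite -subr_eq0 addrK => /eqP.
have lD u v : l (u + v) = l u + l v by have := lin 1 u v; rewrite scale1r mul1r.
have lZ (a : R[i]) u : l (a *: u) = a * l u by have := lin a u 0; rewrite l0 !addr0.
have lsum n (c : nat -> R[i]) : l (\sum_(i < n) c i *: e i) = \sum_(i < n) c i * l (e i).
  by rewrite (big_morph l lD l0); apply: eq_bigr => i _; exact: lZ.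
(* A negative [M] is allowed by the hypotheses and forces [l = 0]. *)
have M0 : 0 <= M \/ forall u, l u = 0.
  have [?|M0] := leP 0 M; [by left|right => u]; apply: rnorm_eq0; apply/eqP.
  rewrite eq_le rnorm_ge0 andbT (le_trans (lM u)) //.
  by rewrite nmulr_rle0 ?rnorm_ge0.
case: M0 => [M0|h]; last by exists 0 => u; rewrite h dot0r.
pose c i := conjc (l (e i)).
have c0 i : e i = 0 -> c i = 0 by rewrite /c => ->; rewrite l0 conjc0.
have cM n : \sum_(i < n) rnorm (c i) ^+ 2 <= M ^+ 2.
  pose v := \sum_(i < n) c i *: e i.
  have E : \sum_(i < n) rnorm (c i) ^+ 2 = rnorm v ^+ 2.
    have := @rnorm_sum_basis_sqr c 0 n c0.
    by rewrite !big_mkord.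
  have lv : l v = (rnorm v ^+ 2)%:C.
    rewrite lsum -E rmorph_sum; apply: eq_bigr => i _; rewrite /c rnorm_conj.
    by case: (l (e i)) => a b; apply: complex_eqP; rewrite ?rnorm_sqrE /=; ring.
  have := lM v; rewrite lv rnorm_realc E ger0_norm ?sqr_ge0 // => h.
  rewrite ler_sqr ?nnegrE ?rnorm_ge0 //.
  have [->|v0] := eqVneq (rnorm v) 0; first by [].
  have v1 : 0 < rnorm v by rewrite lt_neqAle eq_sym v0 rnorm_ge0.
  by move: h; rewrite expr2 ler_pM2r.
have [v cv] := basis_series_cvg c0 cM.
exists v => u; apply: (@tends_unique _ _ (fun n => l (fourier_sum n u))).
  move=> eps eps0; have M1 : 0 < M + 1 by rewrite ltr_wpDl.
  have [|N hN] := fourier_tends u (e := eps / (M + 1)); first by rewrite divr_gt0.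
  exists N => n Nn; have := hN n Nn.
  have -> : l u - l (fourier_sum n u) = l (u - fourier_sum n u).
    by have := lD (u - fourier_sum n u) (fourier_sum n u); rewrite subrK => ->; rewrite addrK.
  rewrite ltr_pdivlMr // mulrC; apply: le_lt_trans.
  apply: le_trans (lM _) _; apply: ler_wpM2r; rewrite ?rnorm_ge0 //; lra.
suff -> : (fun n => l (fourier_sum n u)) =
    (fun n => ip u (\sum_(i < n) c i *: e i)).
  apply: tends_dot => //; exact: (@tends_near_cst _ _ _ _ 0).
apply/funext => n; rewrite (lsum n (fun i => ip u (e i))) dot_sumr.
by apply: eq_bigr => i _; rewrite dotZr /c conjcK mulrC.
Qed.

End System.

(** Each [v n] is a combination of [e 0, ..., e n], so a vector [w] orthogonal to the system is
    orthogonal to a dense sequence; approximating [w] by some [v n] within less than [rnorm w]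
    contradicts Cauchy-Schwarz unless [w = 0]. *)
Lemma orthonormal_basis_exists : separable H ->
  exists e : nat -> H, orthonormal_basis dot e.
Proof.
move=> /separable_sequence[v vd].
pose e n := nth 0 (gram_schmidt v n.+1) n.
pose res n := v n - \sum_(i < n) ip (v n) (e i) *: e i.
have eE n : e n = ((rnorm (res n))^-1)%:C *: res n.
  rewrite /e /= nth_rcons size_gram_schmidt ltnn eqxx /res.
  rewrite (big_nth 0) size_gram_schmidt big_mkord.
  have -> : \sum_(i < n) ip (v n) (nth 0 (gram_schmidt v n) i)
      *: nth 0 (gram_schmidt v n) i = \sum_(i < n) ip (v n) (e i) *: e i => //.
  by apply: eq_bigr => i _; rewrite nth_gram_schmidt.
have vE n : v n = (rnorm (res n))%:C *: e n + \sum_(i < n) ip (v n) (e i) *: e i.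
  rewrite eE scalerA -rmorphM /=.
  have [h|h] := eqVneq (rnorm (res n)) 0.
    by rewrite h mul0r scale0r add0r; exact: subr0_eq (rnorm_eq0 h).
  by rewrite mulfV // scale1r /res subrK.
have unit n : dot (e n) (e n) = 1 \/ e n = 0.
  have [h|h] := eqVneq (rnorm (res n)) 0.
    by right; rewrite eE (rnorm_eq0 h) scaler0.
  left; rewrite -[LHS]/(ip _ _) (dotvv H_hilbert) eE rnormZ rnorm_realc.
  by rewrite ger0_norm ?invr_ge0 ?rnorm_ge0 // mulVf // expr1n.
have orth n : forall i, (i < n)%N -> ip (e n) (e i) = 0.
  elim/ltn_ind: n => n ih i iltn; rewrite eE dotZl.
  suff -> : ip (res n) (e i) = 0 by rewrite mulr0.
  rewrite /res dotBl dot_suml.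
  rewrite (bigD1 (Ordinal iltn)) //= big1 ?addr0.
    rewrite dotZl; have [h|->] := unit i; last by rewrite !dot0r mulr0 subr0.
    by rewrite [ip (e i) (e i)]h mulr1 subrr.
  move=> j ji; rewrite dotZl.
  have [jlt|ilt|jE] := ltngtP j i; last by case/eqP: ji; apply: val_inj.
    by rewrite (dotC _ (e j)) ih // conjc0 mulr0.
  by rewrite ih // mulr0.
exists e; split => // [i j|w hw].
  rewrite neq_ltn => /orP[ij|ji]; last exact: orth.
  by rewrite -[LHS]/(ip _ _) dotC orth // conjc0.
have wv n : ip w (v n) = 0.
  rewrite vE dotDr dotZr [ip w (e n)]hw mulr0 add0r dot_sumr big1 // => i _.
  by rewrite dotZr [ip w (e i)]hw mulr0.
apply: rnorm_eq0; apply/eqP; rewrite -[_ == _]negbK; apply/negP => w0.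
have w1 : 0 < rnorm w by rewrite lt_neqAle eq_sym w0 rnorm_ge0.
have [n hn] := vd w _ w1.
have : rnorm w ^+ 2 <= rnorm w * rnorm (w - v n).
  have := cauchy_schwarz H_hilbert w (w - v n).
  rewrite dotBr wv subr0 (dotvv H_hilbert) rnorm_realc ger0_norm //.
  exact: sqr_ge0.
by rewrite expr2 ler_pM2l // leNgt hn.
Qed.

Lemma riesz : separable H -> forall (l : H -> R[i]) (M : R),
  (forall (a : R[i]) u v, l (a *: u + v) = a * l u + l v) ->
  (forall u, rnorm (l u) <= M * rnorm u) ->
  exists v, forall u, l u = ip u v.
Proof. by move=> /orthonormal_basis_exists[e [e1 e2 e3]] l M; exact: (riesz_basis e1 e2 e3). Qed.

End OrthonormalBasis.

(** * Determinants and the trace norm of matrices *)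

Section Determinants.
Context (R : realType).
Local Notation C := R[i].

Section Algebra.
Context (K : comNzRingType).

(** Sylvester's identity: one block matrix, multiplied by the same unipotent matrix on the right or
    on the left, becomes block triangular with one or the other determinant. *)
Lemma det_add_comm m n (U : 'M[K]_(n, m)) (V : 'M[K]_(m, n)) :
  \det (1%:M + U *m V) = \det (1%:M + V *m U).
Proof.
have h1 : block_mx 1%:M (- U) V 1%:M *m block_mx 1%:M 0 (- V) 1%:M
    = block_mx (1%:M + U *m V) (- U) 0 1%:M.
  by rewrite mulmx_block !mulmx1 !mul1mx !mulmx0 !add0r mulNmx mulmxN opprK subrr.
have h2 : block_mx 1%:M 0 (- V) 1%:M *m block_mx 1%:M (- U) V 1%:M
    = block_mx 1%:M (- U) 0 (1%:M + V *m U).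
  by rewrite mulmx_block !mulmx1 !mul1mx !mul0mx !addr0 mulNmx mulmxN opprK addNr
    [V *m U + _]addrC.
have := congr1 determinant h1; have := congr1 determinant h2.
by rewrite !det_mulmx !det_ublock !det_lblock !det1 !mul1r !mulr1 => -> ->.
Qed.

Lemma det_block_rank1 n (M : 'M[K]_n) (a : 'cV_n) (b : 'rV_n) :
  \det (block_mx M (- a) b 1%:M) = \det (M + a *m b).
Proof.
have := congr1 determinant (_ : block_mx M (- a) b 1%:M *m block_mx 1%:M 0 (- b) 1%:M
    = block_mx (M + a *m b) (- a) 0 1%:M).
rewrite det_mulmx !det_ublock det_lblock !det1 !mulr1; apply.
by rewrite mulmx_block !mulmx1 !mul1mx !mulmx0 !add0r mulNmx mulmxN opprK subrr.
Qed.

(* Expanding along the last row of a bordered matrix shows that the determinant is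
   affine along a rank one direction. *)
Lemma det_rank1_affine n (M : 'M[K]_n) (a : 'cV_n) (b : 'rV_n) (z : K) :
  \det (M + a *m (z *: b)) = \det M + z * (\det (M + a *m b) - \det M).
Proof.
have M0 : \det (block_mx M (- a) (0 : 'rV_n) 1%:M) = \det M.
  by rewrite det_block_rank1 mulmx0 addr0.
rewrite -!det_block_rank1.
(* The last row [(z *: b, 1)] is [z] times [(b, 1)] plus [1 - z] times [(0, 1)]. *)
rewrite (@determinant_multilinear _ _ _ (block_mx M (- a) b 1%:M)
  (block_mx M (- a) 0 1%:M) (rshift n 0) z (1 - z)); first by rewrite M0; ring.
- apply/rowP => j; rewrite !mxE; case: splitP => i0 /= E.
    by have := ltn_ord i0; rewrite -E addn0 ltnn.
  move=> {E}; rewrite !mxE; case: splitP => k _; rewrite !mxE; ring.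
- apply/matrixP => i j; rewrite !mxE; case: splitP => //= k kE; exfalso.
  move: (neq_lift (rshift n (0 : 'I_1)) i) => /eqP; apply; apply: val_inj.
  by rewrite /= kE ord1.
- apply/matrixP => i j; rewrite !mxE; case: splitP => //= k kE; exfalso.
  move: (neq_lift (rshift n (0 : 'I_1)) i) => /eqP; apply; apply: val_inj.
  by rewrite /= kE ord1.
Qed.

End Algebra.

(** Gram-Schmidt on the rows writes [A = L *m S] with [S] unitary and [L] lower triangular. The
    modulus of the determinant is then the product of the moduli of the [L i i], and row [i] of [L]
    is as long as row [i] of [A]. *)
Lemma hadamard n (A : 'M[C]_n) :
  rnorm (\det A) ^+ 2 <= \prod_i \sum_j rnorm (A i j) ^+ 2.
Proof.
pose S := schmidt A; have Su : S \is unitarymx by apply: schmidt_unitarymx.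
pose St := map_mx Num.conj (S^T); pose L := A *m St.
have SSt : S *m St = 1%:M by apply/eqP: Su.
have StS : St *m S = 1%:M by apply: mulmx1C.
have AE : A = L *m S by rewrite -mulmxA StS mulmx1.
have trL : is_trig_mx L.
  apply/is_trig_mxP => i j ij.
  (* Row [i] of [A] lies in the span of the rows of [S] of index at most [i], which are orthogonal
     to row [j]. *)
  have : (row i A <= kermx (col j St))%MS.
    apply: submx_trans (row_schmidt_sub A i) _.
    apply/sumsmx_subP => k ki; rewrite genmxE; apply/sub_kermxP.
    apply/matrixP => p q; rewrite !ord1.
    have /matrixP/(_ k j) := SSt; rewrite !mxE.
    have -> : (k == j) = false by apply/negbTE; rewrite neq_ltn (leq_ltn_trans ki ij).
    by move=> E; rewrite -[RHS]E; apply: eq_bigr => l _; rewrite !mxE.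
  move=> /sub_kermxP/matrixP/(_ 0 0); rewrite !mxE => E; rewrite -[RHS]E.
  by apply: eq_bigr => l _; rewrite !mxE.
have dS : rnorm (\det S) ^+ 2 = 1.
  have := congr1 determinant SSt; rewrite det_mulmx det1 det_map_mx det_tr => E.
  by rewrite expr2 -{2}rnorm_conj -rnormM [_ * _]E rnorm1.
have LL : L *m (map_mx Num.conj L^T) = A *m (map_mx Num.conj A^T).
  rewrite trmx_mul map_mxM.
  have -> : map_mx Num.conj St^T = S by apply/matrixP => i j; rewrite !mxE conjCK.
  by rewrite mulmxA -(mulmxA A) StS mulmx1.
rewrite {1}AE det_mulmx rnormM exprMn dS mulr1 det_trig // rnorm_prod -prodrXl.
apply: ler_prod => i _; rewrite sqr_ge0 /=.
have sq (B : 'M[C]_n) : \sum_j rnorm (B i j) ^+ 2 =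
    complex.Re ((B *m (map_mx Num.conj B^T)) i i).
  apply: (@complexI R); rewrite mxE rmorph_sum /=.
  have E j : (rnorm (B i j) ^+ 2)%:C = B i j * (map_mx Num.conj B^T) j i.
    rewrite !mxE; case: (B i j) => x y.
    by apply: complex_eqP; rewrite ?rnorm_sqrE /=; ring.
  by rewrite -(eq_bigr _ (fun j _ => E j)) -rmorph_sum.
by rewrite sq -LL -sq (bigD1 i) //= lerDl sumr_ge0 // => j _; apply: sqr_ge0.
Qed.

Lemma cauchy_schwarz_sum I (r : seq I) (x y : I -> R) (a b : R) :
  0 <= a -> 0 <= b ->
  \sum_(i <- r) x i ^+ 2 <= a ^+ 2 -> \sum_(i <- r) y i ^+ 2 <= b ^+ 2 ->
  \sum_(i <- r) `|x i| * `|y i| <= a * b.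
Proof.
move=> a0 b0 xa yb.
(* The slack makes both bounds positive, so that the weights [q / (2 * p)] and [p / (2 * q)] of the
   arithmetic-geometric inequality make sense. *)
suff key (e : R) : 0 < e -> \sum_(i <- r) `|x i| * `|y i| <= (a + e) * (b + e).
  apply/ler_addgt0Pr => d d0.
  pose e := Num.min 1 (d / (a + b + 1)).
  have ab1 : 0 < a + b + 1 by lra.
  have e0 : 0 < e by rewrite lt_min ltr01 divr_gt0.
  have e1 : e <= 1 by rewrite ge_min lexx.
  have ed : e * (a + b + 1) <= d by rewrite -ler_pdivlMr // ge_min lexx orbT.
  by apply: le_trans (key e e0) _; nra.
move=> e0; pose p := a + e; pose q := b + e.
have p0 : 0 < p by rewrite /p; lra.
have q0 : 0 < q by rewrite /q; lra.
have : \sum_(i <- r) `|x i| * `|y i| <=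
    \sum_(i <- r) (q / (2 * p) * x i ^+ 2 + p / (2 * q) * y i ^+ 2).
  apply: ler_sum => i _.
  rewrite -(real_normK (num_real (x i))) -(real_normK (num_real (y i))).
  set s := `|x i|; set t := `|y i|.
  have -> : q / (2 * p) * s ^+ 2 + p / (2 * q) * t ^+ 2 =
      s * t + (q * s - p * t) ^+ 2 / (2 * p * q) by field; lra.
  by rewrite lerDl divr_ge0 ?sqr_ge0 //; nra.
move=> /le_trans; apply; rewrite big_split /= -!mulr_sumr.
have : q / (2 * p) * (\sum_(i <- r) x i ^+ 2) <= q / (2 * p) * p ^+ 2.
  rewrite ler_pM2l ?divr_gt0 ?mulr_gt0 //; apply: le_trans xa _.
  by rewrite ler_sqr ?nnegrE /p; lra.
have : p / (2 * q) * (\sum_(i <- r) y i ^+ 2) <= p / (2 * q) * q ^+ 2.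
  rewrite ler_pM2l ?divr_gt0 ?mulr_gt0 //; apply: le_trans yb _.
  by rewrite ler_sqr ?nnegrE /q; lra.
have -> : q / (2 * p) * p ^+ 2 = p * q / 2 by field; lra.
have -> : p / (2 * q) * q ^+ 2 = p * q / 2 by field; lra.
rewrite -/p -/q; lra.
Qed.

(* The trace norm, as the norm dual to the operator norm. *)
Definition trace_norm_le n (A : 'M[C]_n) (r : R) : Prop :=
  forall (X : 'M[C]_n) (c : R), 0 <= c ->
  (forall (a b : 'I_n -> C) (p q : R), 0 <= p -> 0 <= q ->
     \sum_i rnorm (a i) ^+ 2 <= p ^+ 2 -> \sum_i rnorm (b i) ^+ 2 <= q ^+ 2 ->
     rnorm (\sum_i \sum_j X i j * (a i * b j)) <= c * (p * q)) ->
  rnorm (\sum_i \sum_j X i j * A i j) <= c * r.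

Lemma trace_norm_leD n (A B : 'M[C]_n) r s :
  trace_norm_le A r -> trace_norm_le B s -> trace_norm_le (A + B) (r + s).
Proof.
move=> Ar Bs X c c0 Xc; rewrite mulrDr.
have -> : \sum_i \sum_j X i j * (A + B) i j =
    \sum_i \sum_j X i j * A i j + \sum_i \sum_j X i j * B i j.
  rewrite -big_split; apply: eq_bigr => i _; rewrite -big_split.
  by apply: eq_bigr => j _; rewrite mxE mulrDr.
exact: le_trans (ler_cnormD _ _) (lerD (Ar _ _ c0 Xc) (Bs _ _ c0 Xc)).
Qed.

Lemma trace_norm_le0 n : trace_norm_le (0 : 'M[C]_n) 0.
Proof.
move=> X c c0 _; rewrite mulr0 big1 ?cnorm0 // => i _.
by rewrite big1 // => j _; rewrite mxE mulr0.
Qed.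

Lemma trace_norm_le_rank1 n (a : 'cV[C]_n) (b : 'rV[C]_n) p q :
  0 <= p -> 0 <= q ->
  \sum_i rnorm (a i 0) ^+ 2 <= p ^+ 2 -> \sum_i rnorm (b 0 i) ^+ 2 <= q ^+ 2 ->
  trace_norm_le (a *m b) (p * q).
Proof.
move=> p0 q0 ap bq X c c0 Xc.
have -> : \sum_i \sum_j X i j * (a *m b) i j =
    \sum_i \sum_j X i j * (a i 0 * b 0 j).
  by apply: eq_bigr => i _; apply: eq_bigr => j _; rewrite mxE big_ord1.
exact: (Xc (fun i => a i 0) (fun i => b 0 i)).
Qed.

Lemma trace_norm_le_ge0 n (A : 'M[C]_n) r : trace_norm_le A r -> 0 <= r.
Proof.
move=> /(_ 0 1 ler01) h.
have -> : r = 1 * r by rewrite mul1r.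
apply: le_trans (rnorm_ge0 _) (h _) => a b p q p0 q0 _ _.
rewrite big1 ?cnorm0 ?mulr_ge0 // => i _; rewrite big1 // => j _.
by rewrite mxE mul0r.
Qed.

Lemma trace_norm_le_weak n (A : 'M[C]_n) r s :
  trace_norm_le A r -> r <= s -> trace_norm_le A s.
Proof.
by move=> Ar rs X c c0 Xc; apply: le_trans (Ar _ _ c0 Xc) _; rewrite ler_wpM2l.
Qed.

(** The trace is the pairing with the identity matrix, whose operator norm is at most one. *)
Lemma trace_norm_le_tr n (A : 'M[C]_n) r : trace_norm_le A r -> rnorm (\tr A) <= r.
Proof.
move=> /(_ 1%:M 1 ler01) h.
have E (f : 'I_n -> 'I_n -> C) : \sum_i \sum_j (1%:M : 'M[C]_n) i j * f i j = \sum_i f i i.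
  apply: eq_bigr => i _; rewrite (bigD1 i) //= mxE eqxx mul1r big1 ?addr0 // => j ji.
  by rewrite mxE eq_sym (negPf ji) mul0r.
have : rnorm (\sum_i \sum_j (1%:M : 'M[C]_n) i j * A i j) <= 1 * r.
  apply: h => a b p q p0 q0 ap bq; rewrite (E (fun i j => a i * b j)) mul1r.
  apply: le_trans (ler_cnorm_sum _ _ _) _.
  have := cauchy_schwarz_sum p0 q0 ap bq; apply: le_trans.
  by apply: ler_sum => i _; rewrite rnormM !ger0_norm ?rnorm_ge0.
by rewrite E mul1r.
Qed.

(** Pairing with the conjugate of [A] itself: its operator norm is at most its Hilbert-Schmidt norm
    [f], whence [f ^+ 2 <= f * r]. *)
Lemma trace_norm_le_frob n (A : 'M[C]_n) r : trace_norm_le A r ->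
  \sum_i \sum_j rnorm (A i j) ^+ 2 <= r ^+ 2.
Proof.
move=> Ar; set F := \sum_i _; have r0 := trace_norm_le_ge0 Ar.
have F0 : 0 <= F by apply: sumr_ge0 => i _; apply: sumr_ge0 => j _; apply: sqr_ge0.
pose f := Num.sqrt F; have f0 : 0 <= f by apply: sqrtr_ge0.
have fF : f ^+ 2 = F by rewrite sqr_sqrtr.
have := Ar (map_mx conjc A) f f0.
have -> : \sum_i \sum_j (map_mx conjc A) i j * A i j = F%:C.
  rewrite rmorph_sum; apply: eq_bigr => i _; rewrite rmorph_sum; apply: eq_bigr => j _.
  rewrite mxE; apply: complex_eqP; rewrite ?rnorm_sqrE; case: (A i j) => x y /=; ring.
rewrite rnorm_realc ger0_norm // => h.
have {}h : F <= f * r.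
  apply: h => a b p q p0 q0 ap bq.
  rewrite pair_big /=; apply: le_trans (ler_cnorm_sum _ _ _) _.
  pose x (k : 'I_n * 'I_n) := rnorm (A k.1 k.2).
  pose y (k : 'I_n * 'I_n) := rnorm (a k.1) * rnorm (b k.2).
  have pq0 : 0 <= p * q by rewrite mulr_ge0.
  have := @cauchy_schwarz_sum _ (index_enum _) x y f (p * q) f0 pq0.
  have E : \sum_i \sum_j rnorm (a i) ^+ 2 * rnorm (b j) ^+ 2 <= (p * q) ^+ 2.
    have -> : \sum_i \sum_j rnorm (a i) ^+ 2 * rnorm (b j) ^+ 2 =
        (\sum_i rnorm (a i) ^+ 2) * (\sum_j rnorm (b j) ^+ 2).
      by rewrite mulr_suml; apply: eq_bigr => i _; rewrite mulr_sumr.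
    by rewrite exprMn ler_pM // sumr_ge0 // => i _; apply: sqr_ge0.
  rewrite pair_big /= in E.
  have -> : \sum_(i <- index_enum ('I_n * 'I_n)%type) x i ^+ 2 = F.
    by rewrite /F pair_big.
  move=> g; apply: le_trans (g _ _).
  - apply: ler_sum => k _; rewrite !rnormM mxE rnorm_conj !ger0_norm //.
      by rewrite mulr_ge0 ?rnorm_ge0.
    exact: rnorm_ge0.
  - by rewrite fF.
  - by apply: le_trans E; apply: ler_sum => k _; rewrite /y exprMn.
have [f1|f1] := eqVneq f 0; first by rewrite -fF f1; nra.
have f2 : 0 < f by rewrite lt_neqAle eq_sym f1.
by rewrite -fF ler_sqr ?nnegrE // -(ler_pM2l f2) -expr2 fF.
Qed.

Definition det_bound (r : R) : R := expR (r + r ^+ 2 / 2).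

Lemma det_bound_gt0 r : 0 < det_bound r. Proof. exact: expR_gt0. Qed.

Lemma det_bound_le r s : 0 <= r -> r <= s -> det_bound r <= det_bound s.
Proof. by move=> r0 rs; rewrite ler_expR; nra. Qed.

(** Row [i] of [1 + A] has squared length [1 + 2 Re (A i i)] plus that of row [i] of [A], which is
    at most an exponential. Hadamard's inequality multiplies these into an exponential of the trace
    and the Hilbert-Schmidt norm, both controlled by [r]. *)
Lemma det_trace_norm n (A : 'M[C]_n) r : trace_norm_le A r ->
  rnorm (\det (1%:M + A)) <= det_bound r.
Proof.
move=> Ar; have r0 := trace_norm_le_ge0 Ar.
rewrite -ler_sqr ?nnegrE ?rnorm_ge0 ?(ltW (det_bound_gt0 _)) //.
apply: le_trans (hadamard _) _.
apply: (@le_trans _ _ (\prod_i expR (2 * complex.Re (A i i) + \sum_j rnorm (A i j) ^+ 2))).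
  apply: ler_prod => i _; apply/andP; split.
    by apply: sumr_ge0 => j _; apply: sqr_ge0.
  apply: le_trans (expR_ge1Dx _).
  rewrite (bigD1 i) //= [X in _ <= _ + (_ + X)](bigD1 i) //=.
  have -> : \sum_(j | j != i) rnorm ((1%:M + A) i j) ^+ 2 =
      \sum_(j | j != i) rnorm (A i j) ^+ 2.
    by apply: eq_bigr => j ji; rewrite !mxE eq_sym (negPf ji) add0r.
  rewrite !mxE eqxx !rnorm_sqrE ReD ImD /=; case: (A i i) => x y /=.
  by rewrite le_eqVlt; apply/orP; left; apply/eqP; ring.
rewrite -(big_morph expR (@expRD R) (@expR0 R)) big_split /= -mulr_sumr.
rewrite expr2 -expRD ler_expR.
have := trace_norm_le_frob Ar; have := trace_norm_le_tr Ar.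
have -> : \sum_i complex.Re (A i i) = complex.Re (\tr A).
  by rewrite /mxtrace (big_morph (@complex.Re R) (@ReD R) (erefl _)).
have := Re_le_rnorm (\tr A); have := ler_norm (complex.Re (\tr A)); lra.
Qed.

(** A Cauchy estimate: along the rank one direction the determinant is affine with slope [D], and it
    is bounded by [E] at [z] and [- z] of modulus [t^-1], where the perturbation has trace norm at
    most one. This unit is the [1] in [det_bound (r + 1)]. *)
Lemma det_rank1_step n (A : 'M[C]_n) (a : 'cV[C]_n) (b : 'rV[C]_n) r p q :
  trace_norm_le A r -> 0 <= p -> 0 <= q ->
  \sum_i rnorm (a i 0) ^+ 2 <= p ^+ 2 -> \sum_i rnorm (b 0 i) ^+ 2 <= q ^+ 2 ->
  rnorm (\det (1%:M + (A + a *m b)) - \det (1%:M + A)) <= p * q * det_bound (r + 1).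
Proof.
move=> Ar p0 q0 ap bq; set D := \det _ - _; pose E := det_bound (r + 1).
have E0 : 0 < E by apply: det_bound_gt0.
have pq0 : 0 <= p * q by rewrite mulr_ge0.
(* [p * q] may vanish, so the radius is taken from a positive [t] slightly above it. *)
suff key t : p * q <= t -> 0 < t -> rnorm D <= t * E.
  apply/ler_addgt0Pr => d d0.
  have := key (p * q + d / E); rewrite mulrDl divfK ?lt0r_neq0 //; apply.
    by rewrite lerDl divr_ge0 // ltW.
  by rewrite ltr_wpDl // divr_gt0.
move=> pqt t0.
have bound (z : C) : rnorm z = t^-1 -> rnorm (\det (1%:M + A) + z * D) <= E.
  move=> zt; have := det_rank1_affine (1%:M + A) a b z.
  rewrite -!addrA -/D => <-; apply: det_trace_norm; apply: trace_norm_leD => //.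
  apply: (@trace_norm_le_weak _ _ (p * (rnorm z * q))).
    apply: trace_norm_le_rank1 => //; first by rewrite mulr_ge0 ?rnorm_ge0.
    rewrite exprMn; have -> : \sum_i rnorm ((z *: b) 0 i) ^+ 2 =
        rnorm z ^+ 2 * \sum_i rnorm (b 0 i) ^+ 2.
      by rewrite mulr_sumr; apply: eq_bigr => i _; rewrite mxE rnormM exprMn.
    by rewrite ler_wpM2l ?sqr_ge0.
  by rewrite zt mulrCA mulrC ler_pdivrMr ?mul1r.
have t1 : rnorm ((t^-1)%:C : C) = t^-1.
  by rewrite rnorm_realc ger0_norm // invr_ge0 ltW.
have b1 := bound _ t1; have b2 := bound (- (t^-1)%:C).
rewrite cnormN in b2; have {}b2 := b2 t1.
have : rnorm (((t^-1)%:C * D) + ((t^-1)%:C * D)) <= E + E.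
  have -> : (t^-1)%:C * D + (t^-1)%:C * D = (\det (1%:M + A) + (t^-1)%:C * D) -
     (\det (1%:M + A) + - (t^-1)%:C * D) by ring.
  by apply: le_trans (ler_cnormB _ _) (lerD b1 b2).
rewrite -mulrDr rnormM t1 -mulr2n -[D *+ 2]mulr_natl rnormM.
have -> : rnorm (2%:R : C) = 2.
  have -> : (2%:R : C) = (2%:R : R)%:C by rewrite rmorph_nat.
  by rewrite rnorm_realc ger0_norm.
move=> h; have : t * (t^-1 * (2 * rnorm D)) <= t * (E + E) by rewrite ler_pM2l.
by rewrite mulrA mulfV ?lt0r_neq0 // mul1r; lra.
Qed.

Lemma tends_det n (M : nat -> 'M[C]_n) (L : 'M[C]_n) :
  (forall i j, tends (fun k => M k i j) (L i j)) ->
  tends (fun k => \det (M k)) (\det L).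
Proof.
move=> h; apply: tends_sum => s _; apply: tendsM.
  by apply: (@tends_near_cst _ _ _ _ 0).
by apply: tends_prod => i _.
Qed.

Lemma complex_cauchy_tends (f : nat -> C) :
  (forall e : R, 0 < e -> exists N, forall m n, (N <= m)%N -> (N <= n)%N ->
     rnorm (f m - f n) < e) -> exists l, tends f l.
Proof.
move=> h.
have rc (g : nat -> R) : (forall m n, `|g m - g n| <= rnorm (f m - f n)) ->
    exists l : R, forall e, 0 < e -> exists N, forall n, (N <= n)%N -> `|l - g n| < e.
  move=> gf; suff : cvgn g.
    move=> /cvg_ex[l /cvgrPdist_lt gl]; exists l => e /gl[N _ hN].
    by exists N => n Nn; apply: hN.
  apply/cauchy_cvgP/cauchyP => e /h[N hN].
  exists (g N), N => // n Nn; rewrite /ball /=.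
  exact: le_lt_trans (gf _ _) (hN _ _ _ _).
have reB m n : `|complex.Re (f m) - complex.Re (f n)| <= rnorm (f m - f n).
  by rewrite -ReN -ReD Re_le_rnorm.
have imB m n : `|complex.Im (f m) - complex.Im (f n)| <= rnorm (f m - f n).
  by rewrite -ImN -ImD Im_le_rnorm.
have [x hx] := rc _ reB; have [y hy] := rc _ imB.
exists (x +i* y) => e e0; have e2 : 0 < e / 2 by rewrite divr_gt0.
have [N1 h1] := hx _ e2; have [N2 h2] := hy _ e2.
exists (maxn N1 N2) => n; rewrite geq_max => /andP[/h1 b1 /h2 b2].
apply: le_lt_trans (rnorm_le_ReIm _) _; rewrite ReD ReN ImD ImN /=; lra.
Qed.

End Determinants.

(** * Nuclear forms *)

Section Nuclear.
Context (R : realType) (H : completeNormedModType R[i]).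
Context (dot : {dot H for Num.conj}).
Hypothesis H_hilbert : forall v : H, `|v| ^+ 2 = dot v v.
Implicit Types u v w : H.
Local Notation C := R[i].
Local Notation ip := (inner dot).
Local Notation form := (H -> H -> C).

Definition rank_one (a b : H) : form := fun v w => ip v b * ip a w.
Local Notation rank1 := rank_one.

(* [nuclear phi r]: the operator with form [phi] has trace norm at most [r]. *)
Definition nuclear_by (a b : nat -> H) (phi : form) (r : R) : Prop :=
  (forall n, \sum_(k < n) rnorm (a k) * rnorm (b k) <= r) /\
  forall v w, tends (fun n => \sum_(k < n) rank1 (a k) (b k) v w) (phi v w).

Definition nuclear (phi : form) (r : R) : Prop := exists a b, nuclear_by a b phi r.

Definition form_mx (e : nat -> H) n (phi : form) : 'M[C]_n :=
  \matrix_(i < n, j < n) phi (e j) (e i).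

Definition form_det e n phi : C := \det (1%:M + form_mx e n phi).

Lemma nuclear_ge0 phi r : nuclear phi r -> 0 <= r.
Proof. by move=> [a [b [/(_ 0%N) + _]]]; rewrite big_ord0. Qed.

Lemma rnorm_rank1 a b v w : rnorm (rank1 a b v w) <= rnorm a * rnorm b * (rnorm v * rnorm w).
Proof.
rewrite /rank_one rnormM.
have -> : rnorm a * rnorm b * (rnorm v * rnorm w) =
    (rnorm v * rnorm b) * (rnorm a * rnorm w) by ring.
by apply: ler_pM; rewrite ?rnorm_ge0 ?cauchy_schwarz.
Qed.

Lemma nuclear_bound phi r v w : nuclear phi r ->
  rnorm (phi v w) <= r * (rnorm v * rnorm w).
Proof.
move=> [a [b [ab phiE]]]; apply: (tends_bound (phiE v w)) => n.
apply: le_trans (ler_cnorm_sum _ _ _) _.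
apply: (@le_trans _ _ (\sum_(k < n) rnorm (a k) * rnorm (b k) * (rnorm v * rnorm w))).
  by apply: ler_sum => k _; apply: rnorm_rank1.
by rewrite -mulr_suml ler_wpM2r // mulr_ge0 ?rnorm_ge0.
Qed.

Lemma nuclear_eq phi psi r : (forall v w, phi v w = psi v w) -> nuclear phi r -> nuclear psi r.
Proof. by move=> E [a [b [ab h]]]; exists a, b; split => // v w; rewrite -E. Qed.

Lemma nuclear_weak phi r s : nuclear phi r -> r <= s -> nuclear phi s.
Proof.
move=> [a [b [ab h]]] rs; exists a, b; split => // n; exact: le_trans (ab n) rs.
Qed.

Lemma nuclear_rank1 a b : nuclear (rank1 a b) (rnorm a * rnorm b).
Proof.
exists (fun k => if k == 0%N then a else 0), (fun _ => b); split.
  case=> [|n]; first by rewrite big_ord0 mulr_ge0 ?rnorm_ge0.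
  by rewrite big_ord_recl /= big1 ?addr0 // => i _; rewrite rnorm0 mul0r.
move=> v w; apply: (@tends_near_cst _ _ _ _ 1) => -[//|n _].
by rewrite big_ord_recl /= big1 ?addr0 // => i _; rewrite /rank_one dot0l mulr0.
Qed.

Lemma nuclear0 : nuclear (fun _ _ => 0) 0.
Proof.
exists (fun=> 0), (fun=> 0); split=> [n|v w].
  by rewrite big1 // => i _; rewrite rnorm0 mul0r.
apply: (@tends_near_cst _ _ _ _ 0) => n _.
by rewrite big1 // => i _; rewrite /rank_one dot0l mulr0.
Qed.

Section Pairing.

(** The order in which a double series of rank one forms is rearranged into a single one; numbers
    that code no pair are dropped. *)
Definition unpair (n : nat) : seq (nat * nat) :=
  pmap (@pickle_inv (nat * nat)%type) (iota 0 n).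

Lemma uniq_unpair n : uniq (unpair n).
Proof.
apply: (@pmap_uniq _ _ (@pickle_inv (nat * nat)%type) pickle) (iota_uniq _ _).
exact: pickle_invK.
Qed.

Definition box K L : seq (nat * nat) := [seq (k, l) | k <- iota 0 K, l <- iota 0 L].

Lemma uniq_box K L : uniq (box K L).
Proof.
by apply: allpairs_uniq => [||[? ?] [? ?] _ _ [-> ->]//]; apply: iota_uniq.
Qed.

Lemma mem_box K L k l : ((k, l) \in box K L) = (k < K)%N && (l < L)%N.
Proof.
apply/allpairsP/andP => [[[x y] [+ + [-> ->]]]|[kK lL]].
  by rewrite !mem_iota !add0n.
by exists (k, l); rewrite !mem_iota !add0n.
Qed.

Lemma unpair_sub_box n : exists N, {subset unpair n <= box N N}.
Proof.
elim: (unpair n) => [|[k l] s [N hN]]; first by exists 0%N.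
exists (maxn N (maxn k l).+1) => -[x y]; rewrite inE => /predU1P[[-> ->]|/hN].
  by rewrite mem_box !leq_max !ltnS leq_maxl leq_maxr !orbT.
by rewrite !mem_box !leq_max => /andP[-> ->].
Qed.

Lemma box_sub_unpair K L : exists N, forall n, (N <= n)%N -> {subset box K L <= unpair n}.
Proof.
elim: (box K L) => [|x s [N hN]]; first by exists 0%N.
exists (maxn N (pickle x).+1) => n; rewrite geq_max => /andP[Nn xn] y.
rewrite inE => /predU1P[->|/(hN _ Nn)//].
by rewrite mem_pmap; apply/mapP; exists (pickle x); rewrite ?mem_iota ?add0n ?pickleK_inv.
Qed.

Lemma big_unpair (V : nmodType) (F : nat * nat -> V) n :
  \sum_(x <- unpair n) F x = \sum_(k < n) oapp F 0 (pickle_inv k).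
Proof.
rewrite big_pmap -(big_mkord xpredT (fun k => oapp F 0 (pickle_inv k))) /index_iota subn0.
by apply: eq_bigr => k _; case: pickle_inv.
Qed.

Lemma big_box (V : nmodType) (F : nat * nat -> V) K L :
  \sum_(x <- box K L) F x = \sum_(k < K) \sum_(l < L) F (val k, val l).
Proof.
rewrite big_allpairs -(big_mkord xpredT (fun k => \sum_(l < L) F (k, val l))) /index_iota subn0.
by apply: eq_bigr => k _; rewrite -(big_mkord xpredT (fun l => F (k, l))) /index_iota subn0.
Qed.

Lemma sum_uniq_sub (V : zmodType) (F : nat * nat -> V) s t : uniq s -> uniq t ->
  {subset s <= t} ->
  \sum_(x <- t) F x - \sum_(x <- s) F x = \sum_(x <- t | x \notin s) F x.
Proof.
move=> us ut st.
have -> : \sum_(x <- s) F x = \sum_(x <- t | x \in s) F x.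
  rewrite -[RHS]big_filter; apply: perm_big; apply: uniq_perm; rewrite ?filter_uniq //.
  by move=> x; rewrite mem_filter; case: (boolP (x \in s)) => //= /st ->.
by rewrite [X in X - _](bigID (fun x => x \in s)) /= addrAC subrr add0r.
Qed.

(** Absolute convergence makes the order of summation immaterial: once a box carries all but [e / 4]
    of the mass, any finite set of pairs containing it has a sum within [e / 4] of that of the
    box. *)
Lemma double_series (z : nat * nat -> C) (p : nat * nat -> R) (r : R)
    (zk : nat -> C) (Z : C) :
  (forall x, rnorm (z x) <= p x) ->
  (forall K L, \sum_(k < K) \sum_(l < L) p (val k, val l) <= r) ->
  (forall k, tends (fun L => \sum_(l < L) z (k, val l)) (zk k)) ->
  tends (fun K => \sum_(k < K) zk k) Z ->
  tends (fun n => \sum_(x <- unpair n) z x) Z.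
Proof.
move=> zp pr hzk hZ e e0.
have p0 x : 0 <= p x by apply: le_trans (rnorm_ge0 _) (zp x).
pose A := [set (\sum_(x <- box N N) p x) | N in [set: nat]].
have Asup : has_sup A.
  by split; [exists (\sum_(x <- box 0 0) p x), 0%N|exists r => _ [N _ <-]; rewrite big_box].
have e4 : 0 < e / 4 by rewrite divr_gt0.
have [_ [N _ <-] hN] := sup_adherent e4 Asup.
have tail s : uniq s -> {subset box N N <= s} ->
    rnorm (\sum_(x <- s) z x - \sum_(x <- box N N) z x) <= e / 4.
  move=> us bs; rewrite sum_uniq_sub ?uniq_box //.
  apply: le_trans (ler_cnorm_sum _ _ _) _.
  apply: (@le_trans _ _ (\sum_(x <- s | x \notin box N N) p x)).
    by apply: ler_sum => x _; apply: zp.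
  rewrite -sum_uniq_sub ?uniq_box // lerBlDr.
  have [M sM] : exists M, {subset s <= box M M}.
    elim: (s) => [|[k l] t [M hM]]; first by exists 0%N.
    exists (maxn M (maxn k l).+1) => -[x y]; rewrite inE => /predU1P[[-> ->]|/hM].
      by rewrite mem_box !leq_max !ltnS leq_maxl leq_maxr !orbT.
    by rewrite !mem_box !leq_max => /andP[-> ->].
  have h1 : \sum_(x <- s) p x <= \sum_(x <- box M M) p x.
    rewrite -subr_ge0 sum_uniq_sub ?uniq_box //; apply: sumr_ge0 => x _; exact: p0.
  have h2 : \sum_(x <- box M M) p x <= sup A by apply: ub_le_sup; [exact: Asup.2|exists M].
  lra.
(* The iterated sum is a limit, first in the columns and then in the rows, of sums over larger
   boxes. *)
have Zb : rnorm (Z - \sum_(x <- box N N) z x) <= e / 4.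
  apply: (@tends_bound _ _ (fun K => \sum_(k < K + N) zk k - \sum_(x <- box N N) z x)).
    apply: tendsD; first exact: (tends_shift N hZ).
    by apply: (@tends_near_cst _ _ _ _ 0).
  move=> K; apply: (@tends_bound _ _ (fun L => \sum_(x <- box (K + N) (L + N)) z x -
      \sum_(x <- box N N) z x)).
    apply: tendsD; last by apply: (@tends_near_cst _ _ _ _ 0).
    have -> : (fun L => \sum_(x <- box (K + N) (L + N)) z x) =
        (fun L => \sum_(k < K + N) \sum_(l < L + N) z (val k, val l)).
      by apply/funext => L; rewrite big_box.
    apply: tends_sum => k _.
    exact: (tends_shift N (hzk _)).
  move=> L; apply: tail; first exact: uniq_box.
  move=> [x y]; rewrite !mem_box => /andP[xN yN].
  by rewrite !(leq_trans _ (leq_addl _ _)).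
have [N1 hN1] := box_sub_unpair N N.
exists N1 => n N1n; have := tail _ (uniq_unpair n) (hN1 n N1n).
have := ler_cnormB (Z - \sum_(x <- box N N) z x)
  (\sum_(x <- unpair n) z x - \sum_(x <- box N N) z x).
have -> : Z - \sum_(x <- box N N) z x -
  (\sum_(x <- unpair n) z x - \sum_(x <- box N N) z x) = Z - \sum_(x <- unpair n) z x by ring.
lra.
Qed.

End Pairing.

(** Merges countably many decompositions into one. Infinite sums of nuclear forms, and later
    integrals, are reduced to this with additive bounds. *)
Lemma nuclear_series (phi : nat -> form) (r : nat -> R) (psi : form) (s : R) :
  (forall k, nuclear (phi k) (r k)) ->
  (forall K, \sum_(k < K) r k <= s) ->
  (forall v w, tends (fun K => \sum_(k < K) phi k v w) (psi v w)) ->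
  nuclear psi s.
Proof.
move=> /choice[a /choice[b ab]] rs phipsi.
pose aa x := a x.1 x.2 : H; pose bb x := b x.1 x.2 : H.
pose p x := rnorm (aa x) * rnorm (bb x).
have p0 x : 0 <= p x by rewrite mulr_ge0 ?rnorm_ge0.
have pr K L : \sum_(k < K) \sum_(l < L) p (val k, val l) <= s.
  by apply: le_trans (rs K); apply: ler_sum => k _; apply: (ab k).1.
(* Numbers that code no pair contribute the zero vector. *)
exists (fun n => oapp aa 0 (pickle_inv n)), (fun n => oapp bb 0 (pickle_inv n)); split.
  move=> n; apply: le_trans (_ : \sum_(x <- unpair n) p x <= _).
    rewrite big_unpair; apply: ler_sum => k _; case: pickle_inv => //=.
    by rewrite rnorm0 mul0r.
  have [N nN] := unpair_sub_box n.
  apply: le_trans (pr N N); rewrite -(big_box p) -subr_ge0 sum_uniq_sub ?uniq_box ?uniq_unpair //.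
  by apply: sumr_ge0 => x _.
move=> v w; pose z x := rank1 (aa x) (bb x) v w.
have -> : (fun n => \sum_(k < n) rank1 (oapp aa 0 (pickle_inv k)) (oapp bb 0 (pickle_inv k)) v w)
    = (fun n => \sum_(x <- unpair n) z x).
  apply/funext => n; rewrite big_unpair; apply: eq_bigr => k _.
  by case: pickle_inv => //=; rewrite /rank_one dot0l mulr0.
apply: (@double_series z (fun x => p x * (rnorm v * rnorm w)) (s * (rnorm v * rnorm w))
   (fun k => phi k v w)) => //.
- by move=> x; exact: rnorm_rank1.
- move=> K L; have -> : \sum_(k < K) \sum_(l < L) p (val k, val l) * (rnorm v * rnorm w) =
    (\sum_(k < K) \sum_(l < L) p (val k, val l)) * (rnorm v * rnorm w).
    by rewrite mulr_suml; apply: eq_bigr => k _; rewrite mulr_suml.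
  by rewrite ler_wpM2r // mulr_ge0 ?rnorm_ge0.
- by move=> k; exact: (ab k).2.
Qed.

Lemma nuclearD phi psi r s : nuclear phi r -> nuclear psi s ->
  nuclear (fun v w => phi v w + psi v w) (r + s).
Proof.
move=> hr hs; have r0 := nuclear_ge0 hr; have s0 := nuclear_ge0 hs.
apply: (@nuclear_series (fun k => nth (fun _ _ => 0) [:: phi; psi] k)
  (fun k => nth 0 [:: r; s] k)).
- by case=> [|[|k]] //=; rewrite nth_nil nth_nil; exact: nuclear0.
- case=> [|[|K]]; rewrite ?big_ord0 ?addr_ge0 //.
    by rewrite big_ord1 /= lerDl.
  rewrite !big_ord_recl /= big1 ?addr0 // => i _; by rewrite nth_nil.
- move=> v w; apply: (@tends_near_cst _ _ _ _ 2) => -[//|[//|n _]].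
  by rewrite !big_ord_recl /= big1 ?addr0 // => i _; rewrite nth_nil.
Qed.

Lemma nuclearN phi r : nuclear phi r -> nuclear (fun v w => - phi v w) r.
Proof.
move=> [a [b [ab h]]]; exists (fun k => - a k), b; split=> [n|v w].
  by under eq_bigr do rewrite rnormN.
have -> : (fun n => \sum_(k < n) rank1 (- a k) (b k) v w) =
  (fun n => - \sum_(k < n) rank1 (a k) (b k) v w).
  apply/funext => n; rewrite -sumrN; apply: eq_bigr => k _.
  by rewrite /rank_one dotNl mulrN.
exact: tendsN.
Qed.

End Nuclear.

(** * Fredholm determinants *)

Section FredholmDeterminant.
Context (R : realType) (H : completeNormedModType R[i]).
Context (dot : {dot H for Num.conj}).
Hypothesis H_hilbert : forall v : H, `|v| ^+ 2 = dot v v.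
Implicit Types u v w : H.
Local Notation C := R[i].
Local Notation ip := (inner dot).
Local Notation form := (H -> H -> C).
Local Notation nuclear := (nuclear dot).
Local Notation rank1 := (rank_one dot).

Lemma form_mxD e n (phi psi : form) :
  form_mx e n (fun v w => phi v w + psi v w) = form_mx e n phi + form_mx e n psi.
Proof. by apply/matrixP => i j; rewrite !mxE. Qed.

Lemma form_mx_rank1 e n a b : form_mx e n (rank1 a b) =
  (\col_i ip a (e i)) *m (\row_j ip (e j) b).
Proof. by apply/matrixP => i j; rewrite !mxE big_ord1 !mxE mulrC. Qed.

Lemma form_mx_sum e n I (s : seq I) (phi : I -> form) :
  form_mx e n (fun v w => \sum_(i <- s) phi i v w) = \sum_(i <- s) form_mx e n (phi i).
Proof.
apply/matrixP => i j; rewrite mxE summxE; apply: eq_bigr => k _.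
by rewrite mxE.
Qed.

Lemma form_det_eq e n (phi psi : form) : (forall v w, phi v w = psi v w) ->
  form_det e n phi = form_det e n psi.
Proof.
move=> E; congr (\det (_ + _)); apply/matrixP => i j; by rewrite !mxE.
Qed.

Section System.
Context (e : nat -> H).
Hypothesis e_orth : forall i j, i != j -> dot (e i) (e j) = 0.
Hypothesis e_unit : forall i, dot (e i) (e i) = 1 \/ e i = 0.

Let bessel_l n a : \sum_(i < n) rnorm (ip a (e i)) ^+ 2 <= rnorm a ^+ 2.
Proof. exact: bessel. Qed.

Let bessel_r n b : \sum_(i < n) rnorm (ip (e i) b) ^+ 2 <= rnorm b ^+ 2.
Proof.
apply: le_trans (bessel_l n b); apply: ler_sum => i _.
by rewrite dotC rnorm_conj.
Qed.

Lemma trace_norm_rank1_mx n a b :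
  trace_norm_le (form_mx e n (rank1 a b)) (rnorm a * rnorm b).
Proof.
rewrite form_mx_rank1; apply: trace_norm_le_rank1; rewrite ?rnorm_ge0 //.
  by under eq_bigr do rewrite mxE; exact: bessel_l.
by under eq_bigr do rewrite mxE; exact: bessel_r.
Qed.

Lemma trace_norm_sum_mx n (a b : nat -> H) K :
  trace_norm_le (form_mx e n (fun v w => \sum_(k < K) rank1 (a k) (b k) v w))
    (\sum_(k < K) rnorm (a k) * rnorm (b k)).
Proof.
rewrite form_mx_sum; elim: K => [|K ih]; first by rewrite !big_ord0; exact: trace_norm_le0.
by rewrite !big_ord_recr /=; apply: trace_norm_leD => //; apply: trace_norm_rank1_mx.
Qed.

Lemma trace_norm_nuclear n phi r : nuclear phi r -> trace_norm_le (form_mx e n phi) r.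
Proof.
move=> [a [b [ab h]]] X c c0 Xc.
apply: (@tends_bound _ _ (fun K => \sum_i \sum_j X i j *
   form_mx e n (fun v w => \sum_(k < K) rank1 (a k) (b k) v w) i j)).
  apply: tends_sum => i _; apply: tends_sum => j _; apply: tendsM.
    by apply: (@tends_near_cst _ _ _ _ 0).
  have -> : (fun K => form_mx e n (fun v w => \sum_(k < K) rank1 (a k) (b k) v w) i j) =
    (fun K => \sum_(k < K) rank1 (a k) (b k) (e j) (e i)).
    by apply/funext => K; rewrite mxE.
  by rewrite mxE; apply: h.
move=> K; have /le_trans := @trace_norm_sum_mx n a b K X c c0 Xc; apply.
by rewrite ler_wpM2l.
Qed.

Lemma form_det_bound n phi r : nuclear phi r -> rnorm (form_det e n phi) <= det_bound r.
Proof. by move=> h; apply/det_trace_norm/trace_norm_nuclear. Qed.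

Lemma tends_form_det n (phi : nat -> form) (psi : form) :
  (forall v w, tends (fun K => phi K v w) (psi v w)) ->
  tends (fun K => form_det e n (phi K)) (form_det e n psi).
Proof.
move=> h; apply: tends_det => i j; rewrite !mxE.
have -> : (fun k => (1%:M + form_mx e n (phi k)) i j) =
  (fun k => (1%:M : 'M[C]_n) i j + phi k (e j) (e i)).
  by apply/funext => k; rewrite !mxE.
rewrite mxE; apply: tendsD; last exact: h.
by apply: (@tends_near_cst _ _ _ _ 0).
Qed.

(** The rank one terms of [psi] are added one at a time; the partial sums stay within trace norm
    [r + s], so a single constant serves all steps, whatever their number and the size [n]. *)
Lemma form_det_lipschitz n phi psi r s : nuclear phi r -> nuclear psi s ->
  rnorm (form_det e n (fun v w => phi v w + psi v w) - form_det e n phi)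
    <= s * det_bound (r + s + 1).
Proof.
move=> hr hs; have r0 := nuclear_ge0 hr; have s0 := nuclear_ge0 hs.
have [a [b [ab h]]] := hs.
pose psi_ K : form := fun v w => \sum_(k < K) rank1 (a k) (b k) v w.
apply: (@tends_bound _ _ (fun K => form_det e n (fun v w => phi v w + psi_ K v w)
  - form_det e n phi)).
  apply: tendsD; last by apply: (@tends_near_cst _ _ _ _ 0).
  apply: tends_form_det => v w; apply: tendsD; last exact: h.
  by apply: (@tends_near_cst _ _ _ _ 0).
move=> K; apply: le_trans (_ : (\sum_(k < K) rnorm (a k) * rnorm (b k)) *
    det_bound (r + s + 1) <= _); last first.
  by apply: ler_wpM2r; rewrite ?(ltW (det_bound_gt0 _)).
elim: K => [|K ih].
  rewrite big_ord0 mul0r (@form_det_eq _ _ _ phi) ?subrr ?cnorm0 //.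
  by move=> v w; rewrite /psi_ big_ord0 addr0.
rewrite big_ord_recr /= mulrDl.
have -> : form_det e n (fun v w => phi v w + psi_ K.+1 v w) - form_det e n phi =
  (form_det e n (fun v w => phi v w + psi_ K v w) - form_det e n phi) +
  (form_det e n (fun v w => phi v w + psi_ K.+1 v w) -
   form_det e n (fun v w => phi v w + psi_ K v w)) by ring.
apply: le_trans (ler_cnormD _ _) (lerD ih _).
have A : trace_norm_le (form_mx e n (fun v w => phi v w + psi_ K v w)) (r + s).
  rewrite form_mxD; apply: trace_norm_leD; first exact: trace_norm_nuclear.
  by apply: trace_norm_le_weak (ab K); apply: trace_norm_sum_mx.
have -> : form_det e n (fun v w => phi v w + psi_ K.+1 v w) =
    \det (1%:M + (form_mx e n (fun v w => phi v w + psi_ K v w) +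
      (\col_i ip (a K) (e i)) *m (\row_j ip (e j) (b K)))).
  rewrite -form_mx_rank1 -form_mxD; apply: form_det_eq => v w.
  by rewrite /psi_ big_ord_recr /= addrA.
apply: det_rank1_step => //; rewrite ?rnorm_ge0 //.
  by under eq_bigr do rewrite mxE; exact: bessel_l.
by under eq_bigr do rewrite mxE; exact: bessel_r.
Qed.

(** Sylvester's identity trades a determinant of size [n] for one of the fixed size [K], whose limit
    in [n] can be taken entrywise. *)
Lemma form_det_finite_rank n (a b : nat -> H) K :
  form_det e n (fun v w => \sum_(k < K) rank1 (a k) (b k) v w) =
  \det (1%:M + \matrix_(k < K, l < K) ip (fourier_sum dot e n (a l)) (b k)).
Proof.
pose U := \matrix_(i < n, l < K) ip (a l) (e i).
pose V := \matrix_(l < K, j < n) ip (e j) (b l).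
have -> : form_det e n (fun v w => \sum_(k < K) rank1 (a k) (b k) v w) =
    \det (1%:M + U *m V).
  congr (\det (_ + _)); apply/matrixP => i j; rewrite !mxE.
  by apply: eq_bigr => k _; rewrite !mxE mulrC.
rewrite det_add_comm; congr (\det (_ + _)); apply/matrixP => k l; rewrite !mxE.
by rewrite ip_fourier; apply: eq_bigr => i _; rewrite !mxE mulrC.
Qed.

Hypothesis e_complete : forall v, (forall i, dot v (e i) = 0) -> v = 0.

Lemma form_det_finite_rank_tends (a b : nat -> H) K :
  tends (fun n => form_det e n (fun v w => \sum_(k < K) rank1 (a k) (b k) v w))
    (\det (1%:M + \matrix_(k < K, l < K) ip (a l) (b k))).
Proof.
under eq_fun do rewrite form_det_finite_rank.
apply: tends_det => k l; rewrite !mxE.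
have -> : (fun n => (1%:M + \matrix_(k < K, l < K) ip (fourier_sum dot e n (a l)) (b k)) k l) =
  (fun n => (1%:M : 'M[C]_K) k l + ip (fourier_sum dot e n (a l)) (b k)).
  by apply/funext => n; rewrite !mxE.
rewrite mxE; apply: tendsD; first by apply: (@tends_near_cst _ _ _ _ 0).
by apply: (tends_dotl H_hilbert); exact: fourier_tends.
Qed.

End System.

Lemma nuclear_tail a b phi r : nuclear_by dot a b phi r ->
  exists t : nat -> R, [/\ forall K, 0 <= t K,
    forall K, nuclear (fun v w => phi v w - \sum_(k < K) rank1 (a k) (b k) v w) (t K) &
    forall d : R, 0 < d -> exists N, forall n, (N <= n)%N -> t n < d].
Proof.
move=> [ab h].
pose s n := \sum_(k < n) rnorm (a k) * rnorm (b k).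
have s_ndecr : {homo s : m n / (m <= n)%N >-> m <= n}.
  move=> m n mn; rewrite /s -!(big_mkord xpredT (fun k => rnorm (a k) * rnorm (b k))).
  rewrite (big_cat_nat (leq0n m) mn) /= lerDl.
  by apply: sumr_ge0 => i _; rewrite mulr_ge0 ?rnorm_ge0.
have sub : has_sup (range s).
  by split; [exists (s 0%N), 0%N|exists r => _ [n _ <-]; exact: ab].
have sle n : s n <= sup (range s) by apply: ub_le_sup; [exact: sub.2|exists n].
exists (fun K => sup (range s) - s K); split.
- by move=> K; rewrite subr_ge0.
- move=> K; exists (fun k => a (k + K)%N), (fun k => b (k + K)%N).
  have E (V : zmodType) (F : nat -> V) n :
      \sum_(k < n) F (k + K)%N = \sum_(k < n + K) F k - \sum_(k < K) F k.
    rewrite -!(big_mkord xpredT F) (big_cat_nat (leq0n K) (leq_addl n K)) /=.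
    rewrite addrAC subrr add0r -(big_mkord xpredT (fun k => F (k + K)%N)).
    by have := big_addn 0 (n + K) K xpredT F; rewrite add0n addnK => ->.
  split=> [n|v w].
    by rewrite (E _ (fun k => rnorm (a k) * rnorm (b k))) lerD2r; exact: sle.
  under eq_fun do rewrite (E _ (fun k => rank1 (a k) (b k) v w)).
  apply: tendsD; first exact: (tends_shift K (h v w)).
  by apply: (@tends_near_cst _ _ _ _ 0).
- move=> d d0; have [_ [N _ <-] hN] := sup_adherent d0 sub.
  exists N => n Nn; have := s_ndecr _ _ Nn. rewrite /=. lra.
Qed.

(** For truncations of rank [K] the limit [D K] is given by a formula in which no basis occurs, and
    truncation errors are uniform in [n] and in the basis. Hence [D] is Cauchy and its limit serves
    every basis; one basis is needed to compare [D K] with [D L]. *)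
Lemma form_det_cvg phi r : nuclear phi r -> (exists e, orthonormal_basis dot e) ->
  exists d, forall e, orthonormal_basis dot e -> tends (fun n => form_det e n phi) d.
Proof.
move=> [a [b hab]] [e0 be0].
have [t [t0 tn tlim]] := nuclear_tail hab; have [ab h] := hab.
have r0 : 0 <= r by have := ab 0%N; rewrite big_ord0.
pose phi_ K : form := fun v w => \sum_(k < K) rank1 (a k) (b k) v w.
pose D K := \det (1%:M + \matrix_(k < K, l < K) ip (a l) (b k)).
have [N0 hN0] := tlim 1 ltr01.
pose B := det_bound (r + 1 + 1); have B0 : 0 < B by apply: det_bound_gt0.
have phiK K : nuclear (phi_ K) r.
  exists (fun k => if (k < K)%N then a k else 0), b; split.
    move=> n; apply: le_trans (ab n); apply: ler_sum => k _; case: ifP => // _.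
    by rewrite rnorm0 mul0r mulr_ge0 ?rnorm_ge0.
  move=> v w; apply: (@tends_near_cst _ _ _ _ K) => n Kn.
  rewrite -(big_mkord xpredT (fun k => rank1 (if (k < K)%N then a k else 0) (b k) v w)).
  rewrite (big_cat_nat (leq0n K) Kn) /=.
  have -> : \sum_(K <= k < n) rank1 (if (k < K)%N then a k else 0) (b k) v w = 0.
    rewrite big_nat_cond big1 // => k /andP[/andP[Kk _] _].
    by rewrite ltnNge Kk /= /rank_one dot0l mulr0.
  by rewrite addr0 big_mkord; apply: eq_bigr => k _; rewrite ltn_ord.
have near e : orthonormal_basis dot e -> forall n K, (N0 <= K)%N ->
    rnorm (form_det e n phi - form_det e n (phi_ K)) <= t K * B.
  move=> [be1 be2 _] n K NK.
  have := form_det_lipschitz be1 be2 n (phiK K) (tn K).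
  rewrite (@form_det_eq e n _ phi); last by move=> v w; rewrite /phi_; ring.
  move=> /le_trans; apply; rewrite ler_wpM2l //; apply: det_bound_le.
    by have := t0 K; lra.
  by have := hN0 K NK; lra.
have Dn e : orthonormal_basis dot e -> forall K, tends (fun n => form_det e n (phi_ K)) (D K).
  by move=> [be1 be2 be3] K; exact: form_det_finite_rank_tends.
have Dcauchy K L : (N0 <= K)%N -> (N0 <= L)%N -> rnorm (D K - D L) <= t K * B + t L * B.
  move=> NK NL; apply: (@tends_bound _ _ (fun n => form_det e0 n (phi_ K) - form_det e0 n (phi_ L))).
    by apply: tendsD; [exact: Dn|apply: tendsN; exact: Dn].
  move=> n; have := near e0 be0 n K NK; have := near e0 be0 n L NL.
  rewrite (cnormB (form_det e0 n phi) (form_det e0 n (phi_ K))).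
  have := ler_cnormD (form_det e0 n (phi_ K) - form_det e0 n phi)
    (form_det e0 n phi - form_det e0 n (phi_ L)).
  by rewrite addrA subrK; lra.
have [|d Dd] := @complex_cauchy_tends _ D.
  move=> eps eps0; have [|N hN] := tlim (eps / (2 * B)); first by rewrite divr_gt0 // mulr_gt0.
  exists (maxn N N0) => K L; rewrite !geq_max => /andP[NK N0K] /andP[NL N0L].
  apply: le_lt_trans (Dcauchy _ _ N0K N0L) _.
  have -> : eps = eps / (2 * B) * B + eps / (2 * B) * B by field; lra.
  by apply: ltrD; rewrite ltr_pM2r // hN.
exists d => e be eps eps0; have e3 : 0 < eps / 3 by rewrite divr_gt0.
have [N1 hN1] := Dd _ e3.
have [|N2 hN2] := tlim (eps / 3 / B); first by rewrite divr_gt0.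
pose K := maxn N0 (maxn N1 N2).
have [N3 hN3] := Dn e be K _ e3; exists N3 => n /hN3 g3.
have g1 := hN1 K (leq_trans (leq_maxl _ _) (leq_maxr _ _)).
have g2 := hN2 K (leq_trans (leq_maxr _ _) (leq_maxr _ _)).
have := near e be n K (leq_maxl _ _); rewrite cnormB => g4.
have : t K * B < eps / 3 by rewrite -ltr_pdivlMr.
have -> : d - form_det e n phi = (d - D K) + ((D K - form_det e n (phi_ K)) +
   (form_det e n (phi_ K) - form_det e n phi)) by ring.
have := ler_cnormD (d - D K) ((D K - form_det e n (phi_ K)) +
   (form_det e n (phi_ K) - form_det e n phi)).
have := ler_cnormD (D K - form_det e n (phi_ K)) (form_det e n (phi_ K) - form_det e n phi).
lra.
Qed.

End FredholmDeterminant.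

(** Dominated convergence for series: a finite head carries all but [d / 2] of the dominating mass,
    and the head itself tends to zero term by term. *)
Lemma dominated_series (R : realType) (x : nat -> nat -> R) (y : nat -> R) (r : R) :
  (forall n k, 0 <= x n k <= y k) -> (forall m, \sum_(k < m) y k <= r) ->
  (forall k (d : R), 0 < d -> exists N, forall n, (N <= n)%N -> x n k <= d) ->
  forall d : R, 0 < d -> exists N, forall n, (N <= n)%N -> forall m, \sum_(k < m) x n k <= d.
Proof.
move=> xy yr x0 d d0; have d2 : 0 < d / 2 by rewrite divr_gt0.
have sub : has_sup (range (fun n => \sum_(k < n) y k)).
  by split; [exists (\sum_(k < 0) y k), 0%N|exists r => _ [n _ <-]].
have [_ [K _ <-] hK] := sup_adherent d2 sub.
have yK m : \sum_(k < m) y k <= \sum_(k < K) y k + d / 2.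
  have : \sum_(k < m) y k <= sup (range (fun n => \sum_(k < n) y k)).
    by apply: ub_le_sup; [exact: sub.2|exists m].
  lra.
have [N hN] : exists N, forall n, (N <= n)%N -> \sum_(k < K) x n k <= d / 2.
  elim: K (d / 2) d2 {hK yK} => [|K ih] c c0.
    by exists 0%N => n _; rewrite big_ord0 ltW.
  have c2 : 0 < c / 2 by rewrite divr_gt0.
  have [N1 h1] := ih _ c2; have [N2 h2] := x0 K _ c2.
  exists (maxn N1 N2) => n; rewrite geq_max => /andP[/h1 + /h2]; rewrite big_ord_recr /=; lra.
exists N => n /hN xK m; have nn k : 0 <= x n k by case/andP: (xy n k).
have [mK|/ltnW Km] := leqP m K.
  apply: le_trans (_ : \sum_(k < K) x n k <= _); last by lra.
  rewrite -!(big_mkord xpredT (x n)) (big_cat_nat (leq0n m) mK) /= lerDl.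
  by apply: sumr_ge0 => i _.
move: (yK m) xK; rewrite -!(big_mkord xpredT (x n)) -!(big_mkord xpredT y).
rewrite !(big_cat_nat (leq0n K) Km) /=.
have : \sum_(K <= i < m) x n i <= \sum_(K <= i < m) y i.
  by apply: ler_sum => i _; case/andP: (xy n i).
lra.
Qed.

(** * Rank one perturbations and nonvanishing of the Fredholm determinant *)

Section FredholmPerturbation.
Context (R : realType) (H : completeNormedModType R[i]).
Context (dot : {dot H for Num.conj}).
Hypothesis H_hilbert : forall v : H, `|v| ^+ 2 = dot v v.
Implicit Types u v w : H.
Local Notation C := R[i].
Local Notation ip := (inner dot).
Local Notation form := (H -> H -> C).
Local Notation nuclear := (nuclear dot).
Local Notation rank1 := (rank_one dot).

Context (e : nat -> H).
Hypothesis e_basis : orthonormal_basis dot e.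

Let e_orth : forall i j, i != j -> dot (e i) (e j) = 0.
Proof. by case: e_basis. Qed.

Let e_unit : forall i, dot (e i) (e i) = 1 \/ e i = 0.
Proof. by case: e_basis. Qed.

Let e_complete : forall v, (forall i, dot v (e i) = 0) -> v = 0.
Proof. by case: e_basis. Qed.

(** Complex linearity as a predicate, for operators such as [Rop] and the adjoints that come as bare
    functions. *)
Definition additive_fun (T : H -> H) := forall (a : C) u v, T (a *: u + v) = a *: T u + T v.

Lemma additive_funB T u v : additive_fun T -> T (u - v) = T u - T v.
Proof.
move=> lT; have := lT (-1) v u.
by rewrite !scaleN1r addrC [- T v + _]addrC.
Qed.

Lemma additive_fun_sum T I (s : seq I) (c : I -> C) (f : I -> H) : additive_fun T ->
  T (\sum_(i <- s) c i *: f i) = \sum_(i <- s) c i *: T (f i).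
Proof.
move=> lT; elim: s => [|i s ih]; last by rewrite !big_cons lT ih.
by rewrite !big_nil; have := additive_funB 0 0 lT; rewrite !subrr.
Qed.

Lemma bounded_adjoint (T : H -> H) (M : R) : additive_fun T ->
  (forall v, rnorm (T v) <= M * rnorm v) ->
  exists Ts : H -> H, forall v w, ip (T v) w = ip v (Ts w).
Proof.
move=> lT TM.
suff key w : exists z, forall v, ip (T v) w = ip v z.
  by have [Ts h] := choice key; exists Ts => v w; apply: h.
apply: (riesz_basis H_hilbert e_orth e_unit e_complete (l := fun v => ip (T v) w)
  (M := M * rnorm w)).
  by move=> a u v; rewrite lT dotDl dotZl.
move=> v; apply: le_trans (cauchy_schwarz H_hilbert _ _) _.
by rewrite mulrAC ler_wpM2r ?rnorm_ge0.
Qed.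

Section Operator.
Context (T : H -> H) (r : R).
Hypothesis T_nuclear : nuclear (fun v w => ip (T v) w) r.

Lemma nuclear_additive : additive_fun T.
Proof.
have [a [b [_ h]]] := T_nuclear => z u v; apply: (dot_inj H_hilbert) => w.
rewrite dotDl dotZl; apply: (tends_unique (h _ w)).
have -> : (fun n => \sum_(k < n) rank1 (a k) (b k) (z *: u + v) w) =
  (fun n => z * \sum_(k < n) rank1 (a k) (b k) u w + \sum_(k < n) rank1 (a k) (b k) v w).
  apply/funext => n; rewrite mulr_sumr -big_split /=; apply: eq_bigr => k _.
  by rewrite /rank_one dotDl dotZl mulrDl mulrA.
apply: tendsD (h _ _); apply: tendsM (h _ _).
by apply: (@tends_near_cst _ _ _ _ 0).
Qed.

Lemma nuclear_operator_bound v : rnorm (T v) <= r * rnorm v.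
Proof.
have r0 := nuclear_ge0 T_nuclear.
have := nuclear_bound H_hilbert v (T v) T_nuclear.
rewrite (dotvv H_hilbert) rnorm_realc ger0_norm ?sqr_ge0 //.
have [->|h0] := eqVneq (rnorm (T v)) 0; first by rewrite mulr_ge0 ?rnorm_ge0.
have h1 : 0 < rnorm (T v) by rewrite lt_neqAle eq_sym h0 rnorm_ge0.
by rewrite expr2 mulrA ler_pM2r.
Qed.

(** The operator [v |-> <v, c> (u + T u)] is [I + T] composed with [v |-> <v, c> u], so the
    determinant should gain the factor [1 + <u, c>]. At level [n] this is exact once [T u] is
    replaced by [T (P n u)]; the error [rho n] tends to zero in norm. *)
Lemma form_det_rank1_tends (d : C) u c :
  tends (fun n => form_det e n (fun v w => ip (T v) w)) d ->
  tends (fun n => form_det e n (fun v w => ip (T v) w + rank1 (u + T u) c v w))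
    (d * (1 + ip u c)).
Proof.
move=> hd; have r0 := nuclear_ge0 T_nuclear; have lT := nuclear_additive.
pose P n := fourier_sum dot e n u.
have Pu : tends P u by exact: fourier_tends.
pose rho n := T (u - P n).
pose phi : form := fun v w => ip (T v) w.
pose phi1 n : form := fun v w => phi v w + rank1 (u + T u - rho n) c v w.
(* With [A] the compression of [T], the matrix is [(1 + A) (1 + U V)], and Sylvester's identity
   evaluates the second factor. *)
have det1 n : form_det e n (phi1 n) = form_det e n phi * (1 + ip (P n) c).
  pose U := \col_(i < n) ip u (e i); pose V := \row_(j < n) ip (e j) c.
  have colE : \col_(i < n) ip (u + T u - rho n) (e i) = (1%:M + form_mx e n phi) *m U.
    apply/colP => i; rewrite mxE mulmxDl mul1mx mxE [U i 0]mxE.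
    rewrite /rho additive_funB // opprB -addrA (addrC (T u)) subrK.
    rewrite dotDl; congr (_ + _).
    rewrite additive_fun_sum // dot_suml mxE; apply: eq_bigr => j _.
    by rewrite !mxE dotZl mulrC.
  rewrite /form_det form_mxD form_mx_rank1 colE addrA.
  rewrite -mulmxA -{1}[1%:M + form_mx e n phi]mulmx1 -mulmxDr det_mulmx det_add_comm.
  congr (_ * _); rewrite -[1%:M + V *m U]/(1%:M + V *m U) det_mx11 !mxE eqxx; congr (_ + _).
  by rewrite ip_fourier; apply: eq_bigr => i _; rewrite !mxE mulrC.
pose L := r + (rnorm (u + T u) + r * (2 * rnorm u)) * rnorm c.
have L0 : 0 <= L by rewrite addr_ge0 // !(mulr_ge0,addr_ge0,rnorm_ge0).
pose g n := r * rnorm (u - P n) * rnorm c.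
have rhoL n : rnorm (rho n) <= r * rnorm (u - P n) by apply: nuclear_operator_bound.
have uP n : rnorm (u - P n) <= 2 * rnorm u.
  apply: le_trans (ler_rnormB _ _) _.
  by have := rnorm_fourier_le H_hilbert e_orth e_unit n u; rewrite -/(P n); lra.
have close n : rnorm (form_det e n (fun v w => phi v w + rank1 (u + T u) c v w)
     - form_det e n (phi1 n)) <= g n * det_bound (L + r * (2 * rnorm u) * rnorm c + 1).
  have n1 : nuclear (phi1 n) L.
    apply: nuclear_weak (nuclearD H_hilbert T_nuclear (nuclear_rank1 _ _ _)) _.
    rewrite lerD2l ler_wpM2r ?rnorm_ge0 //; apply: le_trans (ler_rnormB _ _) _.
    by rewrite lerD2l (le_trans (rhoL n)) // ler_wpM2l.
  have n2 := nuclear_rank1 dot (rho n) c.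
  have := form_det_lipschitz H_hilbert e_orth e_unit n n1 n2.
  rewrite (@form_det_eq _ _ e n _ (fun v w => phi v w + rank1 (u + T u) c v w)); last first.
    by move=> v w; rewrite /phi1 /rank_one dotBl; ring.
  move=> /le_trans; apply; apply: ler_pM; rewrite ?(ltW (det_bound_gt0 _)) //.
  - by rewrite mulr_ge0 ?rnorm_ge0.
  - by rewrite ler_wpM2r ?rnorm_ge0.
  - apply: det_bound_le; first by rewrite !(mulr_ge0, addr_ge0, rnorm_ge0).
    rewrite lerD2r lerD2l ler_wpM2r ?rnorm_ge0 //.
    by apply: le_trans (rhoL n) _; rewrite ler_wpM2l.
set B := det_bound _ in close; have B0 : 0 < B by apply: det_bound_gt0.
have lim1 : tends (fun n => form_det e n (phi1 n)) (d * (1 + ip u c)).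
  under eq_fun do rewrite det1.
  apply: tendsM => //; apply: tendsD; first by apply: (@tends_near_cst _ _ _ _ 0).
  exact: (tends_dotl H_hilbert).
move=> eps eps0; have e2 : 0 < eps / 2 by rewrite divr_gt0.
have [N1 h1] := lim1 _ e2.
pose Q := (r * rnorm c + 1) * B.
have Q0 : 0 < Q by rewrite mulr_gt0 // ltr_wpDl // mulr_ge0 ?rnorm_ge0.
have [|N2 h2] := Pu (eps / 2 / Q); first by rewrite divr_gt0.
exists (maxn N1 N2) => n; rewrite geq_max => /andP[/h1 b1 /h2 b2].
have := ler_cnormB (d * (1 + ip u c) - form_det e n (phi1 n))
 (form_det e n (fun v w => phi v w + rank1 (u + T u) c v w) - form_det e n (phi1 n)).
rewrite opprB addrA subrK => b3; apply: le_lt_trans b3 _.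
have b4 : g n * B < eps / 2.
  move: b2; rewrite ltr_pdivlMr //; apply: le_lt_trans.
  rewrite /g /Q mulrA ler_wpM2r ?(ltW B0) //.
  by have := rnorm_ge0 (u - P n); nra.
by have := close n; lra.
Qed.

Context (J : H -> H) (M : R).
Hypothesis J_additive : additive_fun J.
Hypothesis J_bound : forall v, rnorm (J v) <= M * rnorm v.
Hypothesis M_ge0 : 0 <= M.
Hypothesis J_left : forall v, J (v + T v) = v.

(* The compressions of [(J - I) + T + (J - I) T = 0] show that
   [det (I + P (J - I) P) det (I + P T P)] tends to [1]. *)
Lemma form_det_neq0 (d : C) :
  tends (fun n => form_det e n (fun v w => ip (T v) w)) d -> d != 0.
Proof.
move=> hd; have r0 := nuclear_ge0 T_nuclear; have lT := nuclear_additive.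
have [Js hJs] := bounded_adjoint J_additive J_bound.
(* This is [J - I] by [T'E]: the factored form shows that it is nuclear, the difference gives its
   adjoint. *)
pose T' v := - J (T v).
have T'E v : T' v = J v - v.
  by have := J_left v; rewrite -[v in J (v + _)]scale1r J_additive scale1r /T'
     => E; rewrite -[X in _ - X]E opprD addrA subrr add0r.
have lT' : additive_fun T'.
  by move=> a u v; rewrite /T' lT J_additive opprD scalerN.
have T'bound v : rnorm (T' v) <= (M + 1) * rnorm v.
  by rewrite T'E (le_trans (ler_rnormB _ _)) // mulrDl mul1r lerD2r.
have T'adj v w : ip (T' v) w = ip v (Js w - w).
  by rewrite T'E dotBl dotBr hJs.
have [a [b [ab h]]] := T_nuclear.
pose phi : form := fun v w => ip (T v) w.
pose phi' : form := fun v w => ip (T' v) w.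
have nphi' : nuclear phi' (M * r).
  exists (fun k => - J (a k)), b; split.
    move=> n; apply: le_trans (_ : M * (\sum_(k < n) rnorm (a k) * rnorm (b k)) <= _).
      rewrite mulr_sumr; apply: ler_sum => k _.
      by rewrite rnormN mulrA ler_wpM2r ?rnorm_ge0.
    by rewrite ler_wpM2l.
  move=> v w; have -> : phi' v w = ip (T v) (- Js w).
    by rewrite /phi' /T' dotNl dotNr hJs.
  have -> : (fun n => \sum_(k < n) rank1 (- J (a k)) (b k) v w) =
     (fun n => \sum_(k < n) rank1 (a k) (b k) v (- Js w)).
    apply/funext => n; apply: eq_bigr => k _.
    by rewrite /rank_one dotNl dotNr hJs.
  exact: h.
pose P n v := fourier_sum dot e n v.
(* The defect of multiplicativity [T' (I - P n) T], left over because the compression inserts [P n]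
   between the factors. *)
pose eps n : form := fun v w => ip (T' (T v - P n (T v))) w.
have epsE n v w : eps n v w = ip (T v) (Js w - w - P n (Js w - w)).
  by rewrite /eps T'adj dotBl [in RHS]dotBr /P ip_fourierC.
have detE n : form_det e n phi' * form_det e n phi = form_det e n (fun v w => - eps n v w).
  rewrite /form_det -det_mulmx; congr (\det _).
  rewrite mulmxDl mul1mx mulmxDr mulmx1 -addrA; congr (_ + _).
  apply/matrixP => i j; rewrite !mxE.
  have -> : \sum_k form_mx e n phi' i k * form_mx e n phi k j =
      ip (T' (P n (T (e j)))) (e i).
    rewrite additive_fun_sum // dot_suml; apply: eq_bigr => k _.
    by rewrite !mxE dotZl mulrC.
  rewrite /eps /phi /phi' additive_funB // dotBl opprB.
  set X := ip (T' (P n (T (e j)))) (e i).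
  by rewrite (T'E (T (e j))) dotBl /T' dotNl; ring.
(* [P n] tends to the identity only pointwise; summability of the norms turns this into smallness in
   trace norm. *)
have small (del : R) : 0 < del -> exists N, forall n, (N <= n)%N -> nuclear (eps n) del.
  move=> del0.
  pose M1 := M + 1; have M10 : 0 < M1 by rewrite ltr_wpDl.
  have finK : exists N, forall n, (N <= n)%N -> forall m,
      \sum_(k < m) rnorm (a k - P n (a k)) * rnorm (b k) <= del / M1.
    apply: (@dominated_series _ (fun n k => rnorm (a k - P n (a k)) * rnorm (b k))
      (fun k => 2 * (rnorm (a k) * rnorm (b k))) (2 * r)).
    - move=> n k; rewrite mulr_ge0 ?rnorm_ge0 //= mulrA ler_wpM2r ?rnorm_ge0 //.
      apply: le_trans (ler_rnormB _ _) _.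
      have := rnorm_fourier_le H_hilbert e_orth e_unit n (a k); rewrite -/(P n _); lra.
    - by move=> m; rewrite -mulr_sumr ler_wpM2l.
    - move=> k c c0; have := fourier_tends H_hilbert e_orth e_unit e_complete (a k).
      have b1 : 0 < rnorm (b k) + 1 by rewrite ltr_wpDl ?rnorm_ge0.
      move=> /(_ (c / (rnorm (b k) + 1))); rewrite divr_gt0 // => /(_ isT)[N hN].
      exists N => n /hN; rewrite ltr_pdivlMr // => /ltW; apply: le_trans.
      by rewrite ler_wpM2l ?rnorm_ge0 // lerDl.
    - by rewrite divr_gt0.
  have [N hN] := finK; exists N => n Nn.
  exists (fun k => T' (a k - P n (a k))), b; split.
    move=> m; apply: (@le_trans _ _ (M1 * \sum_(k < m) rnorm (a k - P n (a k)) * rnorm (b k))).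
      rewrite mulr_sumr; apply: ler_sum => k _.
      by rewrite mulrA ler_wpM2r ?rnorm_ge0.
    by rewrite mulrC -ler_pdivlMr //; apply: hN.
  move=> v w; rewrite epsE.
  have -> : (fun m => \sum_(k < m) rank1 (T' (a k - P n (a k))) (b k) v w) =
    (fun m => \sum_(k < m) rank1 (a k) (b k) v (Js w - w - P n (Js w - w))).
    apply/funext => m; apply: eq_bigr => k _.
    by rewrite /rank_one T'adj dotBl [ip (a k) (_ - P n _)]dotBr /P ip_fourierC.
  exact: h.
apply/negP => /eqP d0.
have nB n : rnorm (form_det e n phi') <= det_bound (M * r).
  exact: (form_det_bound H_hilbert e_orth e_unit).
set B := det_bound (M * r) in nB; have B0 : 0 < B by apply: det_bound_gt0.
pose B1 : R := det_bound (0 + 1 + 1); have B10 : 0 < B1 by apply: det_bound_gt0.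
(* If [d = 0], the product of the two determinants is within [1 / 4] of [1] by the choice of [del],
   and of modulus at most [1 / 4] by the choice of [N2]. *)
pose del := Num.min 1 (1 / (4 * B1)).
have del0 : 0 < del by rewrite lt_min ltr01 divr_gt0 // mulr_gt0.
have [N1 h1] := small _ del0.
have [|N2 h2] := hd (1 / (4 * B)); first by rewrite divr_gt0 // mulr_gt0.
pose n := maxn N1 N2.
have g1 := h1 n (leq_maxl _ _); have := h2 n (leq_maxr _ _).
rewrite d0 cnormB subr0 -/phi => g2.
have := form_det_lipschitz H_hilbert e_orth e_unit n (nuclear0 dot) (nuclearN g1).
have -> : form_det e n (fun _ _ => 0) = 1.
  rewrite /form_det (_ : form_mx _ _ _ = 0) ?addr0 ?det1 //.
  by apply/matrixP => i j; rewrite !mxE.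
rewrite (@form_det_eq _ _ e n _ (fun v w => - eps n v w)); last by move=> v w; rewrite add0r.
rewrite -detE => g3.
have : del * det_bound (0 + del + 1) <= 1 / 4.
  apply: (@le_trans _ _ (1 / (4 * B1) * B1)); last first.
    by rewrite le_eqVlt; apply/orP; left; apply/eqP; field; lra.
  apply: ler_pM; rewrite ?(ltW del0) ?(ltW (det_bound_gt0 _)) //.
    by rewrite ge_min lexx orbT.
  by apply: det_bound_le; rewrite ?addr_ge0 ?(ltW del0) // lerD2r lerD2l ge_min lexx.
have : rnorm (form_det e n phi' * form_det e n phi) <= 1 / 4.
  rewrite rnormM; apply: (@le_trans _ _ (B * (1 / (4 * B)))).
    by apply: ler_pM; rewrite ?rnorm_ge0 // ltW.
  by rewrite le_eqVlt; apply/orP; left; apply/eqP; field; lra.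
set z := form_det e n phi' * form_det e n phi in g3 *.
have := ler_cnormB z (z - 1); rewrite subKr rnorm1; lra.
Qed.

Lemma fredholm_det_derivative (d : C) (b c : H) (h : R) (psi rho : form) (s : R) (d' : C) :
  tends (fun n => form_det e n (fun v w => ip (T v) w)) d ->
  (forall v, J v + T (J v) = v) -> `|h| <= 1 -> s <= 1 ->
  nuclear rho s ->
  (forall v w, psi v w = ip (T v) w - h%:C * rank1 b c v w + rho v w) ->
  tends (fun n => form_det e n psi) d' ->
  rnorm (d' - d * (1 - h%:C * ip (J b) c)) <= s * det_bound (r + rnorm b * rnorm c + 1 + 1).
Proof.
move=> hd J_right h1 s1 nrho psiE hd'.
have r0 := nuclear_ge0 T_nuclear; have s0 := nuclear_ge0 nrho.
have JZ (a : C) v : J (a *: v) = a *: J v.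
  have J0 : J 0 = 0 by have := additive_funB 0 0 J_additive; rewrite !subrr.
  by have := J_additive a v 0; rewrite J0 !addr0.
(* For [u = - h J b] the vector [u + T u] is [- h b], which is the rank one part of the
   perturbation. *)
have := form_det_rank1_tends (- (h%:C) *: J b) c hd.
have -> : - h%:C *: J b + T (- h%:C *: J b) = - h%:C *: b.
  by rewrite -JZ J_right.
rewrite dotZl mulNr => hlim.
apply: (tends_bound (tendsD hd' (tendsN hlim))) => n.
have nr : nuclear (rank1 (- h%:C *: b) c) (rnorm b * rnorm c).
  apply: nuclear_weak (nuclear_rank1 _ _ _) _.
  rewrite rnormZ cnormN rnorm_realc ler_wpM2r ?rnorm_ge0 //.
  by rewrite ler_piMl ?rnorm_ge0.
have := form_det_lipschitz H_hilbert e_orth e_unit n (nuclearD H_hilbert T_nuclear nr) nrho.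
rewrite (@form_det_eq _ _ e n _ psi); last first.
  by move=> v w; rewrite psiE /rank_one dotZl; ring.
move=> /le_trans; apply; rewrite ler_wpM2l //; apply: det_bound_le.
  by rewrite !(addr_ge0, mulr_ge0, rnorm_ge0).
by rewrite lerD2r lerD2l.
Qed.

End Operator.
End FredholmPerturbation.

(** * Integrals on segments and rays *)

Section RealIntegrals.
Context (R : realType).
Local Notation mu := (@lebesgue_measure R).
Implicit Types (f g : R -> R) (E F : set (measurableTypeR R)).

Local Notation rintegrable E f := (mu.-integrable E (EFin \o f)).

Lemma measurable_continuous E f : measurable E -> continuous f -> measurable_fun E f.
Proof. by move=> mE cf; apply: measurable_funTS; exact: continuous_measurable_fun. Qed.

Lemma rintegrable_le E f g : measurable E -> measurable_fun E f ->
  (forall t, E t -> `|f t| <= g t) -> rintegrable E g -> rintegrable E f.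
Proof.
move=> mE mf fg; apply: le_integrable => //; first exact/measurable_EFinP.
move=> t Et /=; rewrite lee_fin; exact: le_trans (fg t Et) (ler_norm _).
Qed.

Lemma rintegrableD E f g : measurable E -> rintegrable E f -> rintegrable E g ->
  rintegrable E (fun t => f t + g t).
Proof.
by move=> mE If Ig; have := integrableD mE If Ig; apply: eq_integrable.
Qed.

Lemma rintegrableZ E f c : measurable E -> rintegrable E f ->
  rintegrable E (fun t => c * f t).
Proof. by move=> mE If; have := integrableZl mE c If; apply: eq_integrable. Qed.

Lemma rintegrableN E f : measurable E -> rintegrable E f -> rintegrable E (fun t => - f t).
Proof.
move=> mE If; have := rintegrableZ (-1) mE If; apply: eq_integrable => //.
by move=> t _ /=; rewrite mulN1r.
Qed.

Lemma rintegrableS E F f : measurable E -> measurable F -> F `<=` E ->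
  rintegrable E f -> rintegrable F f.
Proof. by move=> mE mF FE; apply: integrableS. Qed.

Lemma rintegrable_segment a b f : continuous f -> rintegrable `[a, b] f.
Proof.
move=> cf; apply: continuous_compact_integrable; first exact: segment_compact.
exact: continuous_subspaceT.
Qed.

Lemma itv_cst_integral a b (c : R) : a <= b -> \int[mu]_(t in `[a, b]) c = c * (b - a).
Proof.
move=> ab; rewrite Rintegral_cst //= lebesgue_measure_itv /= lte_fin.
by move: ab; rewrite le_eqVlt => /predU1P[->|->] //=; rewrite ltxx subrr.
Qed.

Lemma itv_integral_bound a b f (M : R) : a <= b -> continuous f ->
  (forall t, a <= t <= b -> `|f t| <= M) ->
  `|\int[mu]_(t in `[a, b]) f t| <= M * (b - a).
Proof.
move=> ab cf fM; have If := rintegrable_segment a b cf.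
apply: le_trans (le_normr_Rintegral _ If) _ => //.
rewrite -itv_cst_integral //; apply: le_Rintegral => //.
- exact: integrable_norm.
- by apply: (@rintegrable_segment a b (fun=> M)); exact: cst_continuous.
Qed.

Lemma itv_split a b c f : a <= b -> b <= c -> continuous f ->
  \int[mu]_(t in `[a, c]) f t =
  \int[mu]_(t in `[a, b]) f t + \int[mu]_(t in `[b, c]) f t.
Proof.
move=> ab bc cf; have If := rintegrable_segment a c cf.
have := Rintegral_itvB If; move=> /(_ b); rewrite !bnd_simp => /(_ ab bc) /eqP.
rewrite subr_eq => /eqP ->; rewrite addrC; congr (_ + _).
rewrite Rintegral_itv_obnd_cbnd //.
apply: rintegrableS If => // t /=; rewrite !in_itv /= => /andP[bt ->].
by rewrite (le_trans ab (ltW bt)).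
Qed.

Lemma ray_split a b f : a <= b -> rintegrable `[a, +oo[ f ->
  \int[mu]_(t in `[a, +oo[) f t =
  \int[mu]_(t in `[a, b]) f t + \int[mu]_(t in `[b, +oo[) f t.
Proof.
move=> ab If.
have := Rintegral_itvB If; move=> /(_ b); rewrite !bnd_simp => /(_ ab isT) /eqP.
rewrite subr_eq => /eqP ->; rewrite addrC; congr (_ + _).
rewrite Rintegral_itv_obnd_cbnd //.
apply: rintegrableS If => // t /=; rewrite !in_itv /= !andbT => bt.
by rewrite (le_trans ab (ltW bt)).
Qed.

Lemma ray_integrableS a b f : a <= b -> rintegrable `[a, +oo[ f -> rintegrable `[b, +oo[ f.
Proof.
move=> ab; apply: rintegrableS => // t /=; rewrite !in_itv /= !andbT.
exact: le_trans.
Qed.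

Lemma ray_segment_integrable a b f : rintegrable `[a, +oo[ f -> rintegrable `[a, b] f.
Proof.
by apply: rintegrableS => // t /=; rewrite !in_itv /= andbT => /andP[].
Qed.

(** Monotone convergence along the segments [[a, a + n]] gives integrability and the bound
    together. *)
Lemma ge0_ray_integral_bound a f (M : R) : (forall t, a <= t -> 0 <= f t) -> continuous f ->
  (forall n : nat, \int[mu]_(t in `[a, a + n%:R]) f t <= M) ->
  rintegrable `[a, +oo[ f /\ \int[mu]_(t in `[a, +oo[) f t <= M.
Proof.
move=> f0 cf fM; pose F n : set R := `[a, a + n%:R]%classic.
have mf (E : set R) : measurable E -> measurable_fun E (EFin \o f).
  by move=> mE; apply/measurable_EFinP; apply: measurable_continuous.
have UF : \bigcup_n F n = `[a, +oo[%classic.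
  apply/seteqP; split=> t /=.
    by move=> [n _]; rewrite /F /= !in_itv /= andbT => /andP[].
  rewrite in_itv /= andbT => at_; exists (Num.truncn (t - a)).+1 => //.
  rewrite /F /= in_itv /= at_ /= -lerBlDl ltW //; apply: truncnS_gt.
have cv : (\int[mu]_(t in F n) (f t)%:E)%E @[n --> \oo] -->
    (\int[mu]_(t in `[a, +oo[) (f t)%:E)%E.
  rewrite -UF; apply: ge0_nondecreasing_set_cvg_integral.
  - move=> m n mn; apply/subsetPset => t; rewrite /F /= !in_itv /= => /andP[-> /= h].
    by apply: le_trans h _; rewrite lerD2l ler_nat.
  - by move=> n; exact: measurable_itv.
  - by move=> n; apply: mf; exact: measurable_itv.
  - by move=> n t; rewrite /F /= in_itv /= => /andP[at_ _]; rewrite lee_fin; exact: f0.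
have le : (\int[mu]_(t in `[a, +oo[) (f t)%:E <= M%:E)%E.
  rewrite -(cvg_lim _ cv) //; apply: lime_le; first by apply/cvg_ex; eexists; exact: cv.
  apply: nearW => n; have If := rintegrable_segment a (a + n%:R) cf.
  rewrite -[leLHS]fineK; first by rewrite lee_fin; exact: fM.
  apply: integrable_fin_num; last exact: If.
  exact: measurable_itv.
have lt : (\int[mu]_(t in `[a, +oo[) (f t)%:E < +oo)%E by apply: le_lt_trans le (ltry _).
have If : rintegrable `[a, +oo[ f.
  apply/integrableP; split; first by apply: mf; exact: measurable_itv.
  apply: le_lt_trans lt; rewrite le_eqVlt; apply/orP; left; apply/eqP.
  apply: eq_integral => t; rewrite inE /= in_itv /= andbT => at_.
  by rewrite ger0_norm // f0.
split=> //; rewrite -lee_fin /Rintegral fineK //.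
apply: integrable_fin_num; last exact: If.
exact: measurable_itv.
Qed.

Lemma ge0_ray_integral_fin a f : (forall t, a <= t -> 0 <= f t) -> rintegrable `[a, +oo[ f ->
  forall b, \int[mu]_(t in `[a, b]) f t <= \int[mu]_(t in `[a, +oo[) f t.
Proof.
move=> f0 If b; have [ab|ba] := leP a b.
  rewrite (ray_split ab If) lerDl; apply: Rintegral_ge0 => t /=.
  by rewrite in_itv /= andbT => /(le_trans ab); exact: f0.
rewrite set_itv_ge ?bnd_simp -?ltNge // Rintegral_set0.
by apply: Rintegral_ge0 => t /=; rewrite in_itv /= andbT; exact: f0.
Qed.

Let ge0_ray_shift a h f : (forall t, 0 <= f t) -> continuous f ->
  (\int[mu]_(t in `[(a + h)%R, +oo[) (f t)%:E =
   \int[mu]_(t in `[a, +oo[) (f (t + h)%R)%:E)%E.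
Proof.
move=> f0 cf; pose F t : R := t + h.
have dF (t : R^o) : is_derive t (1 : R^o) (F : R^o -> R^o) (1 : R^o) := is_derive_shift t 1 h.
have F' : (F^`())%classic = cst 1.
  by apply/funext => t; rewrite derive1E; apply: derive_val.
rewrite (@increasing_ge0_integration_by_substitutiony _ F f a).
- by apply: eq_integral => t _; rewrite F' /= mulr1.
- by move=> s t _ _; rewrite /F ltrD2r.
- by rewrite F' => t _; exact: cst_continuous.
- rewrite F'; exact: is_cvg_cst.
- rewrite F'; exact: is_cvg_cst.
- split=> [t _|]; first by have [] := dF t.
  by apply: cvgD; [exact: cvg_at_right_filter|exact: cvg_cst].
- exact: cvg_addrr.
- exact: continuous_subspaceT.
- by move=> t _.
Qed.

Lemma ray_shift a h f : continuous f -> rintegrable `[a + h, +oo[ f ->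
  rintegrable `[a, +oo[ (fun t => f (t + h)) /\
  \int[mu]_(t in `[a, +oo[) f (t + h) = \int[mu]_(t in `[a + h, +oo[) f t.
Proof.
move=> cf If.
have cfh : continuous (fun t => f (t + h)).
  move=> t; apply: (@continuous_comp _ _ _ (fun t => t + h) f); last exact: cf.
  by apply: cvgD; [exact: cvg_id|exact: cvg_cst].
have mh : measurable_fun `[a, +oo[ (fun t => f (t + h)) by apply: measurable_continuous.
have Ih : rintegrable `[a, +oo[ (fun t => f (t + h)).
  apply/integrableP; split; first exact/measurable_EFinP.
  have /integrableP[_] := If; rewrite /= (@ge0_ray_shift a h (fun t => `|f t|)) //.
  by move=> t; apply: continuous_comp; [exact: cf|exact: norm_continuous].
split=> //.
have cabs g : continuous g -> continuous (fun t => `|g t|).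
  by move=> cg t; apply: continuous_comp; [exact: cg|exact: norm_continuous].
(* The substitution rule is for nonnegative functions, so [f] is treated as the difference of
   [f + |f|] and [|f|]. *)
have pos : \int[mu]_(t in `[a, +oo[) (f (t + h) + `|f (t + h)|) =
    \int[mu]_(t in `[a + h, +oo[) (f t + `|f t|).
  congr fine; rewrite (@ge0_ray_shift a h (fun t => f t + `|f t|)) //.
    by move=> t; have := ler_norm (- f t); rewrite normrN; lra.
  by move=> t; apply: cvgD; [exact: cf|exact: cabs].
have nrm : \int[mu]_(t in `[a, +oo[) `|f (t + h)| = \int[mu]_(t in `[a + h, +oo[) `|f t|.
  by congr fine; rewrite (@ge0_ray_shift a h (fun t => `|f t|)) //; exact: cabs.
move: pos; rewrite !RintegralD //; try exact: integrable_norm.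
by rewrite nrm => /addIr.
Qed.

End RealIntegrals.

(** * Continuity of vector functions of a real variable *)

Section VectorContinuity.
Context (R : realType).
Local Notation C := R[i].

Definition rcont (V : normedModType C) (f : R -> V) := forall t (e : R), 0 < e ->
  exists2 d : R, 0 < d & forall s, `|t - s| < d -> rnorm (f t - f s) < e.

Lemma rcont_cst (V : normedModType C) (v : V) : rcont (fun=> v).
Proof. by move=> t e e0; exists 1 => // s _; rewrite subrr rnorm0. Qed.

Lemma continuous_of_eps (f : R -> R) :
  (forall t (e : R), 0 < e -> exists2 d : R, 0 < d & forall s, `|t - s| < d -> `|f t - f s| < e) ->
  continuous f.
Proof.
move=> h t; apply/cvgrPdist_lt => e /(h t)[d d0 hd].
by apply/nbhs_ballP; exists d => // s; apply: hd.
Qed.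

Lemma eps_of_continuous (f : R -> R) : continuous f ->
  forall t (e : R), 0 < e -> exists2 d : R, 0 < d & forall s, `|t - s| < d -> `|f t - f s| < e.
Proof.
move=> cf t e e0; have /cvgrPdist_lt/(_ e e0)/nbhs_ballP[d d0 hd] := cf t.
by exists d => // s; apply: hd.
Qed.

Lemma rcont_Re (f : R -> C) : rcont f -> continuous (fun t => complex.Re (f t)).
Proof.
move=> cf; apply: continuous_of_eps => t e /(cf t)[d d0 hd]; exists d => // s /hd.
by apply: le_lt_trans; rewrite -ReN -ReD Re_le_rnorm.
Qed.

Lemma rcont_Im (f : R -> C) : rcont f -> continuous (fun t => complex.Im (f t)).
Proof.
move=> cf; apply: continuous_of_eps => t e /(cf t)[d d0 hd]; exists d => // s /hd.
by apply: le_lt_trans; rewrite -ImN -ImD Im_le_rnorm.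
Qed.

Lemma rcont_rnorm (V : normedModType C) (f : R -> V) :
  rcont f -> continuous (fun t => rnorm (f t)).
Proof.
move=> cf; apply: continuous_of_eps => t e /(cf t)[d d0 hd]; exists d => // s /hd.
apply: le_lt_trans; rewrite ler_distlC.
have h1 := ler_rnorm_dist 0 (f t) (f s); have h2 := ler_rnormD (f t - f s) (f s).
have h3 := ler_rnormD (f s - f t) (f t); rewrite !subrK in h2 h3.
rewrite (rnormB (f s)) in h3; apply/andP; split; lra.
Qed.

Lemma rcont_realc (g : R -> R) : continuous g -> rcont (fun t => (g t)%:C : C).
Proof.
move=> /eps_of_continuous cg t e /(cg t)[d d0 hd]; exists d => // s /hd.
by rewrite -rmorphB rnorm_realc.
Qed.

Lemma rcontD (V : normedModType C) (f g : R -> V) :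
  rcont f -> rcont g -> rcont (fun t => f t + g t).
Proof.
move=> cf cg t e e0; have e2 : 0 < e / 2 by rewrite divr_gt0.
have [d1 d10 h1] := cf t _ e2; have [d2 d20 h2] := cg t _ e2.
exists (Num.min d1 d2); first by rewrite lt_min d10.
move=> s; rewrite lt_min => /andP[/h1 b1 /h2 b2].
by rewrite opprD addrACA; have := ler_rnormD (f t - f s) (g t - g s); lra.
Qed.

Lemma rcont_shift (V : normedModType C) (f : R -> V) h :
  rcont f -> rcont (fun t => f (t + h)).
Proof.
move=> cf t e /(cf (t + h))[d d0 hd]; exists d => // s st; apply: hd.
by rewrite opprD addrACA subrr addr0.
Qed.

(** Common to products of scalars and inner products; it asks for additivity alone because the inner
    product is antilinear in its second argument. *)
Let rcont_pair (U V W : normedModType C) (p : U -> V -> W) (f : R -> U) (g : R -> V) :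
  (forall u u' v, p (u - u') v = p u v - p u' v) ->
  (forall u v v', p u (v - v') = p u v - p u v') ->
  (forall u v, rnorm (p u v) <= rnorm u * rnorm v) ->
  rcont f -> rcont g -> rcont (fun t => p (f t) (g t)).
Proof.
move=> pl pr pb cf cg t e e0.
pose L := rnorm (f t) + rnorm (g t) + 1.
have L0 : 0 < L by rewrite /L; have := rnorm_ge0 (f t); have := rnorm_ge0 (g t); lra.
have m0 : 0 < Num.min 1 (e / (2 * L)) by rewrite lt_min ltr01 divr_gt0 // mulr_gt0.
have [d1 d10 h1] := cf t _ m0; have [d2 d20 h2] := cg t _ m0.
exists (Num.min d1 d2); first by rewrite lt_min d10.
move=> s; rewrite lt_min => /andP[/h1 + /h2]; rewrite !lt_min => /andP[b1 b2] /andP[b3 b4].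
have -> : p (f t) (g t) - p (f s) (g s) = p (f t - f s) (g s) + p (f t) (g t - g s).
  by rewrite pl pr [RHS]addrC addrA subrK.
have gs : rnorm (g s) <= L.
  have := ler_rnormB (g t) (g t - g s); rewrite subKr /L.
  have := rnorm_ge0 (f t); lra.
have -> : e = e / (2 * L) * L + L * (e / (2 * L)) by field; lra.
apply: le_lt_trans (ler_rnormD _ _) _.
apply: le_lt_trans (lerD (pb _ _) (pb _ _)) _.
apply: ler_ltD.
  by apply: ler_pM; rewrite ?rnorm_ge0 ?(ltW b2).
apply: le_lt_trans (_ : L * rnorm (g t - g s) < _); last by rewrite ltr_pM2l.
by apply: ler_wpM2r; rewrite ?rnorm_ge0 // /L; have := rnorm_ge0 (g t); lra.
Qed.

Lemma rcontM (f g : R -> C) : rcont f -> rcont g -> rcont (fun t => f t * g t).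
Proof.
apply: (rcont_pair (p := fun u v : C => u * v)).
- by move=> u u' v; rewrite mulrBl.
- by move=> u v v'; rewrite mulrBr.
- by move=> u v; rewrite rnormM.
Qed.

Lemma rcont_dot (H : completeNormedModType C) (dot : {dot H for Num.conj})
    (H_hilbert : forall v : H, `|v| ^+ 2 = dot v v) (f g : R -> H) :
  rcont f -> rcont g -> rcont (fun t => inner dot (f t) (g t)).
Proof.
apply: (rcont_pair (p := inner dot)).
- by move=> u u' v; rewrite dotBl.
- by move=> u v v'; rewrite dotBr.
- by move=> u v; rewrite cauchy_schwarz.
Qed.

End VectorContinuity.

(** * Complex integrals and weak integrals of vector functions *)

Section ComplexIntegrals.
Context (R : realType).
Local Notation mu := (@lebesgue_measure R).
Local Notation C := R[i].
Implicit Types (f g : R -> C) (E : set (measurableTypeR R)).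
Local Notation rintegrable E f := (mu.-integrable E (EFin \o f)).

Lemma cintegrable_le E f (g : R -> R) : measurable E -> rcont f ->
  (forall t, E t -> rnorm (f t) <= g t) -> rintegrable E g -> cintegrable E f.
Proof.
move=> mE cf fg Ig; split.
  apply: (rintegrable_le mE _ _ Ig); first exact: measurable_continuous mE (rcont_Re cf).
  by move=> t Et; apply: le_trans (Re_le_rnorm _) (fg t Et).
apply: (rintegrable_le mE _ _ Ig); first exact: measurable_continuous mE (rcont_Im cf).
by move=> t Et; apply: le_trans (Im_le_rnorm _) (fg t Et).
Qed.

Lemma cintegrableD E f g : measurable E -> cintegrable E f -> cintegrable E g ->
  cintegrable E (fun t => f t + g t).
Proof.
move=> mE [f1 f2] [g1 g2]; split.
- by have := rintegrableD mE f1 g1; apply: eq_integrable => // t _ /=; rewrite ReD.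
- by have := rintegrableD mE f2 g2; apply: eq_integrable => // t _ /=; rewrite ImD.
Qed.

Lemma cintegralD E f g : measurable E -> cintegrable E f -> cintegrable E g ->
  cintegral E (fun t => f t + g t) = cintegral E f + cintegral E g.
Proof.
move=> mE [f1 f2] [g1 g2]; apply: complex_eqP; rewrite ?ReD ?ImD /= -RintegralD //;
  by apply: eq_Rintegral => t _; rewrite ?ReD ?ImD.
Qed.

Lemma cintegrableZ E f c : measurable E -> cintegrable E f ->
  cintegrable E (fun t => c * f t).
Proof.
move=> mE [f1 f2]; split.
- have := rintegrableD mE (rintegrableZ (complex.Re c) mE f1)
    (rintegrableZ (- complex.Im c) mE f2).
  by apply: eq_integrable => // t _ /=; rewrite ReM mulNr.
- have := rintegrableD mE (rintegrableZ (complex.Re c) mE f2)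
    (rintegrableZ (complex.Im c) mE f1).
  by apply: eq_integrable => // t _ /=; rewrite ImM.
Qed.

Lemma cintegralZ E f c : measurable E -> cintegrable E f ->
  cintegral E (fun t => c * f t) = c * cintegral E f.
Proof.
move=> mE [f1 f2]; apply: complex_eqP; rewrite ?ReM ?ImM /=.
  rewrite -!RintegralZl // -RintegralB //; try exact: rintegrableZ.
  by apply: eq_Rintegral => t _; rewrite ReM.
rewrite -!RintegralZl // -RintegralD //; try exact: rintegrableZ.
by apply: eq_Rintegral => t _; rewrite ImM.
Qed.

Lemma eq_cintegral E f g : (forall t, E t -> f t = g t) -> cintegral E f = cintegral E g.
Proof.
by move=> fg; apply: complex_eqP; apply: eq_Rintegral => t; rewrite inE => /fg ->.
Qed.

Lemma eq_cintegrable E f g : measurable E -> (forall t, E t -> f t = g t) ->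
  cintegrable E f -> cintegrable E g.
Proof.
move=> mE fg [f1 f2]; split; [move: f1|move: f2]; apply: eq_integrable => // t;
  by rewrite inE /= => /fg ->.
Qed.

Lemma cintegrable_conj E f : measurable E -> cintegrable E f ->
  cintegrable E (fun t => conjc (f t)).
Proof.
move=> mE [f1 f2]; split.
  by move: f1; apply: eq_integrable => // t _ /=; rewrite Re_conj.
by have := rintegrableN mE f2; apply: eq_integrable => // t _ /=; rewrite Im_conj.
Qed.

Lemma cintegral_conj E f : measurable E -> cintegrable E f ->
  cintegral E (fun t => conjc (f t)) = conjc (cintegral E f).
Proof.
move=> mE [f1 f2]; apply: complex_eqP; rewrite ?Re_conj ?Im_conj /=.
  by apply: eq_Rintegral => t _; rewrite Re_conj.
rewrite -mulN1r -RintegralZl //; apply: eq_Rintegral => t _.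
by rewrite Im_conj mulN1r.
Qed.

(* Rotating the integral onto the positive axis reduces to the real case. *)
Lemma cintegral_le E f (g : R -> R) : measurable E -> cintegrable E f ->
  (forall t, E t -> rnorm (f t) <= g t) -> rintegrable E g ->
  rnorm (cintegral E f) <= \int[mu]_(t in E) g t.
Proof.
move=> mE If fg Ig; set I := cintegral E f.
have [I0|I0] := eqVneq (rnorm I) 0.
  rewrite I0; apply: Rintegral_ge0 => t Et; exact: le_trans (rnorm_ge0 _) (fg t Et).
have I1 : 0 < rnorm I by rewrite lt_neqAle eq_sym I0 rnorm_ge0.
pose z : C := ((rnorm I)^-1)%:C * conjc I.
have z1 : rnorm z = 1.
  by rewrite rnormM rnorm_realc rnorm_conj ger0_norm ?invr_ge0 ?rnorm_ge0 // mulVf.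
have -> : rnorm I = complex.Re (z * I).
  have -> : z * I = ((rnorm I)^-1 * rnorm I ^+ 2)%:C.
    by rewrite /z -mulrA conj_mulE -rmorphM.
  by rewrite /= expr2 mulrA mulVf // mul1r.
rewrite -cintegralZ //=; have [h _] := cintegrableZ z mE If.
apply: le_Rintegral => // t Et.
apply: le_trans (ler_norm _) (le_trans (Re_le_rnorm _) _).
by rewrite rnormM z1 mul1r; apply: fg.
Qed.

Lemma cintegral_ray_split a b f : a <= b -> cintegrable `[a, +oo[ f ->
  cintegral `[a, +oo[ f = cintegral `[a, b] f + cintegral `[b, +oo[ f.
Proof.
by move=> ab [f1 f2]; apply: complex_eqP; rewrite ?ReD ?ImD /=; apply: ray_split.
Qed.

Lemma cintegral_itv_split a b c f : a <= b -> b <= c -> rcont f ->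
  cintegral `[a, c] f = cintegral `[a, b] f + cintegral `[b, c] f.
Proof.
move=> ab bc cf; apply: complex_eqP; rewrite ?ReD ?ImD /=; apply: itv_split => //.
  exact: rcont_Re.
exact: rcont_Im.
Qed.

Lemma cintegrable_segment a b f : rcont f -> cintegrable `[a, b] f.
Proof.
move=> cf; split; apply: rintegrable_segment; [exact: rcont_Re|exact: rcont_Im].
Qed.

Lemma cintegral_shift a h f : rcont f -> cintegrable `[a + h, +oo[ f ->
  cintegrable `[a, +oo[ (fun t => f (t + h)) /\
  cintegral `[a, +oo[ (fun t => f (t + h)) = cintegral `[a + h, +oo[ f.
Proof.
move=> cf [f1 f2].
have [r1 r2] := ray_shift (rcont_Re cf) f1; have [i1 i2] := ray_shift (rcont_Im cf) f2.
by split; [split|apply: complex_eqP].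
Qed.

Lemma cintegrable_rayS a b f : a <= b -> cintegrable `[a, +oo[ f -> cintegrable `[b, +oo[ f.
Proof. by move=> ab [f1 f2]; split; apply: ray_integrableS ab _. Qed.

Lemma rintegrable_exp (s : R) : 0 < s -> rintegrable `[0, +oo[ (fun t => expR (- s * t)).
Proof.
move=> s0; have h := integrable_exponential_pdf s0.
have mr : measurable (`[0, +oo[%classic : set (measurableTypeR R)) by exact: measurable_itv.
have := rintegrableZ s^-1 mr (rintegrableS measurableT mr (@subsetT _ _) h).
apply: eq_integrable => //.
move=> t; rewrite inE /= => t0.
by rewrite /exponential_pdf patchE mem_set //= mulrA mulVf ?mul1r // lt0r_neq0.
Qed.

Section WeakIntegral.
Context (H : completeNormedModType C) (dot : {dot H for Num.conj}).
Hypothesis H_hilbert : forall v : H, `|v| ^+ 2 = dot v v.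
Hypothesis H_separable : separable H.
Local Notation ip := (inner dot).

(** The functional [w |-> int <f, w>] is antilinear, so the Riesz representation is applied to its
    conjugate. Testing against [u] itself bounds its norm. *)
Lemma weak_integral E (f : R -> H) (g : R -> R) : measurable E ->
  (forall w, cintegrable E (fun t => ip (f t) w)) ->
  (forall t, E t -> rnorm (f t) <= g t) -> rintegrable E g ->
  exists u, (forall w, ip u w = cintegral E (fun t => ip (f t) w)) /\
    rnorm u <= \int[mu]_(t in E) g t.
Proof.
move=> mE If fg Ig; set G := \int[mu]_(t in E) g t.
have bound w : rnorm (cintegral E (fun t => ip (f t) w)) <= G * rnorm w.
  rewrite mulrC -RintegralZl //; apply: cintegral_le => //; last exact: rintegrableZ.
  move=> t Et; apply: le_trans (cauchy_schwarz H_hilbert _ _) _.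
  by rewrite mulrC ler_wpM2l ?rnorm_ge0 //; apply: fg.
have [||u hu] := @riesz _ _ dot H_hilbert H_separable
  (fun w => conjc (cintegral E (fun t => ip (f t) w))) G.
- move=> a v w; have -> : cintegral E (fun t => ip (f t) (a *: v + w)) =
    cintegral E (fun t => conjc a * ip (f t) v + ip (f t) w).
    by apply: eq_cintegral => t _; rewrite dotDr dotZr.
  rewrite cintegralD //; last exact: cintegrableZ.
  by rewrite cintegralZ // rmorphD rmorphM /= conjcK.
- by move=> w; rewrite rnorm_conj.
exists u; split=> [w|]; first by rewrite dotC -hu conjcK.
have [u0|u0] := eqVneq (rnorm u) 0.
  rewrite u0; apply: Rintegral_ge0 => t Et; exact: le_trans (rnorm_ge0 _) (fg t Et).
have u1 : 0 < rnorm u by rewrite lt_neqAle eq_sym u0 rnorm_ge0.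
have := bound u; have -> : cintegral E (fun t => ip (f t) u) = ip u u.
  by rewrite dotC -hu conjcK.
by rewrite dotvv // rnorm_realc ger0_norm ?sqr_ge0 // expr2 ler_pM2r.
Qed.

End WeakIntegral.

End ComplexIntegrals.

(** * The damping factor exp(- s t) *)

Section ComplexExponential.
Context (R : realType).
Local Notation C := R[i].

Lemma cos_dist (a b : R) : `|cos a - cos b| <= `|a - b|.
Proof.
wlog ab : a b / b <= a.
  by move=> h; have [/h//|/ltW/h] := leP b a; rewrite distrC [leRHS]distrC.
have [|c _ ->] := @MVT_segment R cos (fun x => - sin x) b a ab.
- exact: continuous_subspaceT (@continuous_cos R).
- by rewrite normrM ler_piMl // normrN sin_max.
Qed.

Lemma sin_dist (a b : R) : `|sin a - sin b| <= `|a - b|.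
Proof.
wlog ab : a b / b <= a.
  by move=> h; have [/h//|/ltW/h] := leP b a; rewrite distrC [leRHS]distrC.
have [|c _ ->] := @MVT_segment R sin cos b a ab.
- exact: continuous_subspaceT (@continuous_sin R).
- by rewrite normrM ler_piMl // cos_max.
Qed.

(* [cexpt s t] is [exp (- s t)] *)
Definition cexpt (s : C) (t : R) : C :=
  (expR (- complex.Re s * t))%:C * (cos (complex.Im s * t) -i* sin (complex.Im s * t)).

Lemma rnorm_cexpt s t : rnorm (cexpt s t) = expR (- complex.Re s * t).
Proof.
rewrite rnormM rnorm_realc ger0_norm ?expR_ge0 //.
suff -> : rnorm (cos (complex.Im s * t) -i* sin (complex.Im s * t)) = 1 by rewrite mulr1.
apply/eqP; rewrite -sqrp_eq1 ?rnorm_ge0 // rnorm_sqrE /= sqrrN.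
by rewrite cos2Dsin2.
Qed.

Lemma cexpt0 s : cexpt s 0 = 1.
Proof.
rewrite /cexpt !mulr0 expR0 cos0 sin0 oppr0.
by apply: complex_eqP => /=; ring.
Qed.

Lemma cexptD s t u : cexpt s (t + u) = cexpt s t * cexpt s u.
Proof.
rewrite /cexpt !mulrDr expRD cosD sinD.
by apply: complex_eqP => /=; ring.
Qed.

Lemma continuous_cexpt s : rcont (cexpt s).
Proof.
have lin (c : R) : continuous (fun t : R => c * t) by move=> t; exact: mulrl_continuous.
apply: rcontM.
  apply: rcont_realc => t; apply: continuous_comp; first exact: lin.
  exact: continuous_expR.
have cc : continuous (fun t => cos (complex.Im s * t)).
  by move=> t; apply: continuous_comp; [exact: lin|exact: continuous_cos].
have cs : continuous (fun t => sin (complex.Im s * t)).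
  by move=> t; apply: continuous_comp; [exact: lin|exact: continuous_sin].
have -> : (fun t => cos (complex.Im s * t) -i* sin (complex.Im s * t)) =
  (fun t => (cos (complex.Im s * t))%:C + (- 'i%C) * (sin (complex.Im s * t))%:C).
  by apply/funext => t; apply: complex_eqP => /=; ring.
apply: rcontD; first exact: rcont_realc.
by apply: rcontM; [exact: rcont_cst|exact: rcont_realc].
Qed.

Lemma is_derive_eps (f : R -> R) (l : R) : is_derive (0 : R) 1 f l ->
  forall e : R, 0 < e -> exists2 d : R, 0 < d & forall h, `|h| < d ->
    `|f h - f 0 - l * h| <= e * `|h|.
Proof.
move=> [df fl] e e0; rewrite /derivable in df; move/cvg_ex: df => -[l' hl'].
have l'E : l' = l by rewrite -fl; apply/esym/cvg_lim.
rewrite l'E in hl' => {l' l'E}.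
move/cvgrPdist_lt: hl' => /(_ e e0); rewrite /prop_near1 /= /dnbhs /within /=.
move=> /nbhs_ballP[d d0 hd]; exists d => // h hd'.
have [->|h0] := eqVneq h 0; first by rewrite subrr mulr0 subrr normr0 mulr0.
have := hd h; rewrite /ball /= sub0r normrN => /(_ hd' h0).
rewrite addr0 [h *: 1]mulr1 /= => b.
have -> : f h - f 0 - l * h = - ((l - h^-1 *: (f h - f 0)) * h).
  by rewrite /GRing.scale /=; field.
by rewrite normrN normrM ler_wpM2r // ltW.
Qed.

(** Taken at [- h] because the original semigroup is [cexpt s (- h)] times the damped one. *)
Lemma cexpt_derivative s (e : R) : 0 < e -> exists2 d : R, 0 < d &
  forall h, 0 < h < d -> rnorm (cexpt s (- h) - 1 - s * h%:C) <= e * h.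
Proof.
move=> e0; case: s => a b; have e2 : 0 < e / 2 by rewrite divr_gt0.
have d1 : is_derive (0 : R) 1 (fun h : R => expR (a * h) * cos (b * h)) a.
  apply: is_derive_eq; rewrite /GRing.scale /= !mulr0 expR0 cos0 sin0; ring.
have d2 : is_derive (0 : R) 1 (fun h : R => expR (a * h) * sin (b * h)) b.
  apply: is_derive_eq; rewrite /GRing.scale /= !mulr0 expR0 cos0 sin0; ring.
have [r1 r10 h1] := is_derive_eps d1 e2; have [r2 r20 h2] := is_derive_eps d2 e2.
exists (Num.min r1 r2); first by rewrite lt_min r10.
move=> h; rewrite lt_min => /andP[h0 /andP[hr1 hr2]].
have := h1 h; have := h2 h; rewrite gtr0_norm // hr1 hr2 => /(_ isT) + /(_ isT).
rewrite !mulr0 expR0 cos0 sin0 mulr0 mulr1 => b2 b1.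
apply: le_trans (rnorm_le_ReIm _) _.
rewrite /cexpt /= mulrN mulNr opprK mulrN cosN sinN.
have -> : expR (a * h) * cos (b * h) - 0 * - - sin (b * h) - 1 - (a * h - b * 0) =
   expR (a * h) * cos (b * h) - 1 - a * h by ring.
have -> : expR (a * h) * - - sin (b * h) + 0 * cos (b * h) - 0 - (a * 0 + b * h) =
   expR (a * h) * sin (b * h) - 0 - b * h by ring.
lra.
Qed.

End ComplexExponential.

(** * Contraction semigroups and their Laplace transforms *)

Section ContractionSemigroups.
Context (R : realType) (H : completeNormedModType R[i]).
Context (dot : {dot H for Num.conj}).
Hypothesis H_hilbert : forall v : H, `|v| ^+ 2 = dot v v.
Hypothesis H_separable : separable H.
Implicit Types u v w : H.
Local Notation C := R[i].
Local Notation ip := (inner dot).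
Local Notation mu := (@lebesgue_measure R).
Local Notation rintegrable E f := (mu.-integrable E (EFin \o f)).

(* Values at negative times are arbitrary. *)
Record csg (U : R -> H -> H) : Prop := CSG {
  csg_additive : forall t, 0 <= t -> additive_fun (U t) ;
  csg_contr : forall t v, 0 <= t -> rnorm (U t v) <= rnorm v ;
  csg0 : forall v, U 0 v = v ;
  csgD : forall s t v, 0 <= s -> 0 <= t -> U (s + t) v = U s (U t v) ;
  csg_cont0 : forall v (e : R), 0 < e -> exists2 d : R, 0 < d &
    forall h, 0 <= h -> h < d -> rnorm (U h v - v) < e }.

(* Frozen for negative times so as to be continuous on the whole line. *)
Definition orbit (U : R -> H -> H) v (t : R) : H := U (Num.max t 0) v.

Lemma orbitE U v t : 0 <= t -> orbit U v t = U t v.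
Proof. by move=> t0; rewrite /orbit max_l. Qed.

(** By contractivity the continuity at time zero is a modulus of uniform continuity for the whole
    orbit. *)
Lemma csg_modulus U v s t : csg U -> 0 <= s -> 0 <= t ->
  rnorm (U t v - U s v) <= rnorm (U `|t - s| v - v).
Proof.
move=> cU; wlog st : s t / s <= t => [h s0 t0|s0 t0].
  have [/h|/ltW/h] := leP s t; first exact.
  by rewrite distrC rnormB; apply.
rewrite ger0_norm ?subr_ge0 //.
have -> : U t v = U s (U (t - s) v) by rewrite -(csgD cU) ?subr_ge0 // addrC subrK.
rewrite -(additive_funB _ _ (csg_additive cU s0)).
exact: csg_contr.
Qed.

Lemma csg_norm_decr U v s t : csg U -> 0 <= s -> s <= t -> rnorm (U t v) <= rnorm (U s v).
Proof.
move=> cU s0 st; rewrite -(subrK s t) (csgD cU) ?subr_ge0 //.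
by apply: (csg_contr cU); rewrite subr_ge0.
Qed.

Lemma max0_dist (s t : R) : `|Num.max t 0 - Num.max s 0| <= `|t - s|.
Proof.
rewrite ler_norml; case: (leP t 0) => t0; case: (leP s 0) => s0;
have := ler_norm (t - s); have := ler_norm (s - t); rewrite (distrC s t);
have := normr_ge0 (t - s); move=> *; apply/andP; split; lra.
Qed.

Lemma orbit_rcont U v : csg U -> rcont (orbit U v).
Proof.
move=> cU t e /(csg_cont0 cU v)[d d0 hd]; exists d => // s ts.
apply: le_lt_trans (csg_modulus v cU _ _) _; rewrite ?le_max ?lexx ?orbT //.
apply: hd => //; exact: le_lt_trans (max0_dist _ _) ts.
Qed.

(** Taking adjoints gives at once only weak continuity. Contractivity makes it strong: the square of
    the norm of [Us h v - v] is at most [2 |v|^2 - 2 Re <U h v, v>], which is small with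
    [U h v - v]. *)
Lemma adjoint_csg U : csg U ->
  exists Us, csg Us /\ forall t v w, 0 <= t -> ip (U t v) w = ip v (Us t w).
Proof.
move=> cU.
have ex t w : exists z, 0 <= t -> forall v, ip (U t v) w = ip v z.
  have [t0|t0] := leP 0 t; last by exists 0.
  have [||z hz] := riesz H_hilbert H_separable (l := fun v => ip (U t v) w) (M := rnorm w).
  - by move=> a u v; rewrite csg_additive // dotDl dotZl.
  - move=> v; apply: le_trans (cauchy_schwarz H_hilbert _ _) _.
    by rewrite mulrC ler_wpM2l ?rnorm_ge0 ?csg_contr.
  by exists z.
have [Us hUs] : exists Us, forall t w, 0 <= t -> forall v, ip (U t v) w = ip v (Us t w).
  have [F hF] := choice (fun p : R * H => ex p.1 p.2).
  by exists (fun t w => F (t, w)) => t w; exact: (hF (t, w)).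
have contr t w : 0 <= t -> rnorm (Us t w) <= rnorm w.
  move=> t0; have := hUs t w t0 (Us t w); rewrite dotvv // => E.
  have [->|h0] := eqVneq (rnorm (Us t w)) 0; first exact: rnorm_ge0.
  have h1 : 0 < rnorm (Us t w) by rewrite lt_neqAle eq_sym h0 rnorm_ge0.
  have := cauchy_schwarz H_hilbert (U t (Us t w)) w.
  rewrite E rnorm_realc ger0_norm ?sqr_ge0 // expr2 => /le_trans h.
  rewrite -(ler_pM2l h1); apply: h.
  by rewrite ler_wpM2r ?rnorm_ge0 ?csg_contr.
exists Us; split; last by move=> t v w t0; apply: hUs.
split => //.
- move=> t t0 a u v; apply/eqP; rewrite -subr_eq0; apply/eqP.
  apply: (dot_inj H_hilbert) => w; rewrite dot0l dotC dotBr dotDr dotZr.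
  by rewrite -!hUs // dotDr dotZr subrr conjc0.
- move=> v; apply: (dot_inj H_hilbert) => w.
  by rewrite dotC -hUs // csg0 // -dotC.
- move=> s t v s0 t0; apply: (dot_inj H_hilbert) => w.
  rewrite dotC [RHS]dotC -hUs ?addr_ge0 // -hUs // -hUs //.
  by rewrite addrC csgD.
- move=> v e e0.
  pose L := rnorm v + 1; have L0 : 0 < L by rewrite ltr_wpDl ?rnorm_ge0.
  have [|d d0 hd] := csg_cont0 cU v (e := e ^+ 2 / (2 * L)).
    by rewrite divr_gt0 ?mulr_gt0 ?exprn_gt0.
  exists d => // h h0 hhd.
  rewrite -ltr_sqr ?nnegrE ?rnorm_ge0 ?(ltW e0) //.
  have -> : rnorm (Us h v - v) ^+ 2 =
    rnorm (Us h v) ^+ 2 + rnorm v ^+ 2 - 2 * complex.Re (ip (Us h v) v).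
    by rewrite (rnorm_sqrD H_hilbert) rnormN dotNr ReN mulrN.
  have -> : complex.Re (ip (Us h v) v) = complex.Re (ip (U h v - v) v) + rnorm v ^+ 2.
    by rewrite dotBl hUs // dotvv // ReD ReN /= subrK dotC Re_conj.
  have h1 : rnorm (Us h v) ^+ 2 <= rnorm v ^+ 2.
    by rewrite ler_sqr ?nnegrE ?rnorm_ge0 ?contr.
  have h2 : - complex.Re (ip (U h v - v) v) <= rnorm (U h v - v) * rnorm v.
    apply: le_trans (cauchy_schwarz H_hilbert _ _); apply: le_trans (Re_le_rnorm _).
    by rewrite -normrN ler_norm.
  have h3 : 2 * (rnorm (U h v - v) * rnorm v) < e ^+ 2.
    have := hd h h0 hhd; rewrite ltr_pdivlMr ?mulr_gt0 // => h4.
    apply: le_lt_trans h4; rewrite /L.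
    by have := rnorm_ge0 (U h v - v); have := rnorm_ge0 v; nra.
  lra.
Qed.

(** For [0 < Re s] the orbits become integrable, and the Laplace transform at [s] is the plain
    integral of a damped orbit. *)
Definition twist (s : C) (U : R -> H -> H) t v : H := cexpt s t *: U t v.

Lemma twist_csg s U : 0 <= complex.Re s -> csg U -> csg (twist s U).
Proof.
move=> s0 cU.
have e1 t : 0 <= t -> rnorm (cexpt s t) <= 1.
  by move=> t0; rewrite rnorm_cexpt -expR0 ler_expR mulNr oppr_le0 mulr_ge0.
split.
- move=> t t0 a u v; rewrite /twist csg_additive // scalerDr !scalerA.
  by rewrite [a * _]mulrC.
- move=> t v t0; rewrite /twist rnormZ.
  by apply: le_trans (csg_contr cU v t0); rewrite ler_piMl ?rnorm_ge0 ?e1.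
- by move=> v; rewrite /twist cexpt0 scale1r csg0.
- move=> a b v a0 b0; rewrite /twist cexptD csgD // -scalerA.
  have := csg_additive cU a0 (cexpt s b) (U b v) 0.
  have := additive_funB 0 0 (csg_additive cU a0); rewrite !subrr => ->.
  by rewrite !addr0 => ->.
- move=> v e e0; pose L := rnorm v + 1.
  have L0 : 0 < L by rewrite ltr_wpDl ?rnorm_ge0.
  have e2 : 0 < e / 2 by rewrite divr_gt0.
  have [|d1 d10 h1] := continuous_cexpt s 0 (e := e / (2 * L)).
    by rewrite divr_gt0 // mulr_gt0.
  have [d2 d20 h2] := csg_cont0 cU v e2.
  exists (Num.min d1 d2); first by rewrite lt_min d10.
  move=> h h0; rewrite lt_min => /andP[hd1 hd2].
  have := h1 h; rewrite sub0r normrN ger0_norm // cexpt0 => /(_ hd1) b1.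
  have b2 := h2 h h0 hd2.
  have -> : twist s U h v - v = cexpt s h *: (U h v - v) - (1 - cexpt s h) *: v.
    by rewrite /twist scalerBr scalerBl scale1r opprB addrA subrK.
  apply: le_lt_trans (ler_rnormB _ _) _; rewrite !rnormZ.
  have b3 : rnorm (cexpt s h) * rnorm (U h v - v) <= rnorm (U h v - v).
    by rewrite ler_piMl ?rnorm_ge0 ?e1.
  have b4 : rnorm (1 - cexpt s h) * rnorm v <= e / 2.
    move: b1; rewrite ltr_pdivlMr ?mulr_gt0 // => b1.
    by move: b1; rewrite /L; have := rnorm_ge0 v; have := rnorm_ge0 (1 - cexpt s h); nra.
  lra.
Qed.

Section Laplace.
Context (U : R -> H -> H) (cU : csg U) (s : C) (s_gt0 : 0 < complex.Re s).
Let V := twist s U.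
Let cV : csg V. Proof. by apply: twist_csg; rewrite ?ltW. Qed.

Lemma twist_bound t v : 0 <= t -> rnorm (V t v) <= expR (- complex.Re s * t) * rnorm v.
Proof.
by move=> t0; rewrite /V /twist rnormZ rnorm_cexpt ler_wpM2l ?expR_ge0 ?csg_contr.
Qed.

Let ray := (`[0%R, +oo[%classic : set (measurableTypeR R)).
Let m_ray : measurable ray. Proof. exact: measurable_itv. Qed.

Let Ig c : rintegrable ray (fun t => c * expR (- complex.Re s * t)).
Proof. by apply: rintegrableZ => //; exact: rintegrable_exp. Qed.

Let ray_ge0 t : ray t -> 0 <= t.
Proof. by rewrite /ray /= in_itv /= andbT. Qed.

Let rcont_orbit v w : rcont (fun t => ip (orbit V v t) w).
Proof. by apply: rcont_dot => //; [exact: orbit_rcont|exact: rcont_cst]. Qed.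

Lemma laplace_integrable v w : cintegrable ray (fun t => ip (orbit V v t) w).
Proof.
apply: (cintegrable_le m_ray _ _ (Ig (rnorm v * rnorm w))); first exact: rcont_orbit.
move=> t /ray_ge0 t0; rewrite orbitE //; apply: le_trans (cauchy_schwarz H_hilbert _ _) _.
have := twist_bound v t0; have := rnorm_ge0 w; nra.
Qed.

Lemma laplace_exists v : exists L, forall w,
  ip L w = cintegral ray (fun t => ip (orbit V v t) w).
Proof.
have [|u [hu _]] := weak_integral H_hilbert H_separable m_ray (laplace_integrable v) _
  (Ig (rnorm v)); last by exists u.
by move=> t /ray_ge0 t0; rewrite orbitE // mulrC twist_bound.
Qed.

Context (v L : H).
Hypothesis hL : forall w, ip L w = cintegral ray (fun t => ip (orbit V v t) w).

(** Moving [V h] to its adjoint and shifting time turns [V h L] into the integral over [[h, +oo[],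
    so only the segment [[0, h]] survives. *)
Let laplace_twist_ip h w : 0 <= h ->
  ip (V h L - L) w = - cintegral `[0, h] (fun t => ip (orbit V v t) w).
Proof.
move=> h0; have [Vs [_ hVs]] := adjoint_csg cV.
have -> : ip (V h L - L) w = cintegral ray (fun t => ip (orbit V v t) (Vs h w)) - ip L w.
  by rewrite dotBl hVs // hL.
have -> : cintegral ray (fun t => ip (orbit V v t) (Vs h w)) =
    cintegral ray (fun t => ip (orbit V v (t + h)) w).
  apply: eq_cintegral => t /ray_ge0 t0; rewrite !orbitE ?addr_ge0 // -hVs //.
  by rewrite addrC (csgD cV).
have [|_ ->] := @cintegral_shift _ 0 h _ (rcont_orbit v w).
  by rewrite add0r; apply: cintegrable_rayS h0 _; exact: laplace_integrable.
rewrite hL (cintegral_ray_split h0); last exact: laplace_integrable.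
by rewrite add0r opprD addrCA subrr addr0.
Qed.

Lemma laplace_twist_derivative (e : R) : 0 < e -> exists2 d : R, 0 < d &
  forall h, 0 < h < d -> rnorm (V h L - L + h%:C *: v) <= e * h.
Proof.
move=> e0; have [d d0 hd] := csg_cont0 cV v e0; exists d => // h /andP[h0 hhd].
set z := V h L - L + _.
suff key w : rnorm (ip z w) <= e * h * rnorm w.
  have := key z; rewrite dotvv // rnorm_realc ger0_norm ?sqr_ge0 // => k.
  have [->|z0] := eqVneq (rnorm z) 0; last first.
    have z1 : 0 < rnorm z by rewrite lt_neqAle eq_sym z0 rnorm_ge0.
    by rewrite -(ler_pM2r z1) -expr2.
  by rewrite mulr_ge0 // ltW.
pose sg := (`[0%R, h]%classic : set (measurableTypeR R)).
have msg : measurable sg by exact: measurable_itv.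
have Isg : cintegrable sg (fun t => ip (orbit V v t) w).
  by apply: cintegrable_segment; exact: rcont_orbit.
have cst_int : cintegral sg (fun=> ip v w) = h%:C * ip v w.
  apply: complex_eqP; rewrite /= itv_cst_integral ?ltW // subr0; case: (ip v w) => a b /=; ring.
have -> : ip z w = cintegral sg (fun t => -1 * ip (orbit V v t) w + ip v w).
  rewrite cintegralD //; last first.
  - by apply: cintegrable_segment; exact: rcont_cst.
  - exact: cintegrableZ.
  by rewrite cst_int cintegralZ // mulN1r /sg -(laplace_twist_ip w (ltW h0)) /z dotDl dotZl.
have -> : e * h * rnorm w = \int[mu]_(t in sg) (e * rnorm w).
  by rewrite itv_cst_integral ?ltW // subr0 mulrAC.
apply: cintegral_le => //.
- apply: cintegrableD => //; first exact: cintegrableZ.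
  by apply: cintegrable_segment; exact: rcont_cst.
- move=> t; rewrite /sg /= in_itv /= => /andP[t0 th].
  have -> : -1 * ip (orbit V v t) w + ip v w = - ip (V t v - v) w.
    by rewrite orbitE // dotBl; ring.
  rewrite cnormN; apply: le_trans (cauchy_schwarz H_hilbert _ _) _.
  by rewrite ler_wpM2r ?rnorm_ge0 // ltW // hd // (le_lt_trans th).
- by apply: rintegrable_segment => t; exact: cst_continuous.
Qed.

(** The product rule for [U h L = cexpt s (- h) *: V h L]: the factors have derivatives [s] and
    [- v] at zero. The three error terms receive the shares [e / 4], [e / 2] and [e / 4]. *)
Lemma laplace_generator (e : R) : 0 < e -> exists2 d : R, 0 < d &
  forall h, 0 < h < d -> rnorm (U h L - L - h%:C *: (s *: L - v)) <= e * h.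
Proof.
move=> e0.
have [|d1 d10 h1] := cexpt_derivative s (e := e / (2 * (rnorm L + 1))).
  by rewrite divr_gt0 // mulr_gt0 // ltr_wpDl ?rnorm_ge0.
pose K := expR (complex.Re s) + 1.
have K0 : 0 < K by rewrite ltr_wpDl ?expR_ge0.
have [|d2 d20 h2] := laplace_twist_derivative (e := e / (4 * K)).
  by rewrite divr_gt0 // mulr_gt0.
have [|d3 d30 h3] := continuous_cexpt s 0 (e := e / (4 * (rnorm v + 1))).
  by rewrite divr_gt0 // mulr_gt0 // ltr_wpDl ?rnorm_ge0.
exists (Num.min 1 (Num.min d1 (Num.min d2 d3))); first by rewrite !lt_min ltr01 d10 d20.
move=> h; rewrite !lt_min => /andP[h0 /and4P[hh1 hd1 hd2 hd3]].
have b1 := h1 h; rewrite h0 hd1 in b1; have {}b1 := b1 isT.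
have b2 := h2 h; rewrite h0 hd2 in b2; have {}b2 := b2 isT.
have b3 := h3 (- h); rewrite sub0r opprK gtr0_norm // cexpt0 in b3; have {}b3 := b3 hd3.
have UE : U h L = cexpt s (- h) *: V h L.
  by rewrite /V /twist scalerA -cexptD addNr cexpt0 scale1r.
have eK : rnorm (cexpt s (- h)) <= K.
  rewrite rnorm_cexpt mulrNN /K; apply: le_trans (_ : expR (complex.Re s) <= _); last by lra.
  by rewrite ler_expR ler_piMr ?ltW.
have -> : U h L - L - h%:C *: (s *: L - v) =
   cexpt s (- h) *: (V h L - L + h%:C *: v) + (cexpt s (- h) - 1 - s * h%:C) *: L
   + (h%:C * (1 - cexpt s (- h))) *: v.
  by rewrite UE; apply: (dot_inj H_hilbert) => w; rewrite !(dotDl, dotNl, dotZl); ring.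
apply: le_trans (ler_rnormD _ _) _.
apply: le_trans (lerD (ler_rnormD _ _) (lexx _)) _.
rewrite !rnormZ rnormM rnorm_realc gtr0_norm //.
have c1 : rnorm (cexpt s (- h)) * rnorm (V h L - L + h%:C *: v) <= e / 4 * h.
  apply: le_trans (_ : K * (e / (4 * K) * h) <= _).
    by apply: ler_pM; rewrite ?rnorm_ge0.
  by rewrite le_eqVlt; apply/orP; left; apply/eqP; field; lra.
have c2 : rnorm (cexpt s (- h) - 1 - s * h%:C) * rnorm L <= e / 2 * h.
  apply: le_trans (_ : e / (2 * (rnorm L + 1)) * h * (rnorm L + 1) <= _).
    by apply: ler_pM; rewrite ?rnorm_ge0 //; lra.
  by rewrite le_eqVlt; apply/orP; left; apply/eqP; field; have := rnorm_ge0 L; lra.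
have c3 : h * rnorm (1 - cexpt s (- h)) * rnorm v <= h * (e / 4).
  rewrite -mulrA ler_pM2l //.
  apply: le_trans (_ : e / (4 * (rnorm v + 1)) * (rnorm v + 1) <= _).
    by apply: ler_pM; rewrite ?rnorm_ge0 ?(ltW b3) //; lra.
  by rewrite le_eqVlt; apply/orP; left; apply/eqP; field; have := rnorm_ge0 v; lra.
lra.
Qed.

End Laplace.

End ContractionSemigroups.

(** * The Fejer kernel and the Plancherel bound *)

Section FejerKernel.
Context (R : realType).
Local Notation mu := (@lebesgue_measure R).
Local Notation rintegrable E f := (mu.-integrable E (EFin \o f)).
Local Notation RM := (measurableTypeR R).

Lemma fubini_cos (a p : R -> R) (D1 D2 : set RM) :
  measurable D1 -> measurable D2 -> rintegrable D1 a -> rintegrable D2 p ->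
  \int[mu]_(w in D1) (a w * \int[mu]_(r in D2) (cos (w * r) * p r)) =
  \int[mu]_(r in D2) ((\int[mu]_(w in D1) (a w * cos (w * r))) * p r).
Proof.
move=> mD1 mD2 Ia Ip.
(* Extension by zero to the whole line; the integrand is then dominated by the product of [|A w|]
   and [|Q r|], which justifies Fubini's theorem. *)
pose A : RM -> RM := a \_ D1; pose Q : RM -> RM := p \_ D2.
have IA : rintegrable (setT : set RM) A.
  by have := (integrable_mkcond _ mD1).1 Ia; rewrite restrict_EFin.
have IQ : rintegrable (setT : set RM) Q.
  by have := (integrable_mkcond _ mD2).1 Ip; rewrite restrict_EFin.
have mA : measurable_fun (setT : set RM) A by have /integrableP[/measurable_EFinP] := IA.
have mQ : measurable_fun (setT : set RM) Q by have /integrableP[/measurable_EFinP] := IQ.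
pose f (z : RM * RM) : \bar R := (A z.1 * cos (z.1 * z.2) * Q z.2)%:E.
have mcos : measurable_fun setT (cos : RM -> RM).
  exact: continuous_measurable_fun (@continuous_cos R).
have mf : measurable_fun setT f.
  apply/measurable_EFinP; apply: measurable_funM; last exact: measurableT_comp.
  apply: measurable_funM; first exact: measurableT_comp.
  apply: measurableT_comp => //; exact: measurable_funM.
have mcw (w : R) : measurable_fun setT ((fun r => cos (w * r)) : RM -> RM).
  by apply: continuous_measurable_fun => r; apply: continuous_comp;
    [exact: mulrl_continuous|exact: continuous_cos].
have cQ w : rintegrable setT (fun r => cos (w * r) * Q r).
  have mc : measurable_fun setT (fun r : RM => cos (w * r) * Q r).
    exact: (measurable_funM (mcw w) mQ).
  apply: (rintegrable_le measurableT mc _ (integrable_norm IQ)) => t _ /=.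
  by rewrite normrM ler_piMl // cos_max.
have cA r : rintegrable setT (fun w => A w * cos (w * r)).
  have mc : measurable_fun setT (fun w : RM => A w * cos (w * r)).
    under eq_fun do rewrite [_ * r]mulrC; exact: (measurable_funM mA (mcw r)).
  apply: (rintegrable_le measurableT mc _ (integrable_norm IA)) => t _ /=.
  by rewrite normrM ler_piMr // cos_max.
have If : (mu \x mu)%E.-integrable setT f.
  apply/(integrable12ltyP _ _ mf).
  have Q0 : 0 <= \int[mu]_r `|Q r| by apply: Rintegral_ge0.
  have IN := rintegrableZ (\int[mu]_r `|Q r|) measurableT (integrable_norm IA).
  have /integrableP[mIN IN2] := IN.
  apply: (@le_lt_trans _ _ _ _ _ _ IN2).
  apply: ge0_le_integral => //.
    - by move=> w _; apply: integral_ge0.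
    - apply: (measurable_fun_fubini_tonelli_F (abse \o f)) => //=.
      exact: measurableT_comp.
    - exact: (measurableT_comp (@abse_measurable R setT) mIN).
    move=> w _; rewrite /= normrM normr_id (ger0_norm Q0).
    rewrite mulrC -RintegralZl //; last exact: integrable_norm.
    rewrite /Rintegral fineK; last first.
      apply: integrable_fin_num => //.
      exact: (rintegrableZ `|A w| measurableT (integrable_norm IQ)).
    apply: ge0_le_integral => //.
    - have mfw : measurable_fun setT (fun r : RM => f (w, r)).
        exact: measurableT_comp mf (pair1_measurable w).
      exact: (measurableT_comp (@abse_measurable R setT) mfw).
    - by have /integrableP[] := rintegrableZ `|A w| measurableT (integrable_norm IQ).
    - by move=> r _; rewrite lee_fin /= !normrM ler_wpM2r // ler_piMr // cos_max.
have inner1 w : (\int[mu]_r f (w, r) = (A w * \int[mu]_r (cos (w * r) * Q r))%:E)%E.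
  rewrite -RintegralZl // /Rintegral fineK.
    by apply: eq_integral => r _; rewrite /f /= mulrA.
  by apply: integrable_fin_num => //; exact: (rintegrableZ (A w) measurableT (cQ w)).
have inner2 r : (\int[mu]_w f (w, r) = ((\int[mu]_w (A w * cos (w * r))) * Q r)%:E)%E.
  rewrite -RintegralZr // /Rintegral fineK.
    by apply: eq_integral => w _; rewrite /f.
  apply: integrable_fin_num => //.
  have := rintegrableZ (Q r) measurableT (cA r); apply: eq_integrable => //.
  by move=> w _ /=; rewrite mulrC.
have := Fubini If.
under eq_integral do rewrite inner1; under [in RHS]eq_integral do rewrite inner2.
move=> /(congr1 fine) /= FF.
rewrite [LHS]Rintegral_mkcond [RHS]Rintegral_mkcond.
transitivity (\int[mu]_w (A w * \int[mu]_r (cos (w * r) * Q r))).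
  apply: eq_Rintegral => w _; rewrite /A !patchE; case: ifP => _; last by rewrite mul0r.
  rewrite [in LHS]Rintegral_mkcond; congr (_ * _); apply: eq_Rintegral => r _.
  by rewrite /Q !patchE; case: ifP => _ //; rewrite mulr0.
rewrite [LHS]FF; apply: eq_Rintegral => r _; rewrite /Q !patchE.
case: ifP => _; last by rewrite mulr0.
rewrite [in RHS]Rintegral_mkcond; congr (_ * _); apply: eq_Rintegral => w _.
by rewrite /A !patchE; case: ifP => _ //; rewrite mul0r.
Qed.

(** Half the Fourier transform of the triangular weight on [[- N, N]]; as [N] grows its mass
    concentrates at the origin. *)
Definition fejer (N r : R) : R := \int[mu]_(w in `[0, N]) ((1 - N^-1 * w) * cos (w * r)).

Let continuous_weight (N r : R) : continuous (fun w => (1 - N^-1 * w) * cos (w * r)).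
Proof.
move=> w; apply: cvgM.
  by apply: cvgB; [exact: cvg_cst|exact: mulrl_continuous].
by apply: continuous_comp; [exact: mulrr_continuous|exact: continuous_cos].
Qed.

(** This closed form supplies the positivity of the kernel and its decay [2 / (N r^2)] away from the
    origin. *)
Lemma fejerE (N r : R) : 0 < N -> 0 < r -> fejer N r = (1 - cos (N * r)) / (N * r ^+ 2).
Proof.
move=> N0 r0.
pose F w : R := (1 - N^-1 * w) * (r^-1 * sin (w * r)) - (N * r ^+ 2)^-1 * cos (w * r).
have dF (w : R) : is_derive w 1 F ((1 - N^-1 * w) * cos (w * r)).
  apply: is_derive_eq; rewrite /GRing.scale /=.
  by field; rewrite !lt0r_neq0.
have cF : continuous F.
  by move=> w; apply: differentiable_continuous; apply/derivable1_diffP; have [] := dF w.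
have := @continuous_FTC2 R (fun w => (1 - N^-1 * w) * cos (w * r)) F 0 N N0.
rewrite /fejer /Rintegral => ->.
- rewrite /= /F !mul0r mulr0 sin0 cos0 mulVf ?lt0r_neq0 //.
  by field; rewrite !lt0r_neq0.
- exact: continuous_subspaceT.
- split; first by move=> w _; have [] := dF w.
    by apply: cvg_at_right_filter; exact: cF.
  by apply: cvg_at_left_filter; exact: cF.
- by move=> w _; rewrite derive1E; apply: derive_val.
Qed.

Lemma weight_bound (N w : R) : 0 < N -> 0 <= w <= N -> 0 <= 1 - N^-1 * w <= 1.
Proof.
move=> N0 /andP[w0 wN]; rewrite subr_ge0 gerBl mulr_ge0 ?invr_ge0 ?(ltW N0) // andbT.
by rewrite mulrC ler_pdivrMr // mul1r.
Qed.

Lemma fejer_continuous (N : R) : 0 < N -> continuous (fejer N).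
Proof.
move=> N0; apply: continuous_of_eps => t e e0.
exists (e / (N * N)); first by rewrite divr_gt0 // mulr_gt0.
move=> s ts; rewrite /fejer -RintegralB //; try exact: rintegrable_segment.
apply: le_lt_trans (_ : `|t - s| * N * (N - 0) < _).
  apply: itv_integral_bound; rewrite ?(ltW N0) //.
    move=> w; apply: cvgB; exact: continuous_weight.
  move=> w wN; have /andP[a0 a1] := weight_bound N0 wN; case/andP: wN => w0 wN.
  rewrite -mulrBr normrM (ger0_norm a0).
  apply: le_trans (_ : 1 * `|w * t - w * s| <= _).
    by apply: ler_pM => //; exact: cos_dist.
  by rewrite mul1r -mulrBr normrM (ger0_norm w0) mulrC ler_wpM2l.
by rewrite subr0 -mulrA -ltr_pdivlMr // mulr_gt0.
Qed.

Lemma fejer_le (N r : R) : 0 < N -> `|fejer N r| <= N.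
Proof.
move=> N0; apply: le_trans (_ : 1 * (N - 0) <= _); last by rewrite mul1r subr0.
apply: itv_integral_bound => [||w wN]; [exact: ltW|exact: (@continuous_weight N r)|].
 have /andP[a0 a1] := weight_bound N0 wN.
by rewrite normrM (ger0_norm a0) mulr_ile1 // cos_max.
Qed.

(** On [[0, N / 2]] the weight is at least [1 / 2] and the cosine at least [cos 1]; the rest of the
    integral is nonnegative. *)
Lemma fejer_lower (N r : R) : 0 < N -> 0 <= r -> N * r <= 1 -> N * (cos 1 / 4) <= fejer N r.
Proof.
move=> N0 r0 Nr; have c1 : 0 < cos 1 :> R by exact: cos1_gt0.
have N2 : 0 <= N / 2 by rewrite divr_ge0 // ltW.
have N2N : N / 2 <= N by rewrite ler_pdivrMr // ler_peMr ?(ltW N0) // ler1n.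
have cosb w : 0 <= w <= N -> cos 1 <= cos (w * r).
  move=> /andP[w0 wN]; have wr : w * r <= 1.
    by apply: le_trans Nr; rewrite ler_wpM2r.
  have wr0 : 0 <= w * r by rewrite mulr_ge0.
  have [->//|wr1] := eqVneq (w * r) 1.
  rewrite ltW // ltr_cos ?in_itv /=.
  - by rewrite lt_neqAle wr1.
  - by rewrite wr0 (le_trans wr) // (le_trans _ (pi_ge2 R)) // ler1n.
  - by rewrite ler01 (le_trans _ (pi_ge2 R)) // ler1n.
rewrite /fejer (itv_split N2 N2N (@continuous_weight N r)).
apply: le_trans (_ : \int[mu]_(w in `[0, N / 2]) (cos 1 / 2) + 0 <= _).
  by rewrite itv_cst_integral // le_eqVlt; apply/orP; left; apply/eqP; field.
apply: lerD.
  apply: le_Rintegral; rewrite ?measurable_itv //.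
  - by apply: rintegrable_segment => t; exact: cst_continuous.
  - exact: rintegrable_segment.
  - move=> w /=; rewrite in_itv /= => /andP[w0 wN].
    have h : 2^-1 <= 1 - N^-1 * w.
      have : N^-1 * w <= N^-1 * (N / 2) by rewrite ler_pM2l // invr_gt0.
      by rewrite mulrA mulVf ?lt0r_neq0 // mul1r; lra.
    rewrite mulrC; apply: ler_pM => //; first exact: ltW.
    by apply: cosb; rewrite w0 (le_trans wN).
apply: Rintegral_ge0 => w /=; rewrite in_itv /= => /andP[w0 wN].
have w1 : 0 <= w <= N by rewrite (le_trans N2 w0).
have /andP[a0 _] := weight_bound N0 w1.
by rewrite mulr_ge0 // (le_trans (ltW c1)) // cosb.
Qed.

(** The triangular average of [g w + g (- w)] is at most [M]. By Fubini it is four times the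
    integral of [fejer N] against [p], and this integral is at least [P cos 1 / 8] up to [O(1 / N)],
    whence the factor [2]. *)
Lemma fejer_bound (p g : R -> R) (sg P M : R) :
  0 < sg -> continuous p -> p 0 = P -> (forall r, 0 <= r -> `|p r| <= P * expR (- sg * r)) ->
  continuous g -> (forall w, 0 <= g w) -> (\int[mu]_w (g w)%:E <= M%:E)%E ->
  (forall w, g w + g (- w) = 4 * \int[mu]_(r in `[0, +oo[) (cos (w * r) * p r)) ->
  P * cos 1 <= 2 * M.
Proof.
move=> sg0 cp p0 pb cg g0 gM gE.
have c1 : 0 < cos 1 :> R by exact: cos1_gt0.
have P0 : 0 <= P by have := pb 0 (lexx _); rewrite mulr0 expR0 mulr1; apply: le_trans.
have M0 : 0 <= M.
  by rewrite -lee_fin; apply: le_trans gM; apply: integral_ge0 => w _; rewrite lee_fin.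
have [P1|P1] := eqVneq P 0; first by rewrite P1 mul0r mulr_ge0.
have {P1} P0 : 0 < P by rewrite lt_neqAle eq_sym P1.
pose ray := (`[0%R, +oo[%classic : set RM).
have mray : measurable ray by exact: measurable_itv.
have Iexp c : rintegrable ray (fun r => c * expR (- sg * r)).
  by apply: rintegrableZ => //; exact: rintegrable_exp.
have Ip : rintegrable ray p.
  apply: (rintegrable_le mray (measurable_continuous mray cp) _ (Iexp P)) => r.
  by rewrite /ray /= in_itv /= andbT; exact: pb.
pose I := \int[mu]_(r in ray) expR (- sg * r).
have I0 : 0 <= I by apply: Rintegral_ge0 => r _; exact: expR_ge0.
have upper N : 0 < N -> 4 * \int[mu]_(r in ray) (fejer N r * p r) <= M.
  move=> N0; pose sgm := (`[0%R, N]%classic : set RM).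
  have msg : measurable sgm by exact: measurable_itv.
  have cW : continuous (fun w : R => 1 - N^-1 * w).
    by move=> w; apply: cvgB; [exact: cvg_cst|exact: mulrl_continuous].
  have IW : rintegrable sgm (fun w : R => 1 - N^-1 * w) by apply: rintegrable_segment.
  rewrite -(fubini_cos msg mray IW Ip).
  have cgN : continuous (fun w => g (- w)).
    by move=> w; apply: continuous_comp; [exact: oppr_continuous|exact: cg].
  have cgg : continuous (fun w => g w + g (- w)) by move=> w; apply: cvgD; [exact: cg|exact: cgN].
  have -> : 4 * \int[mu]_(w in sgm) ((1 - N^-1 * w) *
      \int[mu]_(r in ray) (cos (w * r) * p r)) =
      \int[mu]_(w in sgm) ((1 - N^-1 * w) * (g w + g (- w))).
    rewrite -RintegralZl //.
      by apply: eq_Rintegral => w _; rewrite gE; ring.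
    have : rintegrable sgm (fun w => 4^-1 * ((1 - N^-1 * w) * (g w + g (- w)))).
      apply: rintegrable_segment => w; apply: cvgM; first exact: cvg_cst.
      by apply: cvgM; [exact: cW|exact: cgg].
    by apply: eq_integrable => // w _ /=; rewrite gE mulrCA mulKf.
  apply: (@le_trans _ _ (\int[mu]_(w in sgm) (g w + g (- w)))).
    apply: le_Rintegral => //.
    - by apply: rintegrable_segment => w; apply: cvgM; [exact: cW|exact: cgg].
    - exact: rintegrable_segment.
    - move=> w; rewrite /sgm /= in_itv /= => wN.
      have /andP[a0 a1] := weight_bound N0 wN.
      by rewrite ler_piMl // addr_ge0.
  rewrite RintegralD //; try exact: rintegrable_segment.
  have -> : \int[mu]_(w in sgm) g (- w) = \int[mu]_(w in `[- N, 0]) g w.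
    have := @integration_by_substitution_oppr R g 0 N (ltW N0).
    rewrite oppr0 /Rintegral => -> //; exact: continuous_subspaceT.
  rewrite addrC -itv_split ?oppr_le0 ?(ltW N0) // -lee_fin.
  have Ig := rintegrable_segment (- N) N cg.
  rewrite /Rintegral fineK; last by apply: integrable_fin_num Ig; exact: measurable_itv.
  apply: le_trans gM.
  apply: (@ge0_subset_integral _ _ _ mu (`[- N, N]%classic : set RM) setT) => //.
    by apply/measurable_EFinP; exact: measurable_continuous.
  by move=> y _ /=; rewrite lee_fin.
have [d d0 hd] := eps_of_continuous cp 0 (divr_gt0 P0 (ltr0n _ 2)).
pose del := d / 2; have del0 : 0 < del by rewrite divr_gt0.
have pdel r : 0 <= r -> r <= del -> P / 2 <= p r.
  move=> r0 rd; have := hd r; rewrite sub0r normrN ger0_norm // p0.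
  have rd' : r < d by apply: le_lt_trans rd _; rewrite /del; lra.
  by move=> /(_ rd'); rewrite ltr_norml => /andP[_]; lra.
have lower N : 0 < N -> N^-1 <= del ->
    P * cos 1 / 8 - 2 / (N * del ^+ 2) * (P * I) <= \int[mu]_(r in ray) (fejer N r * p r).
  move=> N0 Nd; have cK := fejer_continuous N0.
  have cq : continuous (fun r => fejer N r * p r).
    by move=> r; apply: cvgM; [exact: cK|exact: cp].
  have Iq : rintegrable ray (fun r => fejer N r * p r).
    apply: (rintegrable_le mray (measurable_continuous mray cq) _ (Iexp (N * P))) => r.
    rewrite /ray /= in_itv /= andbT => r0; rewrite normrM -mulrA.
    by apply: ler_pM => //; [exact: fejer_le|exact: pb].
  have Nd0 : 0 <= N^-1 by rewrite invr_ge0 ltW.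
  have Iq1 := ray_integrableS Nd0 Iq.
  (* The segment [[0, 1 / N]] carries the main term, [[1 / N, del]] contributes a nonnegative
     amount, and beyond [del] the kernel is at most [2 / (N del^2)]. *)
  rewrite (ray_split Nd0 Iq) (ray_split Nd Iq1) addrA; apply: lerD.
    apply: le_trans (_ : \int[mu]_(r in `[0, N^-1]) (N * (cos 1 / 4) * (P / 2)) + 0 <= _).
      rewrite itv_cst_integral // le_eqVlt; apply/orP; left; apply/eqP.
      by field; rewrite lt0r_neq0.
    apply: lerD.
      apply: le_Rintegral; rewrite ?measurable_itv //.
      - by apply: rintegrable_segment => t; exact: cst_continuous.
      - exact: rintegrable_segment.
      - move=> r /=; rewrite in_itv /= => /andP[r0 rN]; apply: ler_pM.
        + by rewrite mulr_ge0 ?(ltW N0) // divr_ge0 // ltW.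
        + by rewrite divr_ge0 // ltW.
        + by apply: fejer_lower => //; rewrite mulrC -ler_pdivlMr ?div1r.
        + by apply: pdel => //; apply: le_trans rN Nd.
    apply: Rintegral_ge0 => r /=; rewrite in_itv /= => /andP[rN rd].
    have r0 : 0 < r by apply: lt_le_trans rN; rewrite invr_gt0.
    apply: mulr_ge0; last by apply: le_trans (pdel r (ltW r0) rd); rewrite divr_ge0 // ltW.
    rewrite fejerE // divr_ge0 ?subr_ge0 ?cos_le1 // mulr_ge0 ?(ltW N0) //.
    exact: sqr_ge0.
  pose c := 2 / (N * del ^+ 2) * P.
  have c0 : 0 <= c by rewrite mulr_ge0 ?(ltW P0) // divr_ge0 // mulr_ge0 ?(ltW N0) // sqr_ge0.
  have Ic := Iexp (- c); have Ie := Iexp c.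
  have del0' := ltW del0.
  apply: le_trans (_ : \int[mu]_(r in `[del, +oo[) (- c * expR (- sg * r)) <= _).
    have E1 : \int[mu]_(r in ray) (- c * expR (- sg * r)) = - c * I.
      by rewrite RintegralZl //; exact: rintegrable_exp.
    have := ray_split del0' Ic; rewrite E1.
    have : \int[mu]_(r in `[0, del]) (- c * expR (- sg * r)) <= 0.
      have : 0 <= \int[mu]_(r in `[0, del]) (c * expR (- sg * r)).
        by apply: Rintegral_ge0 => r _; rewrite mulr_ge0 // expR_ge0.
      have -> : \int[mu]_(r in `[0, del]) (- c * expR (- sg * r)) =
          - \int[mu]_(r in `[0, del]) (c * expR (- sg * r)); last by lra.
        rewrite -[RHS]mulN1r -RintegralZl; last exact: ray_segment_integrable Ie.
          by apply: eq_Rintegral => r _; rewrite mulN1r mulNr.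
        exact: measurable_itv.
    by rewrite /c -!mulrA; lra.
  apply: le_Rintegral; rewrite ?measurable_itv //.
  - exact: ray_integrableS Ic.
  - exact: ray_integrableS Iq.
  - move=> r /=; rewrite in_itv /= andbT => rd.
    have r0 : 0 < r by apply: lt_le_trans rd.
    suff : `|fejer N r * p r| <= c * expR (- sg * r).
      by rewrite [- c * _]mulNr ler_norml => /andP[].
    rewrite normrM /c -mulrA; apply: ler_pM => //; last exact: pb (ltW r0).
    rewrite fejerE // ger0_norm; last first.
      by rewrite divr_ge0 ?subr_ge0 ?cos_le1 // mulr_ge0 ?(ltW N0) // sqr_ge0.
    apply: ler_pM.
    + by rewrite subr_ge0 cos_le1.
    + by rewrite invr_ge0 mulr_ge0 ?(ltW N0) // sqr_ge0.
    + by have := cos_geN1 (N * r); lra.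
    + rewrite lef_pV2 ?posrE ?mulr_gt0 ?exprn_gt0 // ler_pM2l // ler_sqr ?nnegrE //; exact: ltW.
apply/ler_addgt0Pr => e e0.
(* The tail error is [Q / N / 8]; [N] is chosen so that [1 / N <= del] and [Q / N <= e]. *)
pose Q := 16 / del ^+ 2 * (P * I).
have Q0 : 0 <= Q.
  by apply: mulr_ge0; [rewrite divr_ge0 // sqr_ge0|rewrite mulr_ge0 // ltW].
pose N := del^-1 + Q / e.
have N0 : 0 < N by rewrite ltr_pwDl ?invr_gt0 // divr_ge0 // ltW.
have Nd : N^-1 <= del.
  by rewrite -[leRHS]invrK lef_pV2 ?posrE ?invr_gt0 // lerDl divr_ge0 // ltW.
have := upper N N0; have := lower N N0 Nd.
have -> : 2 / (N * del ^+ 2) * (P * I) = Q / N / 8 by rewrite /Q; field; rewrite !lt0r_neq0.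
have : Q / N <= e.
  by rewrite ler_pdivrMr // /N mulrDr [e * (Q / e)]mulrC divfK ?lt0r_neq0 // lerDr
    mulr_ge0 ?invr_ge0 ?(ltW e0) ?(ltW del0).
lra.
Qed.

End FejerKernel.

(** * Energy of damped orbits from their Laplace transforms *)

Section Plancherel.
Context (R : realType) (H : completeNormedModType R[i]).
Context (dot : {dot H for Num.conj}).
Hypothesis H_hilbert : forall v : H, `|v| ^+ 2 = dot v v.
Hypothesis H_separable : separable H.
Implicit Types u v : H.
Local Notation C := R[i].
Local Notation ip := (inner dot).
Local Notation mu := (@lebesgue_measure R).
Local Notation rintegrable E f := (mu.-integrable E (EFin \o f)).
Context (U : R -> H -> H) (cU : csg U) (sg : R) (sg_gt0 : 0 < sg).

Let ray := (`[0%R, +oo[%classic : set (measurableTypeR R)).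
Let m_ray : measurable ray. Proof. exact: measurable_itv. Qed.
Let ray_ge0 t : ray t -> 0 <= t.
Proof. by rewrite /ray /= in_itv /= andbT. Qed.

Let V := twist sg%:C U.
Let cV : csg V. Proof. by apply: twist_csg; rewrite ?ltW. Qed.

(** Norms depend on the real part of the damping only, so one form [q] serves all points of the
    vertical line. *)
Let rnormV (w t : R) v : 0 <= t -> rnorm (V t v) = rnorm (twist (sg +i* w) U t v).
Proof. by move=> t0; rewrite /V /twist !rnormZ !rnorm_cexpt. Qed.

Let Iexp c : rintegrable ray (fun t => c * expR (- sg * t)).
Proof. by apply: rintegrableZ => //; exact: rintegrable_exp. Qed.

Let V_bound t v : 0 <= t -> rnorm (V t v) <= expR (- sg * t) * rnorm v.
Proof. by move=> t0; have := @twist_bound _ _ _ cU sg%:C t v t0. Qed.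

Let pair u v t := ip (orbit V u t) (orbit V v t).

Let pair_rcont u v : rcont (pair u v).
Proof. by apply: rcont_dot => //; exact: orbit_rcont. Qed.

Let pair_bound u v t : ray t -> rnorm (pair u v t) <= rnorm u * rnorm v * expR (- sg * t).
Proof.
move=> /ray_ge0 t0; rewrite /pair !orbitE //; apply: le_trans (cauchy_schwarz H_hilbert _ _) _.
rewrite mulrAC; apply: ler_pM; rewrite ?rnorm_ge0 ?(csg_contr cV) //.
by rewrite mulrC V_bound.
Qed.

Let pair_int u v : cintegrable ray (pair u v).
Proof. exact: (cintegrable_le m_ray (pair_rcont u v) (@pair_bound u v) (Iexp _)). Qed.

(** The Gramian of the damped semigroup, that is, the solution of a Lyapunov equation read as a
    form. *)
Let q u v := cintegral ray (pair u v).

Let q_linear v (a : C) u1 u2 : q (a *: u1 + u2) v = a * q u1 v + q u2 v.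
Proof.
rewrite /q -cintegralZ // -cintegralD //; last exact: cintegrableZ.
apply: eq_cintegral => t /ray_ge0 t0; rewrite /pair !orbitE // (csg_additive cV) //.
by rewrite dotDl dotZl.
Qed.

Let qC u v : q u v = conjc (q v u).
Proof.
by rewrite /q -cintegral_conj //; apply: eq_cintegral => t _; rewrite /pair dotC.
Qed.

Let K : R := \int[mu]_(t in ray) expR (- sg * t).
Let K_ge0 : 0 <= K. Proof. by apply: Rintegral_ge0 => t _; exact: expR_ge0. Qed.

Let q_bound u v : rnorm (q u v) <= K * (rnorm u * rnorm v).
Proof.
have := cintegral_le m_ray (pair_int u v) (@pair_bound u v) (Iexp _).
by rewrite RintegralZl // 1?mulrC //; exact: rintegrable_exp.
Qed.

Let pairvv v t : complex.Re (pair v v t) = rnorm (orbit V v t) ^+ 2.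
Proof. by rewrite /pair dotvv. Qed.

Let squeeze (x I z X Y c p1 p2 p3 : R) : `|x - I| <= p1 -> `|X| <= p2 -> `|Y| <= p3 ->
  c - I = c - z + 2 * X + Y -> `|x - z| <= p1 + 2 * p2 + p3.
Proof.
rewrite !ler_norml => /andP[? ?] /andP[? ?] /andP[? ?] ?; apply/andP; split; lra.
Qed.

Section Line.
Context (b Z : H) (hZ : forall u, q u b = ip u Z) (w : R).
Let s : C := sg +i* w.
Context (L : H).
Hypothesis hL : forall u, ip L u = cintegral ray (fun t => ip (orbit (twist s U) b t) u).

(* [Q v = q v v] satisfies [Q (V h L) - Q L = - \int_0^h |V t L|^2], whereas
   [V h L - L = - h b + o(h)]. *)
Lemma plancherel_identity : rnorm L ^+ 2 = 2 * complex.Re (ip L Z).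
Proof.
have s0 : 0 < complex.Re s by [].
have cVs : csg (twist s U) by apply: twist_csg; rewrite ?ltW.
apply/eqP; rewrite -subr_eq0 -normr_le0; apply/ler_addgt0Pr => e e0; rewrite add0r.
(* The three summands collect the errors from the mean of the squared norm, from the cross term
   [q L et] and from [q dl dl]. *)
pose W : R := 1 + 2 * K * rnorm L + K * (rnorm b + 1) ^+ 2.
have W0 : 0 < W.
  have h1 : 0 <= K * rnorm L by rewrite mulr_ge0 ?rnorm_ge0.
  have h2 : 0 <= K * (rnorm b + 1) ^+ 2 by rewrite mulr_ge0 ?sqr_ge0.
  by rewrite /W; lra.
pose e1 := Num.min 1 (e / W).
have e10 : 0 < e1 by rewrite lt_min ltr01 divr_gt0.
have e11 : e1 <= 1 by rewrite ge_min lexx.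
have e1W : e1 * W <= e by rewrite -ler_pdivlMr // ge_min lexx orbT.
have [d1 d10 h1] := laplace_twist_derivative H_hilbert H_separable cU s0 hL e10.
have cN : continuous (fun t => rnorm (orbit V L t) ^+ 2).
  by move=> t; apply: cvgM; exact: (rcont_rnorm (orbit_rcont L cV)).
have [d2 d20 h2] := eps_of_continuous cN 0 e10.
pose h := Num.min e1 (Num.min (d1 / 2) (d2 / 2)).
have h0 : 0 < h by rewrite lt_min e10 lt_min !divr_gt0.
have he : h <= e1 by rewrite ge_min lexx.
have hd1 : h < d1.
  by apply: le_lt_trans (_ : d1 / 2 < _); [rewrite !ge_min lexx !orbT|lra].
have hd2 : h < d2.
  by apply: le_lt_trans (_ : d2 / 2 < _); [rewrite !ge_min lexx !orbT|lra].
pose dl := twist s U h L - L.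
pose et := dl + h%:C *: b.
have et_le : rnorm et <= e1 * h by apply: h1; rewrite h0.
have dlE : dl = (- h%:C) *: b + et by rewrite /et scaleNr addrC addrK.
have dl_le : rnorm dl <= h * (rnorm b + 1).
  rewrite dlE; apply: le_trans (ler_rnormD _ _) _.
  rewrite rnormZ cnormN rnorm_realc gtr0_norm //.
  by have : e1 * h <= 1 * h by [rewrite ler_pM2r]; lra.
have Qdl : complex.Re (q (L + dl) (L + dl)) =
    complex.Re (q L L) - \int[mu]_(t in `[0, h]) (rnorm (orbit V L t) ^+ 2).
  have -> : L + dl = twist s U h L by rewrite addrC subrK.
  have cr : rcont (fun t => pair L L (t + h)) by apply: rcont_shift.
  have Ih : cintegrable (`[0 + h, +oo[%classic : set (measurableTypeR R)) (pair L L).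
    by rewrite add0r; apply: cintegrable_rayS (ltW h0) _.
  have [_ hs] := @cintegral_shift _ 0 h _ (pair_rcont L L) Ih.
  have -> : q (twist s U h L) (twist s U h L) = cintegral `[h, +oo[ (pair L L).
    rewrite -[X in `[X, +oo[](add0r h) -hs; apply: eq_cintegral => t /ray_ge0 t0.
    rewrite /pair !orbitE ?addr_ge0 ?(ltW h0) // !dotvv //.
    by rewrite !(rnormV w) ?addr_ge0 ?(ltW h0) // -(csgD cVs) ?(ltW h0).
  rewrite /q (cintegral_ray_split (ltW h0) (pair_int L L)) ReD.
  have -> : complex.Re (cintegral `[0, h] (pair L L)) =
      \int[mu]_(t in `[0, h]) (rnorm (orbit V L t) ^+ 2).
    by apply: eq_Rintegral => t _; rewrite pairvv.
  by rewrite addrC addKr.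
have qD u v1 v2 : q u (v1 + v2) = q u v1 + q u v2.
  by rewrite qC [q u v1]qC [q u v2]qC -(scale1r v1) q_linear mul1r scale1r rmorphD.
have qDl u1 u2 v : q (u1 + u2) v = q u1 v + q u2 v.
  by rewrite -(scale1r u1) q_linear mul1r scale1r.
have Qexp : complex.Re (q (L + dl) (L + dl)) =
    complex.Re (q L L) - h * (2 * complex.Re (ip L Z)) + 2 * complex.Re (q L et)
      + complex.Re (q dl dl).
  have E1 : complex.Re (q L dl) = - h * complex.Re (ip L Z) + complex.Re (q L et).
    have q0 : q 0 L = 0.
      by have /eqP := qDl 0 0 L; rewrite addr0 -subr_eq0 opprD addNKr oppr_eq0 => /eqP.
    have := q_linear L (- h%:C) b 0; rewrite q0 !addr0 => qZ.
    rewrite dlE qD ReD [q L (_ *: b)]qC Re_conj qZ ReM /= oppr0 mul0r subr0.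
    by rewrite -hZ qC Re_conj.
  rewrite qD (qDl L dl L) (qDl L dl dl) !ReD [q dl L]qC Re_conj E1; lra.
have hm : `|h * rnorm L ^+ 2 - \int[mu]_(t in `[0, h]) (rnorm (orbit V L t) ^+ 2)| <= e1 * h.
  have -> : h * rnorm L ^+ 2 = \int[mu]_(t in `[0, h]) (rnorm L ^+ 2).
    by rewrite itv_cst_integral ?(ltW h0) // subr0 mulrC.
  have Icst : rintegrable (`[0, h]%classic : set (measurableTypeR R)) (fun=> rnorm L ^+ 2).
    by apply: rintegrable_segment => t; exact: cst_continuous.
  have msg : measurable (`[0, h]%classic : set (measurableTypeR R)) by exact: measurable_itv.
  rewrite -(RintegralB msg Icst (rintegrable_segment 0 h cN)).
  have -> : e1 * h = e1 * (h - 0) by rewrite subr0.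
  apply: itv_integral_bound; first exact: ltW.
    by move=> t; apply: cvgB; [exact: cvg_cst|exact: cN].
  move=> t /andP[t0 th]; have := h2 t; rewrite sub0r normrN ger0_norm //.
  rewrite orbitE // (csg0 cV) => k; apply/ltW/k; exact: le_lt_trans th hd2.
have b1 : `|complex.Re (q L et)| <= K * (rnorm L * (e1 * h)).
  apply: le_trans (Re_le_rnorm _) _; apply: le_trans (q_bound _ _) _.
  by rewrite ler_wpM2l // ler_wpM2l ?rnorm_ge0.
have b2 : `|complex.Re (q dl dl)| <= K * (e1 * h * (rnorm b + 1) ^+ 2).
  apply: le_trans (Re_le_rnorm _) _; apply: le_trans (q_bound _ _) _.
  rewrite ler_wpM2l //; apply: le_trans (_ : (h * (rnorm b + 1)) * (h * (rnorm b + 1)) <= _).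
    by apply: ler_pM; rewrite ?rnorm_ge0.
  rewrite mulrACA [(rnorm b + 1) ^+ 2]expr2; apply: ler_wpM2r.
    by rewrite -expr2 sqr_ge0.
  by rewrite ler_wpM2r // ltW.
have key : h * `|rnorm L ^+ 2 - 2 * complex.Re (ip L Z)| <= h * (e1 * W).
  rewrite -[h in leLHS](gtr0_norm h0) -normrM mulrBr.
  have E : h * (e1 * W) = e1 * h + 2 * (K * (rnorm L * (e1 * h))) +
    K * (e1 * h * (rnorm b + 1) ^+ 2) by rewrite /W; ring.
  by rewrite E; apply: (squeeze (c := complex.Re (q L L)) hm b1 b2); rewrite -Qexp Qdl.
by apply: le_trans e1W; rewrite ler_pM2l in key.
Qed.

End Line.

(** Writing [L w] in [2 Re <L w, Z>] as a Laplace transform gives a cosine transform of [p] plus a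
    sine transform of [m]. The sum over [w] and [- w] cancels the sine part, and [p 0] is the
    energy. The sign [eps] serves transforms read along the conjugate line. *)
Lemma twist_energy_bound (b : H) (L : R -> H) (eps M : R) : eps = 1 \/ eps = - 1 ->
  (forall w u, ip (L w) u = cintegral ray (fun t => ip (orbit (twist (sg +i* w) U) b t) u)) ->
  (\int[mu]_w (rnorm (L (eps * w)) ^+ 2)%:E <= M%:E)%E ->
  \int[mu]_(t in ray) (rnorm (orbit V b t) ^+ 2) * cos 1 <= 2 * M.
Proof.
move=> heps hL hM.
have [|u|Z hZ] := riesz H_hilbert H_separable (l := q^~ b) (M := K * rnorm b).
- by move=> a u v; exact: q_linear.
- by apply: le_trans (q_bound _ _) _; rewrite -mulrA [rnorm b * _]mulrC.
pose E := \int[mu]_(t in ray) (rnorm (orbit V b t) ^+ 2).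
have cN : continuous (fun t => rnorm (orbit V b t) ^+ 2).
  by move=> t; apply: cvgM; exact: (rcont_rnorm (orbit_rcont b cV)).
have IE : rintegrable ray (fun t => rnorm (orbit V b t) ^+ 2).
  have [+ _] := pair_int b b; apply: eq_integrable => // t _.
  by rewrite /= -pairvv.
(* [U r] commutes with the damped semigroup and contracts, so pairing with [b] costs at most the
   energy of [b]. *)
have zb r : 0 <= r -> rnorm (ip (U r b) Z) <= E.
  move=> r0; rewrite -hZ; apply: (cintegral_le m_ray (pair_int _ _) _ IE) => t /ray_ge0 t0.
  rewrite /pair !orbitE //; apply: le_trans (cauchy_schwarz H_hilbert _ _) _.
  rewrite expr2 ler_wpM2r ?rnorm_ge0 // /V /twist !rnormZ ler_wpM2l ?rnorm_ge0 //.
  by rewrite -(csgD cU) // addrC (csgD cU) // (csg_contr cU).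
pose z t := ip (orbit U b t) Z.
have cz : rcont z by apply: rcont_dot => //; [exact: orbit_rcont|exact: rcont_cst].
have ce : continuous (fun r : R => expR (- sg * r)).
  by move=> r; apply: continuous_comp; [exact: mulrl_continuous|exact: continuous_expR].
pose p r := expR (- sg * r) * complex.Re (z r).
pose m r := expR (- sg * r) * complex.Im (z r).
have cp : continuous p by move=> r; apply: cvgM; [exact: ce|exact: (rcont_Re cz)].
have cm : continuous m by move=> r; apply: cvgM; [exact: ce|exact: (rcont_Im cz)].
have pb r : 0 <= r -> `|p r| <= E * expR (- sg * r).
  move=> r0; rewrite /p normrM (ger0_norm (expR_ge0 _)) mulrC ler_wpM2r ?expR_ge0 //.
  by apply: le_trans (Re_le_rnorm _) _; rewrite /z orbitE // zb.
have mb r : 0 <= r -> `|m r| <= E * expR (- sg * r).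
  move=> r0; rewrite /m normrM (ger0_norm (expR_ge0 _)) mulrC ler_wpM2r ?expR_ge0 //.
  by apply: le_trans (Im_le_rnorm _) _; rewrite /z orbitE // zb.
have E0 : 0 <= E by apply: Rintegral_ge0 => t _; exact: sqr_ge0.
have Iwave (f k : R -> R) : continuous f -> (forall x, `|f x| <= 1) -> continuous k ->
    (forall r, 0 <= r -> `|k r| <= E * expR (- sg * r)) ->
    forall w, rintegrable ray (fun r => f (w * r) * k r).
  move=> cf f1 ck kb w.
  have cfk : continuous (fun r => f (w * r) * k r).
    move=> r; apply: cvgM; last exact: ck.
    by apply: continuous_comp; [exact: mulrl_continuous|exact: cf].
  apply: (rintegrable_le m_ray (measurable_continuous m_ray cfk) _ (Iexp E)) => r /ray_ge0 r0.
  by rewrite normrM; apply: le_trans (kb r r0); rewrite ler_piMl.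
have Icos := Iwave _ _ (@continuous_cos R) (@cos_max R) cp pb.
have Isin := Iwave _ _ (@continuous_sin R) (@sin_max R) cm mb.
pose Fc w := \int[mu]_(r in ray) (cos (w * r) * p r).
pose Fs w := \int[mu]_(r in ray) (sin (w * r) * m r).
have GE w : rnorm (L w) ^+ 2 = 2 * (Fc w + Fs w).
  rewrite (plancherel_identity hZ (hL w)) hL /Fc /Fs -RintegralD //; congr (_ * _).
  apply: eq_Rintegral => t /set_mem/ray_ge0 t0.
  rewrite orbitE // /twist dotZl /p /m /z orbitE // /cexpt.
  by case: (ip (U t b) Z) => x y /=; ring.
have Iexp2 := rintegrableZ (2 / sg * E) m_ray (rintegrable_exp (divr_gt0 sg_gt0 (ltr0n R 2))).
pose W := \int[mu]_(r in ray) (2 / sg * E * expR (- (sg / 2) * r)).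
have W0 : 0 <= W.
  by apply: Rintegral_ge0 => r _; rewrite mulr_ge0 ?expR_ge0 // mulr_ge0 // divr_ge0 // ltW.
have lip (f k : R -> R) : continuous f -> (forall x, `|f x| <= 1) -> continuous k ->
    (forall r, 0 <= r -> `|k r| <= E * expR (- sg * r)) ->
    (forall x y, `|f x - f y| <= `|x - y|) -> forall w w',
    `|\int[mu]_(r in ray) (f (w * r) * k r) - \int[mu]_(r in ray) (f (w' * r) * k r)|
    <= `|w - w'| * W.
  move=> cf f1 ck kb fl w w'; have If := Iwave _ _ cf f1 ck kb.
  have ID : rintegrable ray (fun r => f (w * r) * k r - f (w' * r) * k r).
    by have := rintegrableD m_ray (If w) (rintegrableN m_ray (If w')).
  rewrite -RintegralB //; apply: le_trans (le_normr_Rintegral m_ray ID) _.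
  rewrite /W -RintegralZl //; apply: le_Rintegral => //.
  - exact: integrable_norm.
  - exact: rintegrableZ.
  - move=> r /ray_ge0 r0; rewrite -mulrBl normrM.
    apply: le_trans (_ : (`|w - w'| * r) * (E * expR (- sg * r)) <= _).
      apply: ler_pM => //; last exact: kb.
      by apply: le_trans (fl _ _) _; rewrite -mulrBl normrM (ger0_norm r0).
    (* From [1 + x <= exp x] at [x = sg r / 2]: half of the decay pays for the factor [r] produced
       by the Lipschitz bound of the wave. *)
    have key : r * expR (- sg * r) <= 2 / sg * expR (- (sg / 2) * r).
      have -> : - sg * r = - (sg / 2) * r - sg / 2 * r by field.
      rewrite expRD expRN mulrCA mulrC ler_wpM2r ?expR_ge0 // ler_pdivrMr ?expR_gt0 //.
      have := expR_ge1Dx (sg / 2 * r); set y := expR _ => h.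
      have -> : r = 2 / sg * (sg / 2 * r) by field; rewrite lt0r_neq0.
      by rewrite ler_wpM2l ?divr_ge0 ?(ltW sg_gt0) //; lra.
    have -> : `|w - w'| * r * (E * expR (- sg * r)) = `|w - w'| * E * (r * expR (- sg * r)).
      by ring.
    have -> : `|w - w'| * (2 / sg * E * expR (- (sg / 2) * r)) =
      `|w - w'| * E * (2 / sg * expR (- (sg / 2) * r)) by ring.
    by rewrite ler_wpM2l // mulr_ge0.
have cg : continuous (fun w => rnorm (L w) ^+ 2).
  apply: continuous_of_eps => t e e0.
  exists (e / (4 * (W + 1))); first by rewrite divr_gt0 // mulr_gt0 // ltr_wpDl.
  move=> r; rewrite ltr_pdivlMr ?mulr_gt0 ?ltr_wpDl // => h.
  rewrite !GE.
  have := lip _ _ (@continuous_cos R) (@cos_max R) cp pb (@cos_dist R) t r.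
  have := lip _ _ (@continuous_sin R) (@sin_max R) cm mb (@sin_dist R) t r.
  rewrite -/(Fs t) -/(Fs r) -/(Fc t) -/(Fc r) => h1 h2.
  have -> : 2 * (Fc t + Fs t) - 2 * (Fc r + Fs r) = 2 * ((Fc t - Fc r) + (Fs t - Fs r)) by ring.
  rewrite normrM ger0_norm //; apply: le_lt_trans (_ : 2 * (2 * (`|t - r| * W)) < _).
    rewrite ler_pM2l //; apply: le_trans (ler_normD _ _) _; lra.
  by have := normr_ge0 (t - r); nra.
have p0 : p 0 = E.
  rewrite /p mulr0 expR0 mul1r /z orbitE // csg0 // -hZ.
  by apply: eq_Rintegral => t _; rewrite pairvv.
have cge : continuous (fun w => rnorm (L (eps * w)) ^+ 2).
  by move=> w; exact: (continuous_comp (@mulrl_continuous R eps w) (cg (eps * w))).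
apply: (fejer_bound sg_gt0 cp p0 pb cge _ hM) => [w|w]; first exact: sqr_ge0.
rewrite !GE; have FcN y : Fc (- y) = Fc y.
  by apply: eq_Rintegral => r _; rewrite mulNr cosN.
have -> : Fs (eps * - w) = - Fs (eps * w); last first.
  rewrite mulrN FcN -/(Fc w); have -> : Fc (eps * w) = Fc w; last by ring.
  by case: heps => ->; rewrite ?mul1r ?mulN1r.
rewrite mulrN; move: (eps * w) => {}w.
rewrite -[RHS]mulN1r -RintegralZl //; apply: eq_Rintegral => r _.
by rewrite [- w * r]mulNr sinN mulN1r mulNr.
Qed.

End Plancherel.

Section PlancherelBound.
Context (R : realType) (H : completeNormedModType R[i]).
Context (dot : {dot H for Num.conj}).
Hypothesis H_hilbert : forall v : H, `|v| ^+ 2 = dot v v.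
Hypothesis H_separable : separable H.
Local Notation C := R[i].
Local Notation ip := (inner dot).
Local Notation mu := (@lebesgue_measure R).
Local Notation rintegrable E f := (mu.-integrable E (EFin \o f)).

Lemma orbit_square_integrable (U : R -> H -> H) (b : H) (L : R -> R -> H) (eps M : R) : csg U ->
  eps = 1 \/ eps = - 1 ->
  (forall sg w u, 0 < sg ->
     ip (L sg w) u = cintegral `[0, +oo[ (fun t => ip (orbit (twist (sg +i* w) U) b t) u)) ->
  (forall sg, 0 < sg -> (\int[mu]_w (rnorm (L sg (eps * w)) ^+ 2)%:E <= M%:E)%E) ->
  rintegrable (`[0, +oo[%classic : set (measurableTypeR R)) (fun t => rnorm (orbit U b t) ^+ 2).
Proof.
move=> cU heps hL hM.
have c1 : 0 < cos 1 :> R by exact: cos1_gt0.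
have cN : continuous (fun t => rnorm (orbit U b t) ^+ 2).
  by move=> t; apply: cvgM; exact: (rcont_rnorm (orbit_rcont b cU)).
suff bound (n : nat) : \int[mu]_(t in `[0, 0 + n%:R]) (rnorm (orbit U b t) ^+ 2)
    <= expR 2 * (2 * M / cos 1).
  by have [|] := ge0_ray_integral_bound (a := 0) _ cN bound; first by move=> t _; exact: sqr_ge0.
(* At the damping rate [1 / (n + 1)] the factor [exp (- 2 sg t)] stays above [exp (- 2)] on
   [[0, n]], while [M] bounds the damped energy at every rate. *)
rewrite add0r; pose T : R := n%:R + 1; have T0 : 0 < T by rewrite ltr_wpDl.
pose sg := T^-1; have sg0 : 0 < sg by rewrite invr_gt0.
have := twist_energy_bound H_hilbert H_separable cU sg0 heps (fun w u => hL sg w u sg0) (hM sg sg0).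
set V := twist sg%:C U => hE.
have cV : csg V by apply: twist_csg => //; exact: ltW.
have cNV : continuous (fun t => rnorm (orbit V b t) ^+ 2).
  by move=> t; apply: cvgM; exact: (rcont_rnorm (orbit_rcont b cV)).
have IV : rintegrable (`[0, +oo[%classic : set (measurableTypeR R))
    (fun t => rnorm (orbit V b t) ^+ 2).
  apply: (rintegrable_le _ (measurable_continuous _ cNV) _
    (rintegrableZ (rnorm b ^+ 2) _ (rintegrable_exp sg0))); try exact: measurable_itv.
  move=> t; rewrite /= in_itv /= andbT => t0.
  rewrite ger0_norm ?sqr_ge0 // orbitE // expr2.
  have h := twist_bound cU sg%:C b t0.
  apply: le_trans (_ : rnorm b * (expR (- sg * t) * rnorm b) <= _).
    by apply: ler_pM; rewrite ?rnorm_ge0 // (csg_contr cV).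
  by rewrite mulrCA mulrC expr2.
have IVs : rintegrable (`[0, n%:R]%classic : set (measurableTypeR R))
    (fun t => rnorm (orbit V b t) ^+ 2) by exact: rintegrable_segment.
apply: le_trans (_ : expR 2 * \int[mu]_(t in `[0, n%:R]) (rnorm (orbit V b t) ^+ 2) <= _).
  have mseg : measurable (`[0, n%:R]%classic : set (measurableTypeR R)) by exact: measurable_itv.
  rewrite -(RintegralZl _ mseg IVs).
  apply: le_Rintegral => //.
  - exact: rintegrable_segment.
  - exact: rintegrableZ.
  - move=> t /=; rewrite in_itv /= => /andP[t0 tn].
    rewrite !orbitE // /V /twist rnormZ rnorm_cexpt exprMn mulrA ler_peMl ?sqr_ge0 //=.
    rewrite -expRM_natl -expRD -[leLHS]expR0 ler_expR.
    have : sg * t <= 1.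
      by rewrite mulrC ler_pdivrMr // mul1r; apply: le_trans tn _; rewrite lerDl.
    by rewrite mulNr -mulr_natl; lra.
rewrite ler_wpM2l ?expR_ge0 // ler_pdivlMr //; apply: le_trans hE.
rewrite ler_wpM2r ?(ltW c1) //.
by apply: ge0_ray_integral_fin IV _ => t _; exact: sqr_ge0.
Qed.

End PlancherelBound.

(** * Resolvents and the Hardy space hypotheses *)

Section LinearSystems.
Context (R : realType) (H : completeNormedModType R[i]).
Context (dot : {dot H for Num.conj}).
Hypothesis H_hilbert : forall v : H, `|v| ^+ 2 = dot v v.
Hypothesis H_separable : separable H.
Implicit Types u v : H.
Local Notation C := R[i].
Local Notation ip := (inner dot).
Local Notation mu := (@lebesgue_measure R).
Local Notation rintegrable E f := (mu.-integrable E (EFin \o f)).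
Context (S : R -> {linear H -> H}).
Hypothesis S_semigroup : contraction_semigroup S.

Lemma semigroup_csg : csg (fun t v => S t v).
Proof.
have [h0 hD hc hcont] := S_semigroup.
split=> //.
- by move=> t _ a u v; rewrite linearP.
- by move=> t v t0; rewrite -ler_rnormE hc.
move=> v e e0.
have /continuous_within_itvcyP[_] := hcont v.
move=> /cvg_rnormP /(_ e e0); rewrite h0 => -[d /= d0 hd].
exists d => // h hh hd'.
have [->|h1] := eqVneq h 0; first by rewrite h0 subrr rnorm0.
rewrite rnormB; apply: hd => /=; first by rewrite sub0r normrN ger0_norm.
by rewrite lt_neqAle eq_sym h1.
Qed.

Context (D : set H) (A : H -> H).
Hypothesis A_linear : linear_operator D A.
Hypothesis A_accretive : accretive dot D A.
Hypothesis S_generator : generates D (fun v => - A v) S.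

(** The Laplace transform solves the resolvent equation by [laplace_generator]. Accretivity makes
    the solution unique: a difference [w] of solutions has [A w = - s w], so [- Re s |w|^2] would be
    nonnegative. *)
Lemma resolvent_laplace (s : C) v L : 0 < complex.Re s ->
  (forall w, ip L w = cintegral `[0, +oo[ (fun t => ip (orbit (twist s (fun t v => S t v)) v t) w)) ->
  resolvent D A s v = L.
Proof.
move=> s0 hL.
have [DL AL] : D L /\ - A L = s *: L - v.
  apply/S_generator; apply/cvg_rnormP => e e0.
  have e2 : 0 < e / 2 by rewrite divr_gt0.
  have [d d0 hd] := laplace_generator H_hilbert H_separable semigroup_csg s0 hL e2.
  exists d => //= h; rewrite /= sub0r normrN => hhd h0.
  rewrite gtr0_norm // in hhd.
  have := hd h; rewrite h0 hhd => /(_ isT) k.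
  have -> : s *: L - v - (h^-1)%:C *: (S h L - L) =
      - ((h^-1)%:C *: (S h L - L - h%:C *: (s *: L - v))).
    rewrite [in RHS]scalerBr scalerA -rmorphM mulVf ?lt0r_neq0 // scale1r opprB.
    by rewrite addrC.
  rewrite rnormN rnormZ rnorm_realc gtr0_norm ?invr_gt0 // mulrC ltr_pdivrMr //.
  by apply: le_lt_trans k _; rewrite ltr_pM2r //; lra.
have eqL : s *: L + A L = v by rewrite -[A L]opprK AL opprB addrC subrK.
rewrite /resolvent; case: xgetP => [u _ [Du Au]|/(_ L)]; last by case.
have [D0 lin] := A_linear.
have [Dw Aw] := lin (-1) L u DL Du.
rewrite !scaleN1r in Dw Aw; set w := - L + u in Dw Aw.
have Aw' : A w = - (s *: w).
  apply/eqP; rewrite Aw -addr_eq0 /w scalerDr scalerN; apply/eqP.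
  have E1 : A L = v - s *: L by rewrite -eqL addrAC subrr add0r.
  have E2 : A u = v - s *: u by rewrite -Au addrAC subrr add0r.
  by rewrite E1 E2; apply: (dot_inj H_hilbert) => z; rewrite !(dotDl, dotNl, dotZl, dot0l); ring.
have := A_accretive Dw; rewrite Aw' -[dot _ _]/(ip _ _) dotNl dotZl dotvv // ReN ReM /= mulr0 subr0.
rewrite oppr_ge0 pmulr_rle0 // => w2.
have w0 : rnorm w = 0 by apply/eqP; rewrite -sqrf_eq0 eq_le w2 sqr_ge0.
by apply/eqP; rewrite -subr_eq0 addrC; apply/eqP/rnorm_eq0.
Qed.

Let hardy_bound (E : normedModType C) (F : C -> E) : hardy2 F -> exists M : R,
  forall sg, 0 < sg -> (\int[mu]_w (rnorm (F (sg +i* w)) ^+ 2)%:E <= M%:E)%E.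
Proof.
case=> _; set X := [set _ | _ in _]; move=> sup_fin.
have F0 sg : (0 <= \int[mu]_w (rnorm (F (sg +i* w)) ^+ 2)%:E)%E.
  by apply: integral_ge0 => w _; rewrite lee_fin sqr_ge0.
have ub sg : 0 < sg -> (\int[mu]_w (rnorm (F (sg +i* w)) ^+ 2)%:E <= ereal_sup X)%E.
  by move=> sg0; apply: ereal_sup_ubound; exists sg.
have sup_num : ereal_sup X \is a fin_num.
  by rewrite ge0_fin_numE //; apply: le_trans (F0 1) (ub 1 ltr01).
by exists (fine (ereal_sup X)) => sg sg0; rewrite fineK // ub.
Qed.

Lemma control_square_integrable b : hardy2 (fun s => resolvent D A s b) ->
  rintegrable (`[0, +oo[%classic : set (measurableTypeR R))
    (fun t => rnorm (orbit (fun t v => S t v) b t) ^+ 2).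
Proof.
move=> /hardy_bound[M hM].
apply: (orbit_square_integrable H_hilbert H_separable
  (L := fun sg w => resolvent D A (sg +i* w) b) (M := M) semigroup_csg (or_introl erefl)).
  move=> sg w u sg0.
  have s0 : 0 < complex.Re (sg +i* w) by [].
  have [L hL] := laplace_exists H_hilbert H_separable semigroup_csg s0 b.
  by rewrite (resolvent_laplace s0 hL) hL.
by move=> sg sg0; under eq_integral do rewrite mul1r; exact: hM.
Qed.

Lemma cexpt_conj (s : C) t : cexpt (conjc s) t = conjc (cexpt s t).
Proof.
by case: s => x y; rewrite /cexpt /= [- y * t]mulNr cosN sinN; apply: complex_eqP => /=; ring.
Qed.

(** The functional [F s] is represented by the Laplace transform of the adjoint orbit at the
    conjugate of [s], hence the sign [-1]. Its operator norm is the norm of the representing vector,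
    attained at that vector normalized. *)
Lemma observation_square_integrable (Us : R -> H -> H) (c : H) (F : C -> dual H) :
  csg Us -> (forall t u v, 0 <= t -> ip (S t u) v = ip u (Us t v)) ->
  (forall s, 0 < complex.Re s -> forall v, F s v = ip (resolvent D A s v) c) -> hardy2 F ->
  rintegrable (`[0, +oo[%classic : set (measurableTypeR R))
    (fun t => rnorm (orbit Us c t) ^+ 2).
Proof.
move=> cUs adj hF /hardy_bound[M hM].
have ex (p : R * R) : exists L, 0 < p.1 -> forall u, ip L u =
    cintegral `[0, +oo[ (fun t => ip (orbit (twist (p.1 +i* p.2) Us) c t) u).
  case: p => sg w /=; have [sg0|sg0] := ltP 0 sg; last by exists 0.
  have s0 : 0 < complex.Re (sg +i* w) by [].
  by have [L hL] := laplace_exists H_hilbert H_separable cUs s0 c; exists L.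
have [Lp hLp] := choice ex; pose L sg w := Lp (sg, w).
have hL sg w u : 0 < sg -> ip (L sg w) u =
    cintegral `[0, +oo[ (fun t => ip (orbit (twist (sg +i* w) Us) c t) u).
  by move=> sg0; exact: hLp.
apply: (orbit_square_integrable H_hilbert H_separable (L := L) (eps := -1) (M := M)
  cUs (or_intror erefl) hL).
move=> sg sg0.
suff nE w : rnorm (L sg (-1 * w)) = rnorm (F (sg +i* w)).
  by under eq_integral do rewrite nE; exact: hM.
have FL v : F (sg +i* w) v = ip v (L sg (-1 * w)).
  have s0 : 0 < complex.Re (sg +i* w) by [].
  have [Lv hv] := laplace_exists H_hilbert H_separable semigroup_csg s0 v.
  have s1 : 0 < complex.Re (sg +i* (-1 * w)) by [].
  have Iz := laplace_integrable H_hilbert cUs s1 c v.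
  rewrite hF // (resolvent_laplace s0 hv) hv dotC hL // -(cintegral_conj (measurable_itv _) Iz).
  apply: eq_cintegral => t; rewrite /= in_itv /= andbT => t0.
  rewrite !orbitE // /twist dotZl adj // -dotC dotZr.
  rewrite -(cexpt_conj (sg +i* (-1 * w))); congr (cexpt _ _ * _).
  by rewrite /conjc mulN1r opprK.
have -> : rnorm (F (sg +i* w)) = opnorm (F (sg +i* w)) by [].
apply/eqP; rewrite eq_le; apply/andP; split; last first.
  apply: opnorm_le => v v1; rewrite FL; apply: le_trans (cauchy_schwarz H_hilbert _ _) _.
  by rewrite ler_piMl ?rnorm_ge0.
set z := L sg _ in FL *.
have [->|z0] := eqVneq (rnorm z) 0.
  apply: le_trans (opnorm_ub (F (sg +i* w)) (v := 0) _); first exact: rnorm_ge0.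
  by rewrite rnorm0.
have z1 : 0 < rnorm z by rewrite lt_neqAle eq_sym z0 rnorm_ge0.
have := opnorm_ub (F (sg +i* w)) (v := (rnorm z)^-1%:C *: z).
rewrite FL dotZl dotvv // rnormZ rnormM !rnorm_realc ger0_norm ?invr_ge0 ?rnorm_ge0 //.
rewrite mulVf // ger0_norm ?sqr_ge0 // expr2 mulrA mulVf // mul1r; exact.
Qed.

End LinearSystems.

(** * Integrals of rank one operators *)

Section IntegralOfRankOnes.
Context (R : realType) (H : completeNormedModType R[i]).
Context (dot : {dot H for Num.conj}).
Hypothesis H_hilbert : forall v : H, `|v| ^+ 2 = dot v v.
Hypothesis H_separable : separable H.
Implicit Types u v w z : H.
Local Notation C := R[i].
Local Notation ip := (inner dot).
Local Notation mu := (@lebesgue_measure R).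
Local Notation form := (H -> H -> C).
Local Notation nuclear := (nuclear dot).
Local Notation rank1 := (rank_one dot).

Lemma pow2_small (d e : R) : 0 < e -> exists k : nat, d / 2 ^+ k <= e.
Proof.
move=> e0; exists (Num.bound `|d / e|).
have h : d / e < (Num.bound `|d / e|)%:R.
  by apply: le_lt_trans (archi_boundP (normr_ge0 _)); exact: ler_norm.
rewrite ler_pdivrMr ?exprn_gt0 // -ler_pdivrMl // mulrC; apply: ltW; apply: lt_trans h _.
by rewrite -natrX ltr_nat ltn_expl.
Qed.

Context (f g : R -> H) (cf : rcont f) (cg : rcont g).
Context (al be Mg : R).
Hypothesis g_bound : forall t, al <= t <= be -> rnorm (g t) <= Mg.

Definition rank_one_integral (a b : R) : form :=
  fun v w => cintegral `[a, b] (fun t => rank1 (f t) (g t) v w).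

Let seg a d : set (measurableTypeR R) := `[a, a + d]%classic.
Let m_seg a d : measurable (seg a d). Proof. exact: measurable_itv. Qed.

Section Halving.
Context (G : R -> R -> H).
Hypothesis hG : forall a d w, 0 <= d -> ip (G a d) w = cintegral (seg a d) (fun t => ip (g t) w).

Let cell (a d : R) := [/\ 0 <= d, al <= a & a + d <= be].

Let cell_l a d : cell a d -> cell a (d / 2).
Proof. by move=> [d0 aa db]; split=> //; lra. Qed.

Let cell_r a d : cell a d -> cell (a + d / 2) (d / 2).
Proof. by move=> [d0 aa db]; split; lra. Qed.

Let cell_in a d t : cell a d -> a <= t <= a + d -> al <= t <= be.
Proof. by move=> [d0 aa db] /andP[h1 h2]; apply/andP; split; lra. Qed.

Let cg_ip w : rcont (fun t => ip (g t) w).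
Proof. by apply: rcont_dot => //; exact: rcont_cst. Qed.

Let c_rank1 v w z : rcont (fun t => rank1 (f t - z) (g t) v w).
Proof.
apply: rcontM; first by apply: rcont_dot => //; exact: rcont_cst.
by apply: rcont_dot => //; [apply: rcontD => //; exact: rcont_cst|exact: rcont_cst].
Qed.

Let halves (a d : R) : a + d / 2 + d / 2 = a + d.
Proof. by rewrite -addrA -splitr. Qed.

Let G_halves (a d : R) : 0 <= d -> G a d = G a (d / 2) + G (a + d / 2) (d / 2).
Proof.
move=> d0; have d2 : 0 <= d / 2 by rewrite divr_ge0.
apply: (dot_inj H_hilbert) => w; rewrite dotDl !hG // /seg halves.
by apply: cintegral_itv_split; [rewrite lerDl|rewrite lerD2l; lra|exact: cg_ip].
Qed.

Let Mg_ge0 a d : cell a d -> 0 <= Mg.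
Proof.
move=> [d0 aa db]; apply: le_trans (rnorm_ge0 (g a)) (g_bound _); rewrite aa /=; lra.
Qed.

Let G_bound a d : cell a d -> rnorm (G a d) <= Mg * d.
Proof.
move=> ad; have [d0 aa db] := ad.
have h : rnorm (ip (G a d) (G a d)) <= Mg * d * rnorm (G a d).
  rewrite {1}hG //.
  have -> : Mg * d * rnorm (G a d) = \int[mu]_(t in seg a d) (Mg * rnorm (G a d)).
    by rewrite itv_cst_integral ?lerDl // addrC addKr mulrAC.
  apply: cintegral_le => //.
  - by apply: cintegrable_segment.
  - move=> t; rewrite /seg /= in_itv /= => tad.
    apply: le_trans (cauchy_schwarz H_hilbert _ _) _.
    by rewrite ler_wpM2r ?rnorm_ge0 // g_bound // (cell_in ad).
  - by apply: rintegrable_segment => t; exact: cst_continuous.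
have [->|n0] := eqVneq (rnorm (G a d)) 0; first by rewrite mulr_ge0 // (Mg_ge0 ad).
have n1 : 0 < rnorm (G a d) by rewrite lt_neqAle eq_sym n0 rnorm_ge0.
by move: h; rewrite dotvv // rnorm_realc ger0_norm ?sqr_ge0 // expr2 ler_pM2r.
Qed.

(** A Riemann sum on [2 ^ m] cells with [f] frozen at left endpoints and [g] integrated exactly, so
    that only the oscillation of [f] enters the errors. Dyadic cells let refinement be proved by
    recursion. *)
Fixpoint halving_sum (a d : R) m : form :=
  if m is k.+1 then
    fun v w => halving_sum a (d / 2) k v w + halving_sum (a + d / 2) (d / 2) k v w
  else rank1 (f a) (G a d).
Local Notation ap := halving_sum.

Let rank1B a a' b v w : rank1 a b v w - rank1 a' b v w = rank1 (a - a') b v w.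
Proof. by rewrite /rank_one dotBl; ring. Qed.

(** Freezing [f] on a cell costs its distance to [z] times the norm of the integral of [g]; these
    costs add up to the length of the interval. *)
Let ap_osc a d z e m : cell a d ->
  (forall t, a <= t <= a + d -> rnorm (f t - z) <= e) ->
  nuclear (fun v w => ap a d m v w - rank1 z (G a d) v w) (e * Mg * d).
Proof.
elim: m a d => [|m IH] a d ad osc; have [d0 aa db] := ad.
  apply: (nuclear_weak (r := rnorm (f a - z) * rnorm (G a d))).
    by apply: (nuclear_eq _ (nuclear_rank1 dot (f a - z) (G a d))) => v w; rewrite -rank1B.
  rewrite -mulrA; apply: ler_pM; rewrite ?rnorm_ge0 ?G_bound //.
  by apply: osc; rewrite lexx lerDl.
have d2 : 0 <= d / 2 by rewrite divr_ge0.
have h1 := IH _ _ (cell_l ad); have h2 := IH _ _ (cell_r ad).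
apply: (nuclear_weak (r := e * Mg * (d / 2) + e * Mg * (d / 2))); last first.
  by rewrite -mulrDr -splitr.
apply: (nuclear_eq (phi := fun v w => (ap a (d / 2) m v w - rank1 z (G a (d / 2)) v w) +
  (ap (a + d / 2) (d / 2) m v w - rank1 z (G (a + d / 2) (d / 2)) v w))).
- by move=> v w /=; rewrite (G_halves a d0) /rank_one dotDr; ring.
apply: (nuclearD H_hilbert); [apply: h1|apply: h2].
- by move=> t /andP[h3 h4]; apply: osc; rewrite h3 /=; lra.
- by move=> t /andP[h3 h4]; apply: osc; apply/andP; split; lra.
Qed.

Let ap_refine a d dl e k m : cell a d ->
  (forall s t, al <= s <= be -> al <= t <= be -> `|s - t| <= dl -> rnorm (f s - f t) <= e) ->
  d / 2 ^+ k <= dl ->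
  nuclear (fun v w => ap a d (k + m) v w - ap a d k v w) (e * Mg * d).
Proof.
move=> + unif; elim: k a d => [|k IH] a d ad sc; have [d0 aa db] := ad.
  apply: (ap_osc _ ad) => t tad; have tin := cell_in ad tad.
  apply: unif => //; first by rewrite aa /=; lra.
  by move: sc; rewrite expr0 divr1; apply: le_trans; case/andP: tad => h1 h2;
    rewrite ger0_norm; lra.
have sc2 : d / 2 / 2 ^+ k <= dl by rewrite -mulrA -invfM -exprS.
apply: (nuclear_weak (r := e * Mg * (d / 2) + e * Mg * (d / 2))); last first.
  by rewrite -mulrDr -splitr.
apply: (nuclear_eq _ (nuclearD H_hilbert (IH _ _ (cell_l ad) sc2) (IH _ _ (cell_r ad) sc2))).
by move=> v w /=; ring.
Qed.

Let integral_osc a d z e v w : cell a d ->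
  (forall t, a <= t <= a + d -> rnorm (f t - z) <= e) ->
  rnorm (rank_one_integral a (a + d) v w - rank1 z (G a d) v w) <=
  e * Mg * d * (rnorm v * rnorm w).
Proof.
move=> ad osc; have [d0 aa db] := ad.
have Ir z' : cintegrable (seg a d) (fun t => rank1 (f t - z') (g t) v w).
  exact: cintegrable_segment.
have -> : rank_one_integral a (a + d) v w - rank1 z (G a d) v w =
    cintegral (seg a d) (fun t => rank1 (f t - z) (g t) v w).
  apply/eqP; rewrite subr_eq; apply/eqP.
  have -> : rank1 z (G a d) v w = cintegral (seg a d) (fun t => ip z w * ip v (g t)).
    rewrite /rank_one dotC hG // mulrC.
    rewrite -(cintegral_conj (m_seg a d) (cintegrable_segment _ _ (cg_ip v))).
    rewrite -cintegralZ //; first by apply: eq_cintegral => t _; rewrite -dotC.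
    apply: cintegrable_conj => //; exact: cintegrable_segment.
  rewrite -cintegralD //.
    by apply: eq_cintegral => t _; rewrite /rank_one dotBl; ring.
  apply: cintegrableZ => //; apply: cintegrable_segment.
  by apply: rcont_dot => //; exact: rcont_cst.
have -> : e * Mg * d * (rnorm v * rnorm w) =
    \int[mu]_(t in seg a d) (e * Mg * (rnorm v * rnorm w)).
  by rewrite itv_cst_integral ?lerDl // addrC addKr mulrAC.
apply: cintegral_le => //; last by apply: rintegrable_segment => t; exact: cst_continuous.
move=> t; rewrite /seg /= in_itv /= => tad.
apply: le_trans (rnorm_rank1 H_hilbert _ _ _ _) _.
rewrite ler_wpM2r ?mulr_ge0 ?rnorm_ge0 //; apply: ler_pM; rewrite ?rnorm_ge0 ?osc //.
by rewrite g_bound // (cell_in ad).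
Qed.

Let integral_refine a d dl e k v w : cell a d ->
  (forall s t, al <= s <= be -> al <= t <= be -> `|s - t| <= dl -> rnorm (f s - f t) <= e) ->
  d / 2 ^+ k <= dl ->
  rnorm (rank_one_integral a (a + d) v w - ap a d k v w) <= e * Mg * d * (rnorm v * rnorm w).
Proof.
move=> + unif; elim: k a d => [|k IH] a d ad sc; have [d0 aa db] := ad.
  apply: (integral_osc _ _ ad) => t tad; have tin := cell_in ad tad.
  apply: unif => //; first by rewrite aa /=; lra.
  by move: sc; rewrite expr0 divr1; apply: le_trans; case/andP: tad => h1 h2;
    rewrite ger0_norm; lra.
have d2 : 0 <= d / 2 by rewrite divr_ge0.
have sc2 : d / 2 / 2 ^+ k <= dl by rewrite -mulrA -invfM -exprS.
have c0 : rcont (fun t => rank1 (f t) (g t) v w).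
  by apply: rcontM; apply: rcont_dot => //; exact: rcont_cst.
have -> : rank_one_integral a (a + d) v w = rank_one_integral a (a + d / 2) v w +
    rank_one_integral (a + d / 2) (a + d / 2 + d / 2) v w.
  by rewrite halves; apply: cintegral_itv_split => //; [rewrite lerDl|rewrite lerD2l; lra].
have -> : e * Mg * d * (rnorm v * rnorm w) = e * Mg * (d / 2) * (rnorm v * rnorm w) +
  e * Mg * (d / 2) * (rnorm v * rnorm w) by field.
rewrite /= opprD addrACA; apply: le_trans (ler_cnormD _ _) _.
by apply: lerD; apply: IH => //; [exact: cell_l|exact: cell_r].
Qed.

Lemma rank_one_integral_nuclear_aux (Mf eta : R) : al <= be ->
  (forall t, al <= t <= be -> rnorm (f t) <= Mf) -> 0 < eta ->
  (forall e : R, 0 < e -> exists2 dl : R, 0 < dl & forall s t,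
     al <= s <= be -> al <= t <= be -> `|s - t| <= dl -> rnorm (f s - f t) <= e) ->
  nuclear (rank_one_integral al be) ((Mf + eta) * Mg * (be - al)).
Proof.
move=> ab fb eta0 unif; pose d := be - al.
have ad : cell al d by split => //; rewrite /d; lra.
have [d0 _ _] := ad; have Mg0 := Mg_ge0 ad.
(* Tolerances with total at most [eta]: successive refinements form a telescoping nuclear series
   whose first term costs [Mf] and whose remainder costs [eta]. *)
pose ep j : R := eta / 2 ^+ j.+1.
have ep0 j : 0 < ep j by rewrite divr_gt0 // exprn_gt0.
have ex (j : nat) : exists k : nat, exists2 dl : R, d / 2 ^+ k <= dl &
    forall s t, al <= s <= be -> al <= t <= be -> `|s - t| <= dl -> rnorm (f s - f t) <= ep j.
  have [dl dl0 h] := unif _ (ep0 j).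
  by have [k hk] := pow2_small d dl0; exists k, dl.
have [k hk] := choice ex.
(* Partial sums make the depths nondecreasing while keeping each at least the required [k j]. *)
pose K j := (\sum_(i < j.+1) k i)%N.
have KS j : K j.+1 = (K j + k j.+1)%N by rewrite /K big_ord_recr.
have kK j : (k j <= K j)%N by rewrite /K big_ord_recr leq_addl.
have hK j : exists2 dl : R, d / 2 ^+ K j <= dl &
    forall s t, al <= s <= be -> al <= t <= be -> `|s - t| <= dl -> rnorm (f s - f t) <= ep j.
  have [dl h1 h2] := hk j; exists dl => //; apply: le_trans h1.
  rewrite ler_wpM2l // lef_pV2 ?posrE ?exprn_gt0 // ler_weXn2l //; lra.
pose psi j : form := if j is i.+1 then fun v w => ap al d (K i.+1) v w - ap al d (K i) v w
  else ap al d (K 0).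
pose r j := if j is i.+1 then ep i * Mg * d else Mf * Mg * d.
have sum_psi n v w : \sum_(i < n.+1) psi i v w = ap al d (K n) v w.
  elim: n => [|n IH]; first by rewrite big_ord1.
  by rewrite big_ord_recr IH /= addrC subrK.
have sum_ep n : \sum_(i < n) ep i = eta - eta / 2 ^+ n.
  elim: n => [|n IH]; first by rewrite big_ord0 expr0 divr1 subrr.
  rewrite big_ord_recr IH /= /ep exprS; field.
  by rewrite expf_neq0.
apply: (nuclear_series H_hilbert (phi := psi) (r := r)).
- case=> [|j] /=.
    have osc t : al <= t <= al + d -> rnorm (f t - 0) <= Mf.
      by move=> tad; rewrite subr0; apply: fb; exact: cell_in ad tad.
    apply: nuclear_eq (ap_osc (K 0) ad osc) => v w.
    by rewrite /rank_one dot0l mulr0 subr0.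
  by have [dl h1 h2] := hK j; rewrite KS; exact: ap_refine ad h2 h1.
- case=> [|n]; first by rewrite big_ord0 !mulr_ge0 // addr_ge0 ?(ltW eta0) //;
    apply: le_trans (rnorm_ge0 (f al)) (fb _ _); rewrite lexx.
  rewrite big_ord_recl /= /bump /=.
  have -> : \sum_(i < n) r (1 + i)%N = (\sum_(i < n) ep i) * (Mg * d).
    by rewrite mulr_suml; apply: eq_bigr => i _; rewrite add1n /= mulrA.
  rewrite sum_ep -!mulrA -mulrDl ler_wpM2r ?mulr_ge0 // lerD2l gerBl.
  by rewrite divr_ge0 ?(ltW eta0) // exprn_ge0.
- move=> v w e e0; pose L := Mg * d * (rnorm v * rnorm w) + 1.
  have L0 : 0 < L by rewrite ltr_wpDl // !mulr_ge0 ?rnorm_ge0.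
  have [N hN] := pow2_small eta (divr_gt0 e0 (mulr_gt0 (ltr0n R 2) L0)).
  exists N.+1 => -[//|n] Nn; rewrite sum_psi.
  have [dl h1 h2] := hK n; have := integral_refine v w ad h2 h1.
  rewrite /d [al + _]addrC subrK -/d => h; apply: le_lt_trans h _.
  have epn : ep n <= e / (2 * L).
    apply: le_trans hN; rewrite /ep ler_wpM2l ?(ltW eta0) // lef_pV2 ?posrE ?exprn_gt0 //.
    by rewrite ler_weXn2l ?ler1n // ltnW.
  rewrite -[ep n * Mg * d]mulrA -mulrA; apply: le_lt_trans (_ : e / (2 * L) * L < _).
    apply: ler_pM => //; first exact: ltW.
      by rewrite !mulr_ge0 ?rnorm_ge0.
    by rewrite /L lerDl.
  by rewrite invfM mulrA divfK ?lt0r_neq0 //; lra.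
Qed.

End Halving.

Lemma rank_one_integral_nuclear (Mf eta : R) : al <= be ->
  (forall t, al <= t <= be -> rnorm (f t) <= Mf) -> 0 < eta ->
  (forall e : R, 0 < e -> exists2 dl : R, 0 < dl & forall s t,
     al <= s <= be -> al <= t <= be -> `|s - t| <= dl -> rnorm (f s - f t) <= e) ->
  nuclear (rank_one_integral al be) ((Mf + eta) * Mg * (be - al)).
Proof.
have ex (p : R * R) : exists u, forall w,
    ip u w = cintegral (seg p.1 p.2) (fun t => ip (g t) w).
  case: p => a d /=.
  have Ig w : cintegrable (seg a d) (fun t => ip (g t) w).
    by apply: cintegrable_segment; apply: rcont_dot => //; exact: rcont_cst.
  have [//||u [hu _]] := weak_integral H_hilbert H_separable (m_seg a d) Ig
    (g := fun t => rnorm (g t)); last by exists u.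
  by apply: rintegrable_segment; exact: rcont_rnorm.
have [G hG] := choice ex.
by apply: (rank_one_integral_nuclear_aux (G := fun a d => G (a, d))) => a d w _; exact: hG.
Qed.

End IntegralOfRankOnes.

(** * The form of $R_x$: nuclearity and first order expansion in $x$ *)

Section OrbitPairs.
Context (R : realType) (H : completeNormedModType R[i]).
Context (dot : {dot H for Num.conj}).
Hypothesis H_hilbert : forall v : H, `|v| ^+ 2 = dot v v.
Hypothesis H_separable : separable H.
Implicit Types u v w z : H.
Local Notation C := R[i].
Local Notation ip := (inner dot).
Local Notation mu := (@lebesgue_measure R).
Local Notation form := (H -> H -> C).
Local Notation nuclear := (nuclear dot).
Local Notation rank1 := (rank_one dot).
Local Notation rintegrable E f := (mu.-integrable E (EFin \o f)).
Local Notation RM := (measurableTypeR R).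

Lemma ray_tail (a : R) (f : R -> R) : (forall t, a <= t -> 0 <= f t) -> continuous f ->
  rintegrable (`[a, +oo[%classic : set RM) f -> forall e : R, 0 < e ->
  exists N : nat, forall n, (N <= n)%N -> \int[mu]_(t in `[a + n%:R, +oo[) f t <= e.
Proof.
move=> f0 cf If e e0; set I := \int[mu]_(t in `[a, +oo[) f t.
have split n : I = \int[mu]_(t in `[a, a + n%:R]) f t + \int[mu]_(t in `[a + n%:R, +oo[) f t.
  by apply: ray_split If; rewrite lerDl.
have [N hN] : exists N : nat, I - e < \int[mu]_(t in `[a, a + N%:R]) f t.
  apply: contrapT => no.
  have [n|_] := ge0_ray_integral_bound (M := I - e) f0 cf.
    by rewrite leNgt; apply/negP => h; apply: no; exists n.
  rewrite -/I; lra.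
exists N => n Nn.
have : \int[mu]_(t in `[a, a + N%:R]) f t <= \int[mu]_(t in `[a, a + n%:R]) f t.
  have aN : a <= a + N%:R by rewrite lerDl.
  have Nn' : a + N%:R <= a + n%:R by rewrite lerD2l ler_nat.
  rewrite [leRHS](itv_split aN Nn' cf) lerDl; apply: Rintegral_ge0 => t.
  by rewrite /= in_itv /= => /andP[h _]; apply: f0; apply: le_trans h.
have := split n; lra.
Qed.

Context (U Us : R -> H -> H) (cU : csg U) (cUs : csg Us) (b c : H).
Local Notation bt := (orbit U b).
Local Notation ct := (orbit Us c).
Hypothesis b_int : rintegrable (`[0, +oo[%classic : set RM) (fun t => rnorm (bt t) ^+ 2).
Hypothesis c_int : rintegrable (`[0, +oo[%classic : set RM) (fun t => rnorm (ct t) ^+ 2).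

Let cb : rcont bt. Proof. exact: orbit_rcont. Qed.
Let cc : rcont ct. Proof. exact: orbit_rcont. Qed.

Lemma orbit_contr (V : R -> H -> H) v t : csg V -> rnorm (orbit V v t) <= rnorm v.
Proof. by move=> cV; apply: csg_contr; rewrite // le_max lexx orbT. Qed.

Lemma orbit_decr (V : R -> H -> H) v s t : csg V -> 0 <= s -> s <= t ->
  rnorm (orbit V v t) <= rnorm (orbit V v s).
Proof. by move=> cV s0 st; rewrite !orbitE ?(le_trans s0) //; exact: csg_norm_decr. Qed.

Lemma orbit_unif (V : R -> H -> H) v (e : R) : csg V -> 0 < e ->
  exists2 dl : R, 0 < dl & forall s t, `|s - t| <= dl -> rnorm (orbit V v s - orbit V v t) <= e.
Proof.
move=> cV e0; have [d d0 hd] := csg_cont0 cV v e0.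
exists (d / 2); first by rewrite divr_gt0.
move=> s t st; apply: le_trans (csg_modulus v cV _ _) _; rewrite ?le_max ?lexx ?orbT //.
apply/ltW/hd => //; apply: le_lt_trans (max0_dist _ _) _; apply: le_lt_trans st _; lra.
Qed.

Let pt t := rnorm (bt t) * rnorm (ct t).

Let c_pt : continuous pt.
Proof. by move=> t; apply: cvgM; [exact: (rcont_rnorm cb)|exact: (rcont_rnorm cc)]. Qed.

Let pt_ge0 t : 0 <= pt t. Proof. by rewrite mulr_ge0 ?rnorm_ge0. Qed.

Lemma orbit_product_integrable x : 0 <= x -> rintegrable (`[x, +oo[%classic : set RM) pt.
Proof.
move=> x0; apply: ray_integrableS x0 _.
have mray : measurable (`[0%R, +oo[%classic : set RM) by exact: measurable_itv.
apply: (rintegrable_le mray (measurable_continuous mray c_pt) _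
  (rintegrableD mray b_int c_int)) => t _; rewrite ger0_norm // /pt.
have := sqr_ge0 (rnorm (bt t) - rnorm (ct t)).
have := sqr_ge0 (rnorm (bt t) + rnorm (ct t)).
have := rnorm_ge0 (bt t); have := rnorm_ge0 (ct t); nra.
Qed.

Definition ray_form (x : R) : form :=
  fun v w => cintegral `[x, +oo[ (fun t => rank1 (bt t) (ct t) v w).

Let c_rank v w : rcont (fun t => rank1 (bt t) (ct t) v w).
Proof. by apply: rcontM; apply: rcont_dot => //; exact: rcont_cst. Qed.

Let rank_le v w t : rnorm (rank1 (bt t) (ct t) v w) <= rnorm v * rnorm w * pt t.
Proof. by rewrite mulrC; exact: rnorm_rank1. Qed.

Let I_pt x k : 0 <= x -> rintegrable (`[x, +oo[%classic : set RM) (fun t => k * pt t).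
Proof. by move=> x0; apply: rintegrableZ; [exact: measurable_itv|exact: orbit_product_integrable]. Qed.

Lemma ray_form_integrable x v w : 0 <= x ->
  cintegrable (`[x, +oo[%classic : set RM) (fun t => rank1 (bt t) (ct t) v w).
Proof.
move=> x0; apply: (cintegrable_le (measurable_itv _) (c_rank v w) _ (I_pt (rnorm v * rnorm w) x0)).
by move=> t _; exact: rank_le.
Qed.

Lemma ray_form_split x y v w : 0 <= x -> x <= y ->
  ray_form x v w = rank_one_integral dot bt ct x y v w + ray_form y v w.
Proof. by move=> x0 xy; apply: cintegral_ray_split => //; exact: ray_form_integrable. Qed.

(** On the unit interval from [xk k] monotonicity of the two norms gives the bound [r k]. Each
    product of norms at the left end of an interval is at most the integral over the preceding
    interval, the first excepted, and the slacks [2 ^ - (k + 1)] add up to at most [rnorm c]. *)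
Lemma ray_form_nuclear x : 0 <= x -> exists r, nuclear (ray_form x) r.
Proof.
move=> x0; pose xk (k : nat) := x + k%:R.
have xk0 k : 0 <= xk k by rewrite addr_ge0.
have xkS k : xk k.+1 = xk k + 1 by rewrite /xk -natr1 addrA.
have xkB k : xk k.+1 - xk k = 1 by rewrite xkS addrAC subrr add0r.
have xk_le k : xk k <= xk k.+1 by rewrite xkS lerDl.
pose r k := (rnorm (bt (xk k)) + 2^-1 ^+ k.+1) * rnorm (ct (xk k)).
pose P := \int[mu]_(t in `[x, +oo[) pt t.
exists (rnorm b * rnorm c + P + rnorm c).
apply: (nuclear_series H_hilbert
  (phi := fun k => rank_one_integral dot bt ct (xk k) (xk k.+1)) (r := r)).
- move=> k; have -> : r k = (rnorm (bt (xk k)) + 2^-1 ^+ k.+1) * rnorm (ct (xk k)) *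
    (xk k.+1 - xk k) by rewrite xkB mulr1.
  apply: rank_one_integral_nuclear => //.
  + by move=> t /andP[h _]; exact: orbit_decr.
  + by move=> t /andP[h _]; exact: orbit_decr.
  + move=> e e0; have [dl dl0 h] := orbit_unif b cU e0.
    by exists dl => // s t _ _; exact: h.
- move=> K; have pt_step k : pt (xk k.+1) <= \int[mu]_(t in `[xk k, xk k.+1]) pt t.
    have -> : pt (xk k.+1) = \int[mu]_(t in `[xk k, xk k.+1]) (pt (xk k.+1)).
      by rewrite itv_cst_integral // xkB mulr1.
    apply: le_Rintegral; rewrite ?measurable_itv //.
    + by apply: rintegrable_segment => t; exact: cst_continuous.
    + exact: rintegrable_segment.
    + move=> t /=; rewrite in_itv /= => /andP[h1 h2].
      have t0 : 0 <= t by exact: le_trans h1.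
      by rewrite /pt; apply: ler_pM; rewrite ?rnorm_ge0 //; exact: orbit_decr.
  (* Carrying the next product on the left lets each step use the integral over the interval just
     passed. *)
  have inv : \sum_(k < K) r k + pt (xk K) <=
      rnorm b * rnorm c + \int[mu]_(t in `[x, xk K]) pt t + rnorm c * (1 - 2^-1 ^+ K).
    elim: K => [|K IH].
      rewrite big_ord0 add0r expr0 subrr mulr0 addr0.
      apply: le_trans (_ : rnorm b * rnorm c <= _).
        by rewrite /pt; apply: ler_pM; rewrite ?rnorm_ge0 // orbit_contr.
      by rewrite lerDl; apply: Rintegral_ge0 => t _.
    have xxK : x <= xk K by rewrite lerDl.
    rewrite big_ord_recr /= (itv_split xxK (xk_le K) c_pt).
    have h1 := pt_step K.
    have h2 : r K <= pt (xk K) + 2^-1 ^+ K.+1 * rnorm c.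
      by rewrite /r mulrDl lerD2l ler_wpM2l ?exprn_ge0 ?invr_ge0 // orbit_contr.
    have h3 : 2^-1 ^+ K = 2^-1 ^+ K.+1 + 2^-1 ^+ K.+1 :> R.
      by rewrite exprS; lra.
    move: IH; rewrite h3 => IH; lra.
  have h1 : \int[mu]_(t in `[x, xk K]) pt t <= P.
    by apply: ge0_ray_integral_fin => [t _|]; [exact: pt_ge0|exact: orbit_product_integrable].
  have h2 : rnorm c * (1 - 2^-1 ^+ K) <= rnorm c.
    by rewrite ler_piMr ?rnorm_ge0 // gerBl exprn_ge0 // invr_ge0.
  have := pt_ge0 (xk K); lra.
- move=> v w e e0; pose L := rnorm v * rnorm w + 1.
  have L0 : 0 < L by rewrite ltr_wpDl // mulr_ge0 ?rnorm_ge0.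
  have e1 : 0 < e / (2 * L) by rewrite divr_gt0 // mulr_gt0.
  have [t _|N hN] := ray_tail _ c_pt (orbit_product_integrable x0) e1; first exact: pt_ge0.
  exists N => n Nn.
  have xxn k : x <= xk k by rewrite lerDl.
  have -> : \sum_(k < n) rank_one_integral dot bt ct (xk k) (xk k.+1) v w =
      rank_one_integral dot bt ct x (xk n) v w.
    elim: (n) => [|m IH].
      rewrite big_ord0 /xk addr0; apply/esym/eqP.
      have := ray_form_split v w x0 (lexx x).
      by move/eqP; rewrite -subr_eq0 opprD addrA addrAC subrr add0r oppr_eq0.
    rewrite big_ord_recr /= IH; apply/esym.
    exact: (cintegral_itv_split (xxn m) (xk_le m) (c_rank v w)).
  rewrite (ray_form_split v w x0 (xxn n)) addrC addKr.
  apply: le_lt_trans (_ : \int[mu]_(t in `[xk n, +oo[) (rnorm v * rnorm w * pt t) < _).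
    apply: cintegral_le; [exact: measurable_itv|exact: ray_form_integrable| |exact: I_pt].
    by move=> t _; exact: rank_le.
  rewrite RintegralZl; [|exact: measurable_itv|exact: orbit_product_integrable].
  apply: le_lt_trans (_ : L * (e / (2 * L)) < _).
    apply: ler_pM; [by rewrite mulr_ge0 ?rnorm_ge0|by apply: Rintegral_ge0 => t _| |exact: hN].
    by rewrite lerDl.
  by rewrite mulrC invfM mulrA divfK ?lt0r_neq0 //; lra.
Qed.

(* [(b_t - b_x) (x) c_t] and [b_x (x) (c_t - c_x)] are both uniformly small. *)
Lemma rank_one_integral_expansion x (e : R) : 0 < e -> exists2 dl : R, 0 < dl &
  forall al be, al <= x <= be -> be - al <= dl ->
  nuclear (fun v w => rank_one_integral dot bt ct al be v w -
                      (be - al)%:C * rank1 (bt x) (ct x) v w) (e * (be - al)).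
Proof.
(* The weight [2] of [rnorm c] covers the oscillation of [bt] and the equal slack [eta] of
   [rank_one_integral_nuclear]. *)
move=> e0; pose L := 2 * rnorm c + rnorm b + 1.
have L0 : 0 < L by rewrite ltr_wpDl // addr_ge0 ?mulr_ge0 ?rnorm_ge0.
have e1 : 0 < e / L by rewrite divr_gt0.
have [d1 d10 h1] := orbit_unif b cU e1; have [d2 d20 h2] := orbit_unif c cUs e1.
exists (Num.min d1 d2); first by rewrite lt_min d10.
move=> al be /andP[ax xb]; rewrite le_min => /andP[ab1 ab2].
have ab : al <= be by exact: le_trans xb.
have near t : al <= t <= be -> `|t - x| <= be - al.
  by move=> /andP[? ?]; rewrite ler_norml; apply/andP; split; lra.
pose seg : set RM := `[al, be]%classic.
have mseg : measurable seg by exact: measurable_itv.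
have cf : rcont (fun t => bt t - bt x) by apply: rcontD => //; exact: rcont_cst.
have cg : rcont (fun t => ct t - ct x) by apply: rcontD => //; exact: rcont_cst.
have N1 : nuclear (rank_one_integral dot (fun t => bt t - bt x) ct al be)
    ((e / L + e / L) * rnorm c * (be - al)).
  apply: rank_one_integral_nuclear => //.
  - by move=> t _; exact: orbit_contr.
  - by move=> t tin; apply: h1; apply: le_trans (near t tin) _.
  - move=> k k0; have [dl dl0 h] := orbit_unif b cU k0; exists dl => // s t _ _ st.
    by rewrite opprB addrA subrK; exact: h.
have Ig w : cintegrable seg (fun t => ip (ct t - ct x) w).
  by apply: cintegrable_segment; apply: rcont_dot => //; exact: rcont_cst.
have [t||u [hu ub]] := weak_integral H_hilbert H_separable mseg Ig (g := fun=> e / L).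
- rewrite /seg /= in_itv /= => tin; apply: h2; exact: le_trans (near t tin) _.
- by apply: rintegrable_segment => t; exact: cst_continuous.
rewrite itv_cst_integral // in ub.
have N2 := nuclear_rank1 dot (bt x) u.
apply: (nuclear_weak (r := (e / L + e / L) * rnorm c * (be - al) + rnorm (bt x) * rnorm u)); last first.
  have h3 : rnorm (bt x) * rnorm u <= rnorm b * (e / L * (be - al)).
    by apply: ler_pM; rewrite ?rnorm_ge0 // orbit_contr.
  apply: le_trans (lerD (lexx _) h3) _.
  have -> : (e / L + e / L) * rnorm c * (be - al) + rnorm b * (e / L * (be - al)) =
    e * (be - al) * ((2 * rnorm c + rnorm b) / L) by ring.
  by rewrite ler_piMr ?mulr_ge0 ?(ltW e0) ?subr_ge0 // ler_pdivrMr // mul1r lerDl.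
apply: nuclear_eq (nuclearD H_hilbert N1 N2) => v w.
have Iv : cintegrable seg (fun t => ip v (ct t)).
  by apply: cintegrable_segment; apply: rcont_dot => //; exact: rcont_cst.
have Ivx : cintegrable seg (fun t => ip v (ct x)).
  by apply: cintegrable_segment; exact: rcont_cst.
have cstI : cintegral seg (fun t => ip v (ct x)) = (be - al)%:C * ip v (ct x).
  by apply: complex_eqP; rewrite /= itv_cst_integral //; case: (ip v (ct x)) => p q /=; ring.
have vu : ip v u = cintegral seg (fun t => ip v (ct t)) - (be - al)%:C * ip v (ct x).
  rewrite dotC hu -(cintegral_conj mseg (Ig v)) -cstI.
  have -> : cintegral seg (fun t => conjc (ip (ct t - ct x) v)) =
      cintegral seg (fun t => ip v (ct t) + -1 * ip v (ct x)).
    by apply: eq_cintegral => t _; rewrite -dotC dotBr mulN1r.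
  by rewrite (cintegralD mseg Iv (cintegrableZ (-1) mseg Ivx)) (cintegralZ (-1) mseg Ivx) mulN1r.
have If : cintegrable seg (fun t => rank1 (bt t - bt x) (ct t) v w).
  by apply: cintegrable_segment; apply: rcontM; apply: rcont_dot => //; exact: rcont_cst.
have -> : rank_one_integral dot bt ct al be v w =
    cintegral seg (fun t => rank1 (bt t - bt x) (ct t) v w + ip (bt x) w * ip v (ct t)).
  by apply: eq_cintegral => t _; rewrite /rank_one dotBl; ring.
rewrite (cintegralD mseg If (cintegrableZ (ip (bt x) w) mseg Iv)).
by rewrite (cintegralZ (ip (bt x) w) mseg Iv) /rank_one vu /rank_one_integral /rank_one -/seg; ring.
Qed.

End OrbitPairs.

(** * The operators of the linear system *)

Section FredholmDeterminants.
Context (R : realType) (H : completeNormedModType R[i]).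
Context (dot : {dot H for Num.conj}).
Hypothesis H_hilbert : forall v : H, `|v| ^+ 2 = dot v v.
Hypothesis H_separable : separable H.
Implicit Types u v w : H.
Local Notation ip := (inner dot).

Lemma continuous_linear_bound (V W : normedModType R[i]) (l : {linear V -> W}) : continuous l ->
  exists2 M : R, 0 <= M & forall v : V, rnorm (l v) <= M * rnorm v.
Proof.
move=> cl.
have [M [Mr HM]] := (linear_boundedP l).1 (@continuous_linear_bounded _ _ _ 0 l (cl 0)).
have M1 : M < `|M| + 1 by rewrite (le_lt_trans (real_ler_norm Mr)) // ltrDl ltr01.
have M0 : 0 <= `|M| + 1 by rewrite addr_ge0 // ler01.
have ME : `|M| + 1 = (complex.Re (`|M| + 1))%:C.
  by move: M0; case: (`|M| + 1) => p q; rewrite lecE /= => /andP[/eqP -> _].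
exists (complex.Re (`|M| + 1)); first by move: M0; rewrite {1}ME ler0c.
by move=> v; have := HM _ M1 v; rewrite ME !rnormE -rmorphM lecR.
Qed.

Lemma rnorm_le_dual u (M : R) : 0 <= M -> (forall w, rnorm (ip u w) <= M * rnorm w) -> rnorm u <= M.
Proof.
move=> M0 /(_ u); rewrite dotvv // rnorm_realc ger0_norm ?sqr_ge0 // expr2.
have [->//|u0] := eqVneq (rnorm u) 0.
by rewrite ler_pM2r // lt_neqAle eq_sym u0 rnorm_ge0.
Qed.

(** The form of the tail is bounded by [t n |v| |w|] uniformly in [w], which upgrades weak
    convergence of the sums to convergence in norm. *)
Lemma nuclear_trace_class (T : H -> H) r : nuclear dot (fun v w => ip (T v) w) r ->
  trace_class dot T.
Proof.
move=> [a [b ab]]; have [t [t0 tn tlim]] := nuclear_tail ab.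
exists a, b; split.
  apply: nondecreasing_is_cvgn.
    by apply: nondecreasing_series => n _ _; rewrite mulr_ge0 ?rnorm_ge0.
  exists r => _ [n _ <-]; rewrite /series /= big_mkord; exact: ab.1.
move=> v; apply/tendsP => e e0.
have v1 : 0 < rnorm v + 1 by rewrite ltr_wpDl ?rnorm_ge0.
have [|N hN] := tlim (e / (rnorm v + 1)); first by rewrite divr_gt0.
exists N => n Nn; apply: le_lt_trans (_ : t n * rnorm v < _).
  apply: rnorm_le_dual => [|w]; first by rewrite mulr_ge0 ?rnorm_ge0.
  have := nuclear_bound H_hilbert v w (tn n); rewrite mulrA; apply: le_trans.
  rewrite /series /= big_mkord dotBl dot_suml.
  by under [X in _ - X]eq_bigr do rewrite dotZl.
have := hN n Nn; rewrite ltr_pdivlMr //; apply: le_lt_trans.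
by rewrite ler_wpM2l ?lerDl.
Qed.

(** Existence of an orthonormal basis is what makes the value unique: the condition in
    [is_fredholm_det] ranges over all bases and would be vacuous without one. *)
Lemma fredholm_detP (T : H -> H) r : nuclear dot (fun v w => ip (T v) w) r ->
  forall e, orthonormal_basis dot e ->
  tends (fun n => form_det e n (fun v w => ip (T v) w)) (fredholm_det dot T).
Proof.
move=> Tr; have eb := orthonormal_basis_exists H_hilbert H_separable.
have [d hd] := form_det_cvg H_hilbert Tr eb.
have dT : is_fredholm_det dot T d.
  split; first exact: nuclear_trace_class Tr.
  by move=> e be; apply/tendsP; exact: hd.
suff -> : fredholm_det dot T = d by [].
rewrite /fredholm_det; case: xgetP => [d' _ [_ hd']|/(_ d)]; last by case.
have [e be] := eb; apply: tends_unique (hd e be).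
by have /tendsP := hd' e be.
Qed.

End FredholmDeterminants.

(** * The Gelfand-Levitan equation and the expansion of the determinant *)

Section GelfandLevitan.
Context (R : realType) (H : completeNormedModType R[i]).
Context (dot : {dot H for Num.conj}).
Hypothesis H_hilbert : forall v : H, `|v| ^+ 2 = dot v v.
Hypothesis H_separable : separable H.
Implicit Types u v w : H.
Local Notation ip := (inner dot).
Local Notation mu := (@lebesgue_measure R).
Local Notation RM := (measurableTypeR R).
Local Notation rintegrable E f := (mu.-integrable E (EFin \o f)).
Context (S : R -> {linear H -> H}) (S_semigroup : contraction_semigroup S).
Context (B : {linear R[i] -> H}) (C : {linear H -> R[i]}) (c : H).
Hypothesis hC : forall u, C u = ip u c.
Context (Us : R -> H -> H) (cUs : csg Us).
Hypothesis adj : forall t u v, 0 <= t -> ip (S t u) v = ip u (Us t v).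
Let U (t : R) (v : H) : H := S t v.
Let cU : csg U. Proof. exact: semigroup_csg. Qed.
Let b := B 1.
Local Notation bt := (orbit U b).
Local Notation ct := (orbit Us c).
Hypothesis b_int : rintegrable (`[0, +oo[%classic : set RM) (fun t => rnorm (bt t) ^+ 2).
Hypothesis c_int : rintegrable (`[0, +oo[%classic : set RM) (fun t => rnorm (ct t) ^+ 2).

Lemma Rop_integrand t v : 0 <= t -> S t (B (C (S t v))) = ip v (ct t) *: bt t.
Proof.
move=> t0; rewrite !orbitE // /U /b hC adj //.
by rewrite -[X in B X]mulr1 [B _]linearZ linearZ.
Qed.

(** Exhibits a Bochner integral, so that [bochner] does not fall back on its default; any vector it
    may select has the same pairings. *)
Lemma Rop_form x v w : 0 <= x -> ip (Rop dot S B C x v) w = ray_form dot U Us b c x v w.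
Proof.
move=> x0; pose ray : set RM := `[x, +oo[%classic.
have mray : measurable ray by exact: measurable_itv.
have ray0 t : ray t -> 0 <= t.
  by rewrite /ray /= in_itv /= andbT; exact: le_trans.
have cb : rcont bt by exact: orbit_rcont.
have cc : rcont ct by exact: orbit_rcont.
have Ip := orbit_product_integrable cU cUs b_int c_int x0.
pose f t := ip v (ct t) *: bt t.
have fb t : rnorm (f t) <= rnorm v * (rnorm (bt t) * rnorm (ct t)).
  rewrite /f rnormZ [rnorm (bt t) * _]mulrC mulrA ler_wpM2r ?rnorm_ge0 //.
  exact: cauchy_schwarz.
have Iw z : cintegrable ray (fun t => ip (f t) z).
  have := ray_form_integrable H_hilbert cU cUs b_int c_int v z x0.
  by apply: eq_cintegrable => // t _; rewrite /f dotZl.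
have [t _||u [hu _]] := weak_integral H_hilbert H_separable mray Iw
   (g := fun t => rnorm v * (rnorm (bt t) * rnorm (ct t))).
- exact: fb.
- exact: rintegrableZ.
have ub : is_bochner dot ray (fun t => S t (B (C (S t v)))) u.
  split.
  - move=> z; apply: eq_cintegrable (Iw z) => // t /ray0 t0.
    by rewrite Rop_integrand.
  - have cn : continuous (fun t => rnorm (f t)).
      have -> : (fun t => rnorm (f t)) = (fun t => rnorm (ip v (ct t)) * rnorm (bt t)).
        by apply/funext => t; rewrite /f rnormZ.
      have cv : rcont (fun t => ip v (ct t)) by apply: rcont_dot => //; exact: rcont_cst.
      by move=> t; apply: cvgM; [exact: (rcont_rnorm cv)|exact: (rcont_rnorm cb)].
    have In : rintegrable ray (fun t => rnorm (f t)).
      apply: (rintegrable_le mray (measurable_continuous mray cn) _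
        (rintegrableZ (rnorm v) mray Ip)) => t _.
      by rewrite ger0_norm ?rnorm_ge0.
    have /integrableP[_] := In; apply: le_lt_trans.
    rewrite le_eqVlt; apply/orP; left; apply/eqP; apply: eq_integral => t /set_mem /ray0 t0.
    by rewrite /= ger0_norm ?rnorm_ge0 // Rop_integrand.
  - move=> z; rewrite -[dot _ _]/(ip _ _) hu; apply: eq_cintegral => t /ray0 t0.
    by rewrite Rop_integrand.
rewrite /Rop /bochner; case: xgetP => [u' _ [_ _ hu']|/(_ u)]; last by case.
rewrite -[LHS]/(dot u' w) hu' /ray_form; apply: eq_cintegral => t /ray0 t0.
by rewrite Rop_integrand // -[dot _ _]/(ip _ _) dotZl.
Qed.

Context (x : R) (x_ge0 : 0 <= x) (J : {linear H -> H}) (J_cont : continuous J).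
Hypothesis J_left : cancel (I_Rop dot S B C x) J.
Hypothesis J_right : cancel J (I_Rop dot S B C x).

Lemma opinvE v : opinv (I_Rop dot S B C x) v = J v.
Proof.
rewrite /opinv; case: xgetP => [u _ <-|/(_ (J v))]; first by rewrite J_left.
by case; exact: J_right.
Qed.

(** With [k] representing [u |-> - C (S x (J u))], the integrand is the integrand of [R_x] tested at
    [S y b] and [k], so the integral is [- C (S x (J (R_x (S y b))))]. *)
Lemma gelfand_levitan y : 0 <= y ->
  cintegrable (`[x, +oo[%classic : set RM)
    (fun z => TGL dot S B C x z * impulse S B C (z + y)) /\
  impulse S B C (x + y) + TGL dot S B C x y +
    cintegral `[x, +oo[ (fun z => TGL dot S B C x z * impulse S B C (z + y)) = 0.
Proof.
move=> y0; have [_ SD _ _] := S_semigroup.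
have [M M0 hM] := continuous_linear_bound J_cont.
have [||k hk] := riesz H_hilbert H_separable (l := fun u => - C (S x (J u))) (M := M * rnorm c).
- by move=> a u v; rewrite !hC 2!linearP dotDl dotZl; ring.
- move=> u; rewrite cnormN hC; apply: le_trans (cauchy_schwarz H_hilbert _ _) _.
  rewrite mulrAC ler_wpM2r ?rnorm_ge0 //; apply: le_trans (hM u).
  exact: (csg_contr cU).
have TE z : TGL dot S B C x z = ip (S z b) k by rewrite /TGL opinvE hk.
have phiE z : 0 <= z -> impulse S B C (z + y) = ip (S y b) (Us z c).
  by move=> z0; rewrite /impulse SD // hC adj.
pose ray : set RM := `[x, +oo[%classic.
have mray : measurable ray by exact: measurable_itv.
have E z : ray z -> TGL dot S B C x z * impulse S B C (z + y) = rank_one dot (bt z) (ct z) (S y b) k.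
  rewrite /ray /= in_itv /= andbT => xz; have z0 : 0 <= z by exact: le_trans xz.
  by rewrite TE phiE // /rank_one !orbitE // mulrC.
have I := ray_form_integrable H_hilbert cU cUs b_int c_int (S y b) k x_ge0.
split; first by apply: eq_cintegrable I => // z /E ->.
rewrite (eq_cintegral E) -/(ray_form dot U Us b c x (S y b) k) -Rop_form // -hk TE -hk.
(* Then [J R_x = I - J] splits the integral into the two remaining terms of the equation. *)
have -> : Rop dot S B C x (S y b) = I_Rop dot S B C x (S y b) - S y b.
  by rewrite /I_Rop addrC addKr.
rewrite [J (_ - _)]linearB /= J_left 2!linearB /= /impulse SD //.
by rewrite /b; ring.
Qed.

Let d (y : R) : R[i] := fredholm_det dot (Rop dot S B C y).

Let Rop_nuclear y : 0 <= y -> exists r, nuclear dot (fun v w => ip (Rop dot S B C y v) w) r.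
Proof.
move=> y0; have [r hr] := ray_form_nuclear H_hilbert H_separable cU cUs b_int c_int y0.
by exists r; apply: nuclear_eq hr => v w; rewrite Rop_form.
Qed.

Lemma Rop_det_neq0 : d x != 0.
Proof.
have [e be] := orthonormal_basis_exists H_hilbert H_separable.
have [r hr] := Rop_nuclear x_ge0; have [M M0 hM] := continuous_linear_bound J_cont.
apply: (form_det_neq0 H_hilbert be hr _ hM M0 J_left); last exact: fredholm_detP hr e be.
by move=> a u v; rewrite linearP.
Qed.

Lemma Rop_det_expansion (e : R) : 0 < e -> exists2 dl : R, 0 < dl & forall h,
  `|h| < dl -> 0 <= x + h ->
  rnorm (d (x + h) - d x * (1 + h%:C * TGL dot S B C x x)) <= e * `|h|.
Proof.
move=> e0; have [bs hbs] := orthonormal_basis_exists H_hilbert H_separable.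
have [r hr] := Rop_nuclear x_ge0.
pose K := det_bound (r + rnorm (bt x) * rnorm (ct x) + 1 + 1).
have K0 : 0 < K by exact: det_bound_gt0.
pose e1 := Num.min 1 (e / K).
have e10 : 0 < e1 by rewrite lt_min ltr01 divr_gt0.
have e11 : e1 <= 1 by rewrite ge_min lexx.
have e1K : e1 * K <= e by rewrite -ler_pdivlMr // ge_min lexx orbT.
have [dl dl0 hdl] := rank_one_integral_expansion H_hilbert H_separable cU cUs b c x e10.
exists (Num.min 1 dl); first by rewrite lt_min ltr01.
move=> h; rewrite lt_min => /andP[h1 hd] xh.
(* The remainder of the first order expansion. For [h < 0] the segment is [[x + h, x]], which is
   covered because the base point may be either endpoint. *)
pose rho v w := ray_form dot U Us b c (x + h) v w - ray_form dot U Us b c x v w +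
  h%:C * rank_one dot (bt x) (ct x) v w.
have rho_nuclear : nuclear dot rho (e1 * `|h|).
  have [h0|h0] := leP 0 h.
    have xxh : x <= x + h by rewrite lerDl.
    have hE : x + h - x = h by rewrite addrAC subrr add0r.
    have := hdl x (x + h); rewrite hE lexx xxh -{1}[h]ger0_norm // (ltW hd) ger0_norm //.
    move=> /(_ isT isT)/nuclearN; apply: nuclear_eq => v w.
    rewrite /rho (ray_form_split H_hilbert cU cUs b_int c_int v w x_ge0 xxh); ring.
  have xhx : x + h <= x by rewrite gerDl ltW.
  have hE : x - (x + h) = - h by rewrite opprD addrA subrr add0r.
  have := hdl (x + h) x; rewrite hE lexx xhx -(ltr0_norm h0) (ltW hd) => /(_ isT isT).
  apply: nuclear_eq => v w.
  rewrite /rho (ray_form_split H_hilbert cU cUs b_int c_int v w xh xhx) ltr0_norm //.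
  by rewrite rmorphN; ring.
have [r' hr'] := Rop_nuclear xh.
have s1 : e1 * `|h| <= 1 by rewrite mulr_ile1 // ?(ltW e10) // ltW.
have J_lin : additive_fun J by move=> a u v; rewrite linearP.
have psiE v w : ip (Rop dot S B C (x + h) v) w = ip (Rop dot S B C x v) w -
    h%:C * rank_one dot (bt x) (ct x) v w + rho v w.
  by rewrite !Rop_form // /rho; ring.
have TE : TGL dot S B C x x = - ip (J (bt x)) (ct x).
  by rewrite /TGL opinvE hC adj // !orbitE.
have -> : 1 + h%:C * TGL dot S B C x x = 1 - h%:C * ip (J (bt x)) (ct x).
  by rewrite TE mulrN.
apply: le_trans (fredholm_det_derivative H_hilbert hbs hr J_lin
  (fredholm_detP H_hilbert H_separable hr hbs) J_right (ltW h1) s1 rho_nuclear psiE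
  (fredholm_detP H_hilbert H_separable hr' hbs)) _.
by rewrite -/K mulrAC ler_wpM2r.
Qed.

End GelfandLevitan.

(** * Logarithmic derivatives *)

Section ComplexLogarithm.
Context (R : realType).
Local Notation C := R[i].

Lemma cexpD (z w : C) : cexp (z + w) = cexp z * cexp w.
Proof.
case: z w => [a b] [x y]; rewrite /cexp /= expRD cosD sinD.
by apply: complex_eqP => /=; ring.
Qed.

Lemma cexp_ex (z : C) : z != 0 -> exists l, cexp l = z.
Proof.
move=> z0; have r0 : 0 < rnorm z.
  rewrite lt_neqAle rnorm_ge0 andbT eq_sym; apply: contra_neq z0; exact: rnorm_eq0.
pose a := complex.Re z / rnorm z; pose b := complex.Im z / rnorm z.
have ab : a ^+ 2 + b ^+ 2 = 1.
  by rewrite !expr_div_n -mulrDl -rnorm_sqrE divff // expf_neq0 // lt0r_neq0.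
have a1 : -1 <= a <= 1.
  by rewrite -ler_norml normrM normfV (gtr0_norm r0) ler_pdivrMr // mul1r Re_le_rnorm.
have ca : cos (acos a) = a by rewrite acosK.
have sa : sin (acos a) = `|b| by rewrite sin_acos // -ab addrC addKr sqrtr_sqr.
(* [acos] gives a nonnegative sine, so the sign of [b] decides between [acos a] and its opposite. *)
have [t [ct st]] : exists t, cos t = a /\ sin t = b.
  have [b0|b0] := leP 0 b; first by exists (acos a); rewrite ca sa ger0_norm.
  by exists (- acos a); rewrite cosN sinN ca sa ltr0_norm // opprK.
exists (ln (rnorm z) +i* t); rewrite /cexp /= lnK ?posrE // ct st.
by apply: complex_eqP => /=; rewrite ?mul0r ?subr0 ?addr0 /a /b mulrC divfK ?lt0r_neq0.
Qed.

(* A logarithm only on the right half-plane. *)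
Definition clog (z : C) : C := ln (rnorm z) +i* atan (complex.Im z / complex.Re z).

Lemma clogK (z : C) : 0 < complex.Re z -> cexp (clog z) = z.
Proof.
move=> a0; set a := complex.Re z in a0 *; set b := complex.Im z.
have r0 : 0 < rnorm z.
  by apply: lt_le_trans a0 _; apply: le_trans (Re_le_rnorm z); exact: ler_norm.
have ct : cos (atan (b / a)) = a / rnorm z.
  have E : 1 + (b / a) ^+ 2 = (rnorm z / a) ^+ 2.
    by rewrite !expr_div_n rnorm_sqrE -/a -/b; field; rewrite lt0r_neq0.
  by rewrite cos_atan E sqrtr_sqr gtr0_norm ?divr_gt0 // invf_div.
have st : sin (atan (b / a)) = b / rnorm z.
  have := atanK (b / a); rewrite /tan => /(congr1 ( *%R^~ (cos (atan (b / a))))).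
  rewrite divfK; last by rewrite ct mulf_neq0 ?invr_neq0 ?lt0r_neq0.
  by rewrite ct mulrA divfK ?lt0r_neq0 // => ->.
rewrite /cexp /clog /= -/a -/b lnK ?posrE // ct st.
apply: complex_eqP; rewrite /= ?mul0r ?subr0 ?addr0 [LHS]mulrC divfK ?lt0r_neq0 //.
Qed.

Lemma clog1 : clog 1 = 0.
Proof. by rewrite /clog rnorm1 ln1 /= mul0r atan0. Qed.

Lemma clog_derivative (e : R) : 0 < e -> exists2 d : R, 0 < d & forall z : C,
  rnorm z < d -> rnorm (clog (1 + z) - z) <= e * rnorm z.
Proof.
move=> e0; have e8 : 0 < e / 8 by rewrite divr_gt0.
have D1 : is_derive (0 : R) 1 (fun h : R => ln (1 + h)) 1.
  have l10 : 0 < 1 + 0 :> R by rewrite addr0.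
  have := is_derive1_ln l10 => ?.
  by apply: is_derive_eq; rewrite /GRing.scale /= addr0 invr1; ring.
have D2 : is_derive (0 : R) 1 (fun h : R => atan h) 1.
  by apply: is_derive_eq; rewrite /GRing.scale /= expr0n addr0 invr1.
have [d1 d10 h1] := is_derive_eps D1 e8; have [d2 d20 h2] := is_derive_eps D2 e8.
exists (Num.min (Num.min (1 / 2) (e / 8)) (Num.min (d1 / 3) (d2 / 2))).
  by rewrite !lt_min !divr_gt0.
move=> z; rewrite !lt_min => /andP[/andP[n1 n2] /andP[n3 n4]].
set n := rnorm z in n1 n2 n3 n4 *; have n0 : 0 <= n by exact: rnorm_ge0.
set a : R := complex.Re z; set b : R := complex.Im z.
have an : `|a| <= n := Re_le_rnorm z.
have bn : `|b| <= n := Im_le_rnorm z.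
have nE : n ^+ 2 = a ^+ 2 + b ^+ 2 := rnorm_sqrE z.
have nn : n ^+ 2 <= n / 2 by rewrite expr2 ler_wpM2l // ltW // -div1r.
have /andP[am ap] : - n <= a <= n by rewrite -ler_norml.
have Rez : complex.Re (1 + z) = 1 + a by rewrite ReD.
have Imz : complex.Im (1 + z) = b by rewrite ImD /= add0r.
(* [1 + y] is the squared modulus of [1 + z], so the real part of the logarithm is [ln (1 + y) / 2]
   and no derivative of a square root is involved. *)
pose y := 2 * a + n ^+ 2.
have rE : rnorm (1 + z) ^+ 2 = 1 + y by rewrite rnorm_sqrE Rez Imz /y nE; ring.
have y1 : 0 < 1 + y by have := sqr_ge0 n; rewrite /y; lra.
have r0 : 0 < rnorm (1 + z).
  by rewrite lt_neqAle rnorm_ge0 andbT eq_sym -sqrf_eq0 rE; exact: lt0r_neq0.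
have yn : `|y| <= 3 * n.
  by rewrite /y ler_norml; have := sqr_ge0 n => ?; apply/andP; split; lra.
have ReE : `|ln (rnorm (1 + z)) - a| <= e / 8 * (3 * n) / 2 + n ^+ 2 / 2.
  have lE : ln (rnorm (1 + z)) = ln (1 + y) / 2.
    by rewrite -rE lnXn // -[_ *+ 2 in RHS]mulr_natr; field.
  have := h1 y; rewrite addr0 ln1 subr0 mul1r => h'.
  have /h' h : `|y| < d1 by apply: le_lt_trans yn _; lra.
  have h3 : e / 8 * `|y| <= e / 8 * (3 * n) by rewrite ler_wpM2l // ltW.
  have := le_trans h h3; rewrite lE !ler_norml /y => /andP[k1 k2].
  by have := sqr_ge0 n => ?; apply/andP; split; lra.
pose t := b / (1 + a).
have t1 : t * (1 + a) = b by rewrite /t divfK //; apply: lt0r_neq0; lra.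
have tn : `|t| <= 2 * n.
  have a1 : 0 < 1 + a by lra.
  rewrite /t normrM normfV (gtr0_norm a1) ler_pdivrMr //; apply: le_trans bn _.
  have h : n * 1 <= n * (2 * (1 + a)) by rewrite ler_wpM2l //; lra.
  by rewrite mulr1 mulrCA mulrA in h.
have at_le : `|t * a| <= 2 * n ^+ 2.
  by rewrite normrM expr2 mulrA; apply: ler_pM.
have ImE : `|atan t - b| <= e / 8 * (2 * n) + 2 * n ^+ 2.
  have := h2 t; rewrite atan0 subr0 mul1r => h'.
  have /h' h : `|t| < d2 by apply: le_lt_trans tn _; lra.
  have h3 : e / 8 * `|t| <= e / 8 * (2 * n) by rewrite ler_wpM2l // ltW.
  have := le_trans h h3; move: at_le; rewrite !ler_norml -t1 mulrDr mulr1.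
  move=> /andP[k1 k2] /andP[k3 k4]; apply/andP; split; lra.
apply: le_trans (rnorm_le_ReIm _) _.
rewrite ReD ImD ReN ImN /clog /= Rez Imz -/a -/b -/t.
have ne : n ^+ 2 <= e / 8 * n by rewrite expr2 ler_wpM2r // ltW.
apply: le_trans (lerD ReE ImE) _.
have := mulr_ge0 (ltW e8) n0; lra.
Qed.

(** The quotient [f y / f x] is near [1], where [clog] inverts [cexp]. Adding a fixed logarithm of
    [f x] gives a local determination with no global choice of branch. *)
Lemma log_derivative_expansion (f : R -> C) (x : R) (l : C) : f x != 0 -> 0 <= x ->
  (forall e : R, 0 < e -> exists2 d : R, 0 < d & forall h, `|h| < d -> 0 <= x + h ->
     rnorm (f (x + h) - f x * (1 + h%:C * l)) <= e * `|h|) ->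
  has_log_derivative f x l.
Proof.
move=> fx0 x0 fh; have [l0 hl0] := cexp_ex fx0.
have r0 : 0 < rnorm (f x).
  rewrite lt_neqAle rnorm_ge0 andbT eq_sym; apply: contra_neq fx0; exact: rnorm_eq0.
pose z h := f (x + h) / f x - 1.
have zE h : 1 + z h = f (x + h) / f x by rewrite /z addrC subrK.
have zh (e : R) : 0 < e -> exists2 d : R, 0 < d & forall h, `|h| < d -> 0 <= x + h ->
    rnorm (z h - h%:C * l) <= e * `|h|.
  move=> e0; have [|d d0 hd] := fh (e * rnorm (f x)); first by rewrite mulr_gt0.
  exists d => // h h1 h2; have := hd h h1 h2.
  have -> : f (x + h) - f x * (1 + h%:C * l) = f x * (z h - h%:C * l).
    by rewrite /z; field.
  by rewrite rnormM mulrC -mulrA [rnorm (f x) * _]mulrC mulrA ler_pM2r.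
pose lam := rnorm l + 1; have lam0 : 0 < lam by rewrite ltr_wpDl ?rnorm_ge0.
have [d1 d10 hd1] := zh 1 ltr01.
have z_le h : `|h| < d1 -> 0 <= x + h -> rnorm (z h) <= lam * `|h|.
  move=> h1 h2; have := hd1 h h1 h2; rewrite mul1r => k.
  rewrite -(subrK (h%:C * l) (z h)); apply: le_trans (ler_cnormD _ _) _.
  by rewrite rnormM rnorm_realc /lam mulrDl mul1r addrC lerD // mulrC.
exists (fun y => l0 + clog (f y / f x)); split.
  apply/near_realP; exists (Num.min d1 (1 / (2 * lam))).
    by rewrite lt_min d10 divr_gt0 // mulr_gt0.
  move=> y; rewrite lt_min => /andP[yd1 yd2] y0.
  have yE : x + (y - x) = y by rewrite addrC subrK.
  have := z_le (y - x); rewrite yE distrC => /(_ yd1 y0) k.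
  have zlt : rnorm (z (y - x)) <= 1 / 2.
    apply: le_trans k _; rewrite mulrC -ler_pdivlMr //.
    by apply: le_trans (ltW yd2) _; rewrite invfM mulrA.
  rewrite cexpD hl0 clogK; first by rewrite mulrC divfK.
  rewrite -[X in f X]yE -zE ReD /=.
  by have := le_trans (Re_le_rnorm _) zlt; rewrite ler_norml => /andP[? _]; lra.
apply/cvg_rnormP => e e0.
(* [z h] is at most [lam |h|], so the error of the logarithm costs at most [e / 4] per unit of
   [|h|]. *)
pose e1 := e / (4 * lam); have e10 : 0 < e1 by rewrite divr_gt0 // mulr_gt0.
have [d2 d20 hd2] := clog_derivative e10.
have [|d3 d30 hd3] := zh (e / 4); first by rewrite divr_gt0.
rewrite /within /=; near_simpl.
have dpos : 0 < Num.min d1 (Num.min (d2 / lam) d3) by rewrite !lt_min d10 d30 divr_gt0.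
exists (Num.min d1 (Num.min (d2 / lam) d3)) => //= h.
rewrite /ball_ /= sub0r normrN !lt_min => /and3P[h1 h2 h3] h0 xh.
have n0 : 0 < `|h| by rewrite normr_gt0.
rewrite divff // clog1 addr0 addrAC subrr add0r -zE.
have zd2 : rnorm (z h) < d2.
  by apply: le_lt_trans (z_le h h1 xh) _; rewrite mulrC -ltr_pdivlMr.
have k1 := hd2 (z h) zd2; have k2 := hd3 h h3 xh; have k3 := z_le h h1 xh.
have -> : l - (h^-1)%:C * clog (1 + z h) =
    - ((h^-1)%:C * ((clog (1 + z h) - z h) + (z h - h%:C * l))).
  have hh : (h^-1)%:C * h%:C = 1 :> C by rewrite -rmorphM mulVf.
  by rewrite -[in LHS](mul1r l) -hh; ring.
rewrite cnormN rnormM rnorm_realc normfV mulrC ltr_pdivrMr //.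
apply: le_lt_trans (ler_cnormD _ _) _.
have k4 : e1 * rnorm (z h) <= e / 4 * `|h|.
  apply: le_trans (_ : e1 * (lam * `|h|) <= _); first by rewrite ler_wpM2l // ltW.
  by rewrite mulrA /e1 invfM mulrA divfK ?lt0r_neq0.
have : e / 4 * `|h| + e / 4 * `|h| < e * `|h|.
  by rewrite -mulrDl ltr_pM2r //; lra.
lra.
Qed.

End ComplexLogarithm.

Theorem proposition6p3 (R : realType) (H : completeNormedModType R[i])
    (dot : {dot H for Num.conj})
    (H_hilbert : forall v : H, `|v| ^+ 2 = dot v v)
    (H_separable : separable H)
    (D : set H) (A : H -> H) (S : R -> {linear H -> H})
    (B : {linear R[i] -> H}) (C : {linear H -> R[i]})
    (B_bounded : continuous B) (C_bounded : continuous C)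
    (A_linear : linear_operator D A)
    (A_dense : dense D)
    (A_accretive : maximally_accretive dot D A)
    (S_semigroup : contraction_semigroup S)
    (S_generator : generates D (fun v => - A v) S)
    (C_hardy : exists F : R[i] -> dual H,
      (forall s, 0 < complex.Re s ->
         forall v, F s v = C (resolvent D A s v)) /\
      hardy2 F)
    (B_hardy : hardy2 (fun s => resolvent D A s (B 1)))
    (x : R) (x_ge0 : 0 <= x)
    (x_invertible : bounded_invertible (I_Rop dot S B C x)) :
  let phi := impulse S B C in
  let T := TGL dot S B C in
  (forall y, 0 <= y ->
     cintegrable `[x, +oo[ (fun z => T x z * phi (z + y)) /\
     phi (x + y) + T x y +
       cintegral `[x, +oo[ (fun z => T x z * phi (z + y)) = 0) /\
  has_log_derivative (fun x' => fredholm_det dot (Rop dot S B C x')) x (T x x).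
Proof.
move=> phi T.
have cS := semigroup_csg S_semigroup.
have [M M0 hM] := continuous_linear_bound C_bounded.
have [||c hC] := riesz H_hilbert H_separable (l := C) (M := M) => //.
  by move=> a u v; rewrite linearP.
(* The adjoint semigroup turns [C (S t v)] into the pairing of [v] with [Us t c], so control and
   observation both become orbits of contraction semigroups. *)
have [Us [cUs adj]] := adjoint_csg H_hilbert H_separable cS.
have b_int := control_square_integrable H_hilbert H_separable S_semigroup A_linear
  A_accretive.1 S_generator B_hardy.
have [F [FE F_hardy]] := C_hardy.
have c_int : (@lebesgue_measure R).-integrable (`[0, +oo[%classic : set (measurableTypeR R))
    (EFin \o (fun t => rnorm (orbit Us c t) ^+ 2)).
  apply: (observation_square_integrable H_hilbert H_separable S_semigroup A_linear
    A_accretive.1 S_generator cUs adj _ F_hardy) => s s0 v.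
  by rewrite FE // hC.
have [J [J_cont J_left J_right]] := x_invertible.
split; first exact: (gelfand_levitan H_hilbert H_separable S_semigroup hC cUs adj b_int c_int
  x_ge0 J_cont J_left J_right).
apply: log_derivative_expansion => //.
- exact: (Rop_det_neq0 H_hilbert H_separable S_semigroup hC cUs adj b_int c_int x_ge0
    J_cont J_left).
- exact: (Rop_det_expansion H_hilbert H_separable S_semigroup hC cUs adj b_int c_int x_ge0
    J_left J_right).
Qed.
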